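(* Let $\Pi_n$ be the coagulative dynamic permutation (CDP) on $[n]$, and for $v_0\in[n]$ let $(\mu^{n,v_0}(t))_t$ be the infinite-speed random walk (ISRW) on $\Pi_n$ started from $v_0$, with drop-down time $T^{\Downarrow}_{n,v_0}$ and total variation distance $\mathcal D_n^{v_0}(t)=d_{\mathrm{TV}}(\mu^{n,v_0}(t),\mathrm{Unif}([n]))$. Then, as $n\to\infty$: (1) Uniformly in $v_0\in[n]$, $T^{\Downarrow}_{n,v_0}/n$ converges in distribution to $s^{\Downarrow}$, where $s^{\Downarrow}$ is the $[0,1]$-valued random variable with distribution $\mathbb P(s^{\Downarrow}\le s)=\eta(s)$, $s\in[0,1]$. (2) Uniformly in $v_0\in[n]$, $(\mathcal D_n^{v_0}(sn))_{s\in[0,1]}$ converges in distribution to $\big(1-\eta(s)\mathbf 1_{\{s>s^{\Downarrow}\}}\big)_{s\in[0,1]}$ in the Skorokhod $M_1$-topology.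
   Context: $[n]=\{1,\dots,n\}$; $\gamma_v(\pi)$ is the cycle (as a set of elements) of the permutation $\pi$ of $[n]$ containing $v$. CDP: the random sequence $\Pi_n=(\Pi_n(t))_{t=0}^{n-1}$ of permutations of $[n]$ with $\Pi_n(0)=\mathrm{Id}$ and $\Pi_n(t)=\Pi_n(t-1)\circ(a,b)$ for $t\in\{1,\dots,n-1\}$, where at each step $(a,b)$ is sampled uniformly at random from all transpositions of $[n]$ with $\gamma_a(\Pi_n(t-1))\ne\gamma_b(\Pi_n(t-1))$. At time $n-1$ the permutation has a single cycle and the dynamics is trapped, i.e. $\Pi_n(t)=\Pi_n(n-1)$ for $t\ge n-1$. Non-integer times such as $sn$ are read as $\lfloor sn\rfloor$. ISRW started from $v_0$: the sequence of probability distributions $\mu^{n,v_0}(t)=(\mu^{n,v_0}_w(t))_{w\in[n]}$ with $\mu^{n,v_0}_w(0)=1/|\gamma_w(\Pi_n(0))|$ if $w\in\gamma_{v_0}(\Pi_n(0))$ and $0$ otherwise, and for $t\in\mathbb N$, $\mu^{n,v_0}_w(t)=\frac{1}{|\gamma_w(\Pi_n(t))|}\sum_{u\in\gamma_w(\Pi_n(t))}\mu^{n,v_0}_u(t-1)$. It is a (random) function of the realisation of $\Pi_n$. Associated graph process $A_{\Pi_n}$: $A_{\Pi_n}(0)$ is the empty graph on $[n]$; at time $t\ge1$ the edge $\{a,b\}$ is added, where $\Pi_n(t)=\Pi_n(t-1)\circ(a,b)$. $\mathscr C_{\max}(A_{\Pi_n}(t))$ is the set of vertices in the largest connected component of $A_{\Pi_n}(t)$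 (if not unique, all vertices in all the largest components). Drop-down time: fix any $\varepsilon_n>0$ with $\varepsilon_n=\omega(n^{-1/3})$ and $\varepsilon_n=o(1)$; then $T^{\Downarrow}_{n,v_0}=\inf\{t>\frac n2[1+\varepsilon_n]:\ \mathrm{supp}(\mu^{n,v_0}(t))\cap\mathscr C_{\max}(A_{\Pi_n}(t))\ne\emptyset\}$. Functions: $\zeta:[0,\infty)\to[0,1)$ is $0$ on $[0,\frac12]$ and, for $u>\frac12$, $\zeta(u)$ is the unique positive solution of $1-\zeta(u)=e^{-2u\zeta(u)}$. $\phi:[0,\infty)\to[0,1)$, $\phi(v)=\int_0^v[1-\zeta^2(u)]\,du$, is continuous and strictly increasing with $\phi(\infty)=1$. $\eta(w)=\zeta(\phi^{-1}(w))$ for $w\in[0,1)$, and $\eta(1)=1$ by continuity. *)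

(* Defs.v *)
(* MathComp / MathComp-Analysis development. *)
From HB Require Import structures.
From mathcomp Require Import all_boot all_order all_algebra all_fingroup.
From mathcomp Require Import all_classical all_reals all_analysis.

Set Implicit Arguments.
Unset Strict Implicit.
Unset Printing Implicit Defensive.

Import Order.TTheory GRing.Theory Num.Theory.
Import numFieldNormedType.Exports.

Local Open Scope classical_set_scope.
Local Open Scope ring_scope.

Section CoagulativeDynamicPermutation.
Context {R : realType} {n : nat}.
Implicit Types (s : 'S_n) (p : nat -> 'S_n) (v w a b : 'I_n).

(* The set [n] is represented by 'I_n, and the cycle of w in the permutation s
   by porbit s w. *)
Definition merging_transpositions s : {set 'S_n} :=
  [set tperm ab.1 ab.2 | ab : 'I_n * 'I_n & porbit s ab.1 != porbit s ab.2]%SET.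

(* Permutations of MathComp compose from left to right:
   ((tperm a b * s)%g x) = s (tperm a b x), i.e. tperm a b * s is s o (a,b). *)
Definition cdp_kernel s s' : R :=
  let M := merging_transpositions s in
  if M == finset.set0 then (s' == s)%:R
  else #|[set m in M | s' == (m * s)%g]%SET|%:R / #|M|%:R.

(* Joint law of (Pi 0, ..., Pi t): the Markov chain started from the identity
   with kernel cdp_kernel, which stays put once there is a single cycle. *)
Definition is_cdp {d} {T : measurableType d} (P : probability T R)
    (Pi : T -> nat -> 'S_n) : Prop :=
  (forall t s, measurable [set x | Pi x t = s]) /\
  (forall t p, P [set x | forall k, (k <= t)%N -> Pi x k = p k] =
     ((p 0%N == 1%g)%:R * \prod_(k < t) cdp_kernel (p k) (p k.+1))%:E).

Fixpoint isrw v0 p t : 'I_n -> R :=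
  match t with
  | 0 => fun w =>
      if w \in porbit (p 0%N) v0 then #|porbit (p 0%N) w|%:R^-1 else 0
  | t'.+1 => fun w =>
      #|porbit (p t'.+1) w|%:R^-1 *
      \sum_(u in porbit (p t'.+1) w) isrw v0 p t' u
  end.

Definition tv_dist (mu nu : 'I_n -> R) : R := 2^-1 * \sum_w `|mu w - nu w|.

Definition isrw_tv v0 p t : R :=
  tv_dist (isrw v0 p t) (fun=> n%:R^-1).

(* At step k+1 the chain moves from p k to p k o (a,b) exactly when a <> b and
   p k.+1 = tperm a b * p k; cdp_edge p t collects these edges for k < t. *)
Definition cdp_edge p t : rel 'I_n := fun a b =>
  [exists k : 'I_t, (a != b) && (p k.+1 == tperm a b * p k)%g].

Definition largest_components p t : {set 'I_n} :=
  [set v | [forall w, #|connect (cdp_edge p t) w|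
                        <= #|connect (cdp_edge p t) v|]%N]%SET.

Definition drop_down_time (eps : R) v0 p : R :=
  inf [set t%:R | t in [set t : nat | n%:R / 2 * (1 + eps) < t%:R /\
    exists w, isrw v0 p t w != 0 /\ w \in largest_components p t]].

End CoagulativeDynamicPermutation.

Section LimitFunctions.
Context {R : realType}.
Implicit Types u v w : R.

(* For u > 1/2 the set below is a singleton, and get selects its element. *)
Definition cdp_zeta u : R :=
  if u <= 2^-1 then 0
  else get [set z : R | 0 < z /\ 1 - z = expR (- (2 * u * z))].

Definition cdp_phi v : R :=
  \int[@lebesgue_measure R]_(u in `[0, v]) (1 - cdp_zeta u ^+ 2).

(* inverse of cdp_phi, which is a bijection from [0,+oo[ onto [0,1[ *)
Definition cdp_phi_inv w : R := get [set v : R | 0 <= v /\ cdp_phi v = w].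

Definition cdp_eta w : R := if w < 1 then cdp_zeta (cdp_phi_inv w) else 1.

End LimitFunctions.

(* The space D[0,1] with the M1 topology. A path is a function on [0,1] with
   one-sided limits, right-continuous at 0, whose value at an interior point
   lies between the two one-sided limits; the values outside [0,1] are
   irrelevant. Thus both the right-continuous and the left-continuous version
   of a path are admitted: they have the same completed graph, hence are at
   M1-distance 0 and topologically indistinguishable. *)
Section SkorokhodM1.
Context {R : realType}.

Definition lim_left (x : R -> R) (t : R) : R :=
  if 0 < t then lim (x @ t^'-) else x t.

Definition lim_right (x : R -> R) (t : R) : R :=
  if t < 1 then lim (x @ t^'+) else x t.

Definition between (a b z : R) : Prop := Num.min a b <= z <= Num.max a b.

Record is_path (x : R -> R) : Prop := IsPath {
  path_cvg_left : forall t : R, 0 < t <= 1 -> cvg (x @ t^'-) ;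
  path_cvg_right : forall t : R, 0 <= t < 1 -> cvg (x @ t^'+) ;
  path_right0 : x @ 0^'+ --> x 0 ;
  path_between : forall t : R, 0 <= t <= 1 ->
    between (lim_left x t) (lim_right x t) (x t) }.

Definition completed_graph (x : R -> R) : set (R * R) :=
  [set zt | 0 <= zt.2 <= 1 /\
            between (lim_left x zt.2) (lim_right x zt.2) zt.1].

Definition graph_le (x : R -> R) (p q : R * R) : Prop :=
  p.2 < q.2 \/
  p.2 = q.2 /\ `|lim_left x p.2 - p.1| <= `|lim_left x q.2 - q.1|.

Definition parametric_representation (x u r : R -> R) : Prop :=
  [/\ {within `[0, 1], continuous u},
      {within `[0, 1], continuous r},
      (fun s => (u s, r s)) @` `[0, 1] = completed_graph x &
      forall s s' : R, 0 <= s -> s <= s' -> s' <= 1 ->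
        graph_le x (u s, r s) (u s', r s')].

Definition unif_dist01 (u v : R -> R) : R :=
  sup [set (`|u s - v s| : R) | s in (`[0, 1] : set R)].

Definition m1_dist (x y : R -> R) : R :=
  inf [set e : R | exists u1 r1 u2 r2,
    [/\ parametric_representation x u1 r1,
        parametric_representation y u2 r2 &
        e = Num.max (unif_dist01 u1 u2) (unif_dist01 r1 r2)]].

End SkorokhodM1.

Record m1_space (R : realType) := M1Space {
  m1_fun :> R -> R ;
  m1_is_path : is_path m1_fun }.

Section M1Topology.
Context {R : realType}.

HB.instance Definition _ := gen_eqMixin (m1_space R).
HB.instance Definition _ := gen_choiceMixin (m1_space R).

(* open sets of the topology induced by the (pseudo)distance m1_dist *)
Definition m1_open (U : set (m1_space R)) : Prop :=
  forall x, U x -> exists2 e : R, 0 < e &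
    forall y : m1_space R, m1_dist x y < e -> U y.

Lemma m1_openT : m1_open setT.
Proof. by move=> x _; exists 1. Qed.

Lemma m1_openI : setI_closed m1_open.
Proof.
move=> A B oA oB x [/oA[e e0 eA] /oB[f f0 fB]].
exists (Num.min e f); first by rewrite lt_min e0.
by move=> y; rewrite lt_min => /andP[/eA ? /fB].
Qed.

Lemma m1_open_bigU (I : Type) (f : I -> set (m1_space R)) :
  (forall i, m1_open (f i)) -> m1_open (\bigcup_i f i).
Proof.
move=> of_ x [i _ /of_[e e0 ef]].
by exists e => // y /ef fy; exists i.
Qed.

HB.instance Definition _ :=
  isOpenTopological.Build (m1_space R) m1_openT m1_openI m1_open_bigU.

End M1Topology.

Section ConvergenceInLaw.
Context {R : realType} {E : topologicalType}.

Definition borel_random_element {d} {T : measurableType d} (X : T -> E) : Prop :=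
  forall U : set E, open U -> measurable (X @^-1` U).

(* X n v, v in [n], converges in distribution to Y as n tends to infinity,
   uniformly in v; X n v lives on the n-th probability space. *)
Definition cvg_in_law_unif (d : nat -> measure_display)
    (T : forall n, measurableType (d n)) (P : forall n, probability (T n) R)
    (X : forall n, 'I_n -> T n -> E)
    {d0} {T0 : measurableType d0} (P0 : probability T0 R) (Y : T0 -> E) : Prop :=
  [/\ forall n v, borel_random_element (X n v),
      borel_random_element Y &
      forall f : E -> R, continuous f -> (exists M : R, forall x, `|f x| <= M) ->
      forall e : R, 0 < e -> \forall n \near \oo, forall v : 'I_n,
        `|fine 'E_(P n)[f \o X n v] - fine 'E_P0[f \o Y]| < e].

End ConvergenceInLaw.

(* Main.v *)
Require Import Defs.
From mathcomp Require Import all_boot all_order all_algebra all_fingroup.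
From mathcomp Require Import all_classical all_reals all_analysis.
From mathcomp Require Import measurable_realfun.
From mathcomp Require Import ring lra zify.
Set Implicit Arguments.
Unset Strict Implicit.
Unset Printing Implicit Defensive.
Import Order.TTheory GRing.Theory Num.Theory.
Import numFieldNormedType.Exports.
Local Open Scope classical_set_scope.
Local Open Scope ring_scope.

(** Each step of the dynamics merges two cycles, so the walk started at v is
    uniform on the current cycle of v, and its distance to the uniform
    distribution is 1 - c / n where c is the size of this cycle. The components
    of the associated graph are the cycles. Hence the drop-down time is the
    first time after n / 2 (1 + eps n) at which the cycle of v is a largest one,
    and both claims follow from one statement on cycles, cycle_limit: at time
    s n the vertex v has been hit with probability close to eta s, and then its
    cycle has size close to n (eta s); otherwise its cycle has size o(n). The
    law of the history is invariant under relabelling (Ex_conj), which gives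
    uniformity in v.

    The cycle sizes are studied through F th, the mean of exp (- th c) over the
    vertices. Merging two uniform vertices of different cycles amounts to an
    Erdos-Renyi graph seen at a random clock uu, the sum of n / D where D counts
    the pairs of vertices in different cycles. In this clock F solves, in the
    limit, a first order equation whose characteristics are
    th = - ln (1 - h) - 2 h u; along them F keeps the value 1 - h, and
    Phi + (1 - h) ^ 2 u is conserved too, where Phi is minus a primitive of F.
    A Gronwall argument in mean square shows that both laws hold up to errors
    of order n ^ (- 1/2) as long as th stays away from 0 (concentration). The
    characteristic of h reaches 0 before the clock u iff h < zeta u, so the
    vertices in unboundedly large cycles form a fraction zeta u (NK_lower,
    NK_upper). As Phi 0 counts the cycles, whose number n - t is known, the
    second law gives t / n = zeta u + u (1 - zeta u) ^ 2, which is phi u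
    (phi_psi); so uu is close to phi^-1 s at time s n (uu_lower, uu_upper) and
    the fraction is eta s. Two large cycles cannot coexist for long, because
    merging them increases a bounded potential (giant_exists). Finally, at time
    n / 2 the largest cycle is already unbounded (critical_cycles), so a vertex
    that is hit is in a large cycle, hence in the giant one.

    For the first claim, a continuous function on [0, 1] is approximated by a
    step function, whose mean is a combination of values of the distribution
    function (cdf_close). For the second claim, all paths are nonincreasing. For
    such paths closeness in the Levy sense, which can be checked on a finite
    grid, implies closeness in the M1 topology, as one sees by parametrizing the
    completed graph by t - z (m1_dist_levy). By cycle_limit on a grid the walk
    is close to the limit path that drops at the drop-down time of the walk
    (walk_near_drop), so the second claim reduces to the first (path_limit). *)

(** * The limit functions *)
Section LimitFunctionsTheory.
Context {R : realType}.
Implicit Types u v h s e z : R.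

(** The tangent line at l x lies below the graph, in particular at 0 and x. *)
Lemma expR_strict_convex (l x : R) : 0 < l < 1 -> x != 0 ->
  expR (l * x) < 1 - l + l * expR x.
Proof.
move=> /andP[l0 l1] x0.
have y0 : (1 - l) * x != 0 by rewrite mulf_neq0 // subr_eq0 eq_sym lt_eqF.
have z0 : - (l * x) != 0 by rewrite oppr_eq0 mulf_neq0 // gt_eqF.
have e0 : 0 < expR (l * x) by exact: expR_gt0.
have := expR_gt1Dx y0; have := expR_gt1Dx z0.
rewrite -(ltr_pM2l e0) -[X in _ < X -> _]expRD subrr expR0 => h1.
rewrite -(ltr_pM2l e0) -[X in _ < X -> _]expRD.
have -> : l * x + (1 - l) * x = x by ring.
move=> h2.
move: h1 h2; set E := expR (l * x); set X := expR x => h1 h2.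
have k1 : (1 - l) * (E * (1 - l * x)) < (1 - l) * 1 by rewrite ltr_pM2l // subr_gt0.
have k2 : l * (E * (1 + (1 - l) * x)) < l * X by rewrite ltr_pM2l.
by lra.
Qed.

(** At z = 1 - 1 / (2 u) the inequality 1 + x <= exp x, for x = 2 u - 1, gives
    exp (- 2 u z) <= 1 - z; at z = 1 the opposite holds. The explicit lower
    bound shows that zeta tends to 1. *)
Lemma zeta_root_exists u : 2^-1 < u ->
  exists2 z, 1 - (2 * u)^-1 <= z < 1 & 1 - z = expR (- (2 * u * z)).
Proof.
move=> u2.
have u0 : 0 < u by lra.
have u20 : 2 * u != 0 by rewrite mulf_neq0 ?gt_eqF.
pose z0 := 1 - (2 * u)^-1.
have uz0 : 2 * u * z0 = 2 * u - 1 by rewrite /z0; field; lra.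
have z01 : z0 <= 1 by rewrite /z0 gerBl invr_ge0; lra.
pose f z := 1 - z - expR (- (2 * u * z)).
have cf : {within `[z0, 1], continuous f}.
  apply: continuous_subspaceT => x.
  apply: cvgB; first by apply: cvgB; [exact: cvg_cst|exact: cvg_id].
  apply: (@continuous_comp R R R (fun z => - (2 * u * z)) expR).
    by apply: cvgN; apply: cvgM; [exact: cvg_cst|exact: cvg_id].
  exact: continuous_expR.
have f1 : f 1 < 0 by rewrite /f subrr sub0r oppr_lt0 expR_gt0.
have f0 : 0 <= f z0.
  rewrite /f uz0 subr_ge0 expRN.
  have -> : 1 - z0 = (2 * u)^-1 by rewrite /z0; ring.
  rewrite lef_pV2 ?posrE ?expR_gt0 //.
    by have := expR_ge1Dx (2 * u - 1); rewrite addrC subrK.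
  by lra.
have [|z /[!in_itv]/= /andP[z0z z1] fz] := IVT z01 cf (v := 0).
  by rewrite (min_idPr _) ?(max_idPl _) ?f0 ?(ltW f1)//; rewrite (le_trans (ltW f1)).
exists z; last by move/eqP: fz; rewrite subr_eq0 => /eqP.
rewrite z0z lt_neqAle z1 andbT; apply: contra_eqN fz => /eqP ->.
by rewrite lt_eqF.
Qed.

Lemma zetaP u : 2^-1 < u ->
  0 < cdp_zeta u /\ 1 - cdp_zeta u = expR (- (2 * u * cdp_zeta u)).
Proof.
move=> u2; rewrite /cdp_zeta leNgt u2 /=.
set S := (X in get X); have [z /andP[z0 z1] zE] := zeta_root_exists u2.
suff : S (get S) by [].
apply: (getI (x := z)); split => //; apply: lt_le_trans z0.
by rewrite subr_gt0 invf_lt1; lra.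
Qed.

Lemma zeta_small u : u <= 2^-1 -> cdp_zeta u = 0.
Proof. by move=> u2; rewrite /cdp_zeta u2. Qed.

Lemma zeta_eq u : 1 - cdp_zeta u = expR (- (2 * u * cdp_zeta u)).
Proof.
have [u2|u2] := leP u 2^-1; last by case: (zetaP u2).
by rewrite zeta_small // mulr0 subr0 oppr0 expR0.
Qed.

Lemma zeta_ge0 u : 0 <= cdp_zeta u.
Proof.
have [u2|u2] := leP u 2^-1; first by rewrite zeta_small.
by case: (zetaP u2) => /ltW.
Qed.

Lemma zeta_lt1 u : cdp_zeta u < 1.
Proof. by rewrite -subr_gt0 zeta_eq expR_gt0. Qed.

(** The chord of the convex function z |-> exp (- 2 u z) from 0 to the root
    zeta u lies on the line 1 - z; hence the sign of 1 - h - exp (- 2 u h)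
    tells on which side of zeta u the number h lies. *)
Lemma zeta_lt_sign u h : cdp_zeta u < h -> h < 1 -> 1 - h < expR (- (2 * u * h)).
Proof.
move=> zh h1; have z0 := zeta_ge0 u; have h0 : 0 < h by exact: le_lt_trans zh.
have [u2|u2] := leP u 2^-1.
  have [->|u0] := eqVneq u 0; first by rewrite mulr0 mul0r oppr0 expR0; lra.
  have hn : - (2 * u * h) != 0 by rewrite oppr_eq0 !mulf_neq0 // gt_eqF.
  apply: le_lt_trans (expR_gt1Dx hn).
  by nra.
have [zp zE] := zetaP u2; set z := cdp_zeta u in z0 zh zp zE *.
have := @expR_strict_convex (z / h) (- (2 * u * h)).
rewrite divr_gt0 //= ltr_pdivrMr // mul1r => /(_ zh).
rewrite oppr_eq0 !mulf_neq0 ?gt_eqF//; last by lra.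
move=> /(_ isT).
have -> : z / h * - (2 * u * h) = - (2 * u * z) by field; lra.
rewrite -zE; set E := expR _ => hE.
have : (1 - z) * h < (1 - z / h + z / h * E) * h by rewrite ltr_pM2r.
have -> : (1 - z / h + z / h * E) * h = h - z + z * E by field; lra.
move=> h2; have : z * (1 - h) < z * E by lra.
by rewrite ltr_pM2l.
Qed.

Lemma zeta_gt_sign u h : 0 < h -> h < cdp_zeta u -> expR (- (2 * u * h)) < 1 - h.
Proof.
move=> h0 hz; have z0 := zeta_ge0 u.
have [u2|u2] := leP u 2^-1; first by move: hz; rewrite zeta_small // => ?; lra.
have [zp zE] := zetaP u2; set z := cdp_zeta u in hz z0 zp zE *.
have := @expR_strict_convex (h / z) (- (2 * u * z)).
rewrite divr_gt0 //= ltr_pdivrMr // mul1r => /(_ hz).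
rewrite oppr_eq0 !mulf_neq0 ?gt_eqF//; last by lra.
move=> /(_ isT).
have -> : h / z * - (2 * u * z) = - (2 * u * h) by field; lra.
by rewrite -zE => hE; apply: lt_le_trans hE _; rewrite le_eqVlt; apply/orP; left; apply/eqP; field; lra.
Qed.

Lemma zeta_le u v : u <= v -> cdp_zeta u <= cdp_zeta v.
Proof.
move=> uv; rewrite leNgt; apply/negP => vu.
have := zeta_lt_sign vu (zeta_lt1 u).
have z0 : 0 < cdp_zeta u by exact: le_lt_trans (zeta_ge0 _) vu.
by rewrite zeta_eq ltr_expR ltrN2 ltr_pM2r //; lra.
Qed.

Lemma zeta_ge u : 2^-1 < u -> 1 - (2 * u)^-1 <= cdp_zeta u.
Proof.
move=> u2; have [z /andP[z0 z1] zE] := zeta_root_exists u2.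
suff <- : z = cdp_zeta u by [].
have zp : 0 < z by apply: lt_le_trans z0; rewrite subr_gt0 invf_lt1; lra.
case: (ltgtP z (cdp_zeta u)) => // h.
  by have := zeta_gt_sign zp h; rewrite -zE ltxx.
by have := zeta_lt_sign h z1; rewrite -zE ltxx.
Qed.

Lemma continuous_zeta : continuous (@cdp_zeta R).
Proof.
have cE h : continuous (fun v => expR (- (2 * v * h))).
  move=> x; apply: (@continuous_comp R R R (fun v => - (2 * v * h)) expR).
    apply: cvgN; apply: cvgM; last exact: cvg_cst.
    by apply: cvgM; [exact: cvg_cst|exact: cvg_id].
  exact: continuous_expR.
move=> u; apply/cvgrPdist_lt => e e0.
have up : \forall v \near u, cdp_zeta v < cdp_zeta u + e.
  have [h1|h1] := leP 1 (cdp_zeta u + e).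
    by near=> v; apply: lt_le_trans (zeta_lt1 _) h1.
  have hu : cdp_zeta u < cdp_zeta u + e by lra.
  have /cvgr_gt : expR (- (2 * v * (cdp_zeta u + e))) @[v --> u] --> _ := @cE _ u.
  move=> /(_ _ (zeta_lt_sign hu h1)); apply: filterS => v lt1.
  rewrite ltNge le_eqVlt; apply/negP => /orP[/eqP hE|hv].
    by move: lt1; rewrite hE -zeta_eq ltxx.
  have := zeta_gt_sign _ hv; have := zeta_ge0 u => ? /(_ _)/lt_trans; move/(_ _ _ lt1).
  by rewrite ltxx => /(_ _)H; have : false by apply: H; lra.
have dn : \forall v \near u, cdp_zeta u - e < cdp_zeta v.
  have [h1|h1] := leP (cdp_zeta u - e) 0.
    have [h2|h2] := ltP (cdp_zeta u - e) 0.
      by near=> v; apply: lt_le_trans h2 (zeta_ge0 _).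
    have hu : 0 < cdp_zeta u / 2 by lra.
    have hu' : cdp_zeta u / 2 < cdp_zeta u by lra.
    have /cvgr_lt : expR (- (2 * v * (cdp_zeta u / 2))) @[v --> u] --> _ := @cE _ u.
    move=> /(_ _ (zeta_gt_sign hu hu')); apply: filterS => v lt1.
    rewrite (le_lt_trans h1) // lt_neqAle zeta_ge0 andbT.
    apply/eqP => z0; have := @zeta_lt_sign v (cdp_zeta u / 2).
    rewrite -z0 => /(_ hu); have := zeta_lt1 u => ? H.
    have := lt_trans (H _) lt1; rewrite ltxx => {}H.
    by have : false by apply: H; lra.
  have hu : cdp_zeta u - e < cdp_zeta u by lra.
  have /cvgr_lt : expR (- (2 * v * (cdp_zeta u - e))) @[v --> u] --> _ := @cE _ u.
  move=> /(_ _ (zeta_gt_sign h1 hu)); apply: filterS => v lt1.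
  rewrite ltNge le_eqVlt; apply/negP => /orP[/eqP hE|hv].
    by move: lt1; rewrite -hE -zeta_eq ltxx.
  have h2 : cdp_zeta u - e < 1 by have := zeta_lt1 u; lra.
  by have := lt_trans (zeta_lt_sign hv h2) lt1; rewrite ltxx.
apply: filterS2 up dn => v up dn; rewrite ltr_norml.
by apply/andP; split; lra.
Unshelve. all: by end_near. Qed.

(** The closed form of the integral cdp_phi, see phi_psi. *)
Definition psi u : R := cdp_zeta u + u * (1 - cdp_zeta u) ^+ 2.

Let Q u z : R := u * (1 - z ^+ 2) + (1 - z) * ln (1 - z) + z.

Lemma ln_zeta u : ln (1 - cdp_zeta u) = - (2 * u * cdp_zeta u).
Proof. by rewrite zeta_eq expRK. Qed.

Lemma Q_zeta u : Q u (cdp_zeta u) = psi u.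
Proof. by rewrite /Q ln_zeta /psi; ring. Qed.

Lemma is_derive_Q u z : z < 1 -> is_derive z 1 (Q u) (- (2 * u * z) - ln (1 - z)).
Proof.
move=> z1.
have z10 : 0 < 1 - z by rewrite subr_gt0.
have d1 : is_derive z 1 (fun z : R => 1 - z) (- 1).
  rewrite -[-1]sub0r; exact: is_deriveB.
have dl : is_derive z 1 (fun z => ln (1 - z)) (- (1 - z)^-1).
  rewrite -mulrN1; apply: (is_derive1_comp (f := @ln R) (g := fun z => 1 - z)).
  exact: is_derive1_ln.
rewrite /Q; apply: is_derive_eq.
rewrite /GRing.scale /=.
have : (1 - z) * (1 - z)^-1 = 1 by rewrite divff ?gt_eqF.
by set w := (1 - z)^-1; set L := ln _ => w1; rewrite ?expr1; lra.
Qed.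

(** The derivative - 2 u z - ln (1 - z) of Q u is negative below the root zeta u
    and positive above, so psi u is the minimum of the functions Q u z, which
    are affine in u. This makes psi concave. *)
Lemma psi_le_Q u z : 0 <= z -> z < 1 -> psi u <= Q u z.
Proof.
move=> z0 z1; rewrite -Q_zeta.
have cQ a b : b < 1 -> {within `[a, b], continuous (Q u)}.
  move=> b1; apply: derivable_within_continuous => x.
  rewrite in_itv/= => /andP[_ xb].
  by have [] := @is_derive_Q u x (le_lt_trans xb b1).
case: (ltgtP (cdp_zeta u) z) => [||->//].
- move=> h; have [c|c] := MVT h _ (@cQ _ _ z1) (df := fun z => - (2 * u * z) - ln (1 - z)).
    by rewrite in_itv/= => /andP[_ cz]; apply: is_derive_Q; apply: lt_trans z1.
  rewrite in_itv/= => /andP[zc cz] E; rewrite -subr_ge0 E mulr_ge0 ?subr_ge0 ?(ltW h)//.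
  have c1 := lt_trans cz z1.
  have := ltW (zeta_lt_sign zc c1).
  rewrite -ler_ln ?posrE ?expR_gt0 ?subr_gt0 // expRK.
  by lra.
- move=> h; have [c|c] := MVT h _ (@cQ _ _ (zeta_lt1 u)) (df := fun z => - (2 * u * z) - ln (1 - z)).
    rewrite in_itv/= => /andP[_ cz]; apply: is_derive_Q.
    exact: lt_trans (zeta_lt1 u).
  rewrite in_itv/= => /andP[zc cz] E; rewrite -subr_le0 E mulr_le0_ge0 ?subr_ge0 ?(ltW h)//.
  have c1 := lt_trans cz (zeta_lt1 u).
  have := ltW (zeta_gt_sign (le_lt_trans z0 zc) cz).
  rewrite -ler_ln ?posrE ?expR_gt0 ?subr_gt0 // expRK.
  by lra.
Qed.

Lemma psi_super u v : psi v <= psi u + (v - u) * (1 - cdp_zeta u ^+ 2).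
Proof.
have := psi_le_Q v (zeta_ge0 u) (zeta_lt1 u).
by rewrite -[psi u]Q_zeta /Q; lra.
Qed.

Lemma sqr_zeta_lt1 u : 0 < 1 - cdp_zeta u ^+ 2.
Proof. by have := zeta_ge0 u; have := zeta_lt1 u; nra. Qed.

Lemma psi_lt u v : u < v -> psi u < psi v.
Proof.
move=> uv; have := psi_super v u; have := sqr_zeta_lt1 v.
have uv0 : 0 < v - u by rewrite subr_gt0.
by nra.
Qed.

Lemma psi_le u v : u <= v -> psi u <= psi v.
Proof. by rewrite le_eqVlt => /orP[/eqP->//|/psi_lt/ltW]. Qed.

Lemma psi_lt1 u : psi u < 1.
Proof.
have [u2|u2] := leP u 2^-1; first by rewrite /psi zeta_small //; lra.
have z1 := zeta_lt1 u.
have h : u * (1 - cdp_zeta u) <= 2^-1.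
  have := zeta_ge u2; rewrite lerBlDr -lerBlDl => h.
  apply: le_trans (_ : u * (2 * u)^-1 <= _); first by rewrite ler_pM2l //; lra.
  by rewrite le_eqVlt; apply/orP; left; apply/eqP; field; lra.
have : u * (1 - cdp_zeta u) ^+ 2 <= 2^-1 * (1 - cdp_zeta u).
  by rewrite expr2 mulrA ler_pM2r // subr_gt0.
by rewrite /psi; lra.
Qed.

Lemma psi_small u : u <= 2^-1 -> psi u = u.
Proof. by move=> u2; rewrite /psi zeta_small //; ring. Qed.

Lemma continuous_psi : continuous psi.
Proof.
move=> x; apply: cvgD; first exact: continuous_zeta.
apply: cvgM; first exact: cvg_id.
have c1 : {for x, continuous (fun x => 1 - cdp_zeta x)}.
  by apply: cvgB; [exact: cvg_cst|exact: continuous_zeta].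
exact: cvgM.
Qed.

(** By psi_super, used in both directions, the difference quotient of psi
    between x and z lies between 1 - zeta x ^ 2 and 1 - zeta z ^ 2. *)
Lemma is_derive_psi (x : R) : is_derive x (1 : R) psi (1 - cdp_zeta x ^+ 2).
Proof.
apply/is_derive1_caratheodory.
pose g z := if z == x then 1 - cdp_zeta x ^+ 2 else (psi z - psi x) / (z - x).
exists g; split; last by rewrite /g eqxx.
  move=> z; rewrite /g; case: eqVneq => [->|zx]; first by rewrite !subrr mulr0.
  by rewrite mulrVK // unitfE subr_eq0.
pose m z := `|(1 - cdp_zeta x ^+ 2) - (1 - cdp_zeta z ^+ 2)|.
have cm : m @ x --> 0.
  rewrite -(normr0 R) -(subrr (1 - cdp_zeta x ^+ 2)); apply: cvg_norm.
  apply: cvgB; [exact: cvg_cst|apply: cvgB; first exact: cvg_cst].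
  by apply: cvgM; exact: continuous_zeta.
have ca : (fun z => 1 - cdp_zeta x ^+ 2 - m z) @ x --> 1 - cdp_zeta x ^+ 2.
  by rewrite -[X in _ --> X]subr0; apply: cvgB => //; exact: cvg_cst.
have cb : (fun z => 1 - cdp_zeta x ^+ 2 + m z) @ x --> 1 - cdp_zeta x ^+ 2.
  by rewrite -[X in _ --> X]addr0; apply: cvgD => //; exact: cvg_cst.
have gx : g x = 1 - cdp_zeta x ^+ 2 by rewrite /g eqxx.
suff : g @ x --> g x by []; rewrite gx.
apply: (squeeze_cvgr _ ca cb); apply: nearW => z; rewrite -ler_distl /m /g.
case: eqVneq => [->|zx]; first by rewrite subrr normr0.
have s1 := psi_super x z; have s2 := psi_super z x.
move: s1 s2; set p := 1 - cdp_zeta x ^+ 2; set q := 1 - cdp_zeta z ^+ 2 => s1 s2.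
have A0 : 0 <= `|p - q| by [].
have A1 : p - q <= `|p - q| by exact: ler_norm.
have A2 : q - p <= `|p - q| by rewrite distrC ler_norm.
move: A0 A1 A2; set A := `|p - q| => A0 A1 A2.
have [zx'|zx'] := ltP z x.
  have d0 : 0 < x - z by rewrite subr_gt0.
  have -> : (psi z - psi x) / (z - x) = (psi x - psi z) / (x - z).
    by rewrite -[RHS]mulrNN -invrN !opprB.
  rewrite ler_norml lerBrDr lerBlDr ler_pdivlMr // ler_pdivrMr //.
  have B0 := mulr_ge0 (ltW d0) A0.
  have := ler_pM2l d0 (p - q) A; have := ler_pM2l d0 (q - p) A; rewrite A1 A2 => B1 B2.
  by apply/andP; split; lra.
have d0 : 0 < z - x by rewrite subr_gt0 lt_neqAle eq_sym zx.
rewrite ler_norml lerBrDr lerBlDr ler_pdivlMr // ler_pdivrMr //.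
have B0 := mulr_ge0 (ltW d0) A0.
have := ler_pM2l d0 (p - q) A; have := ler_pM2l d0 (q - p) A; rewrite A1 A2 => B1 B2.
by apply/andP; split; lra.
Qed.

Lemma phi_psi v : 0 <= v -> cdp_phi v = psi v.
Proof.
rewrite le_eqVlt => /orP[/eqP <-|v0]; rewrite /cdp_phi.
  by rewrite set_itv1 Rintegral_set1 psi_small // invr_ge0.
rewrite /Rintegral (@continuous_FTC2 _ _ psi) //.
- by rewrite -EFinB /= (@psi_small 0) ?subr0 // invr_ge0.
- apply: continuous_subspaceT => x; apply: cvgB; first exact: cvg_cst.
  by apply: cvgM; exact: continuous_zeta.
- split.
  + by move=> x _; have [] := is_derive_psi x.
  + exact/cvg_at_right_filter/continuous_psi.
  + exact/cvg_at_left_filter/continuous_psi.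
- move=> x _; rewrite derive1E.
  by have [_ ->] := is_derive_psi x.
Qed.

Lemma phi_inv_spec s : 0 <= s -> s < 1 ->
  0 <= cdp_phi_inv s /\ psi (cdp_phi_inv s) = s.
Proof.
move=> s0 s1.
pose v := (1 - s)^-1.
have s10 : 0 < 1 - s by lra.
have v1 : 1 <= v by rewrite /v invf_ge1 //; lra.
have zv : s <= psi v.
  have v2 : 2^-1 < v by lra.
  have := zeta_ge v2; have := zeta_lt1 v; rewrite /psi.
  have : (2 * v)^-1 <= 1 - s by rewrite invfM invrK; lra.
  move=> h1 h2 h3; have : 0 <= v * (1 - cdp_zeta v) ^+ 2 by rewrite mulr_ge0 ?sqr_ge0 //; lra.
  by lra.
have v0 : 0 <= v by lra.
have cp : {within `[0, v], continuous psi}.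
  by apply: continuous_subspaceT; exact: continuous_psi.
have p0 : psi 0 = 0 by rewrite psi_small // invr_ge0.
have [|x] := IVT v0 cp (v := s).
  by rewrite p0 ge_min s0 le_max zv orbT.
rewrite in_itv/= => /andP[x0 _] xs.
have [h1 h2] : [set v : R | 0 <= v /\ cdp_phi v = s] (cdp_phi_inv s).
  by apply: (getI (x := x)); split; rewrite ?phi_psi.
by rewrite -phi_psi.
Qed.

Lemma phi_inv_le s t : 0 <= s -> s <= t -> t < 1 -> cdp_phi_inv s <= cdp_phi_inv t.
Proof.
move=> s0 st t1; rewrite leNgt; apply/negP => /psi_lt.
have [_ ->] := phi_inv_spec (le_trans s0 st) t1.
have [_ ->] := phi_inv_spec s0 (le_lt_trans st t1).
by rewrite ltNge st.
Qed.

Lemma eta_ge0 s : 0 <= cdp_eta s.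
Proof. by rewrite /cdp_eta; case: ifP => // _; exact: zeta_ge0. Qed.

Lemma eta_le1 s : cdp_eta s <= 1.
Proof. by rewrite /cdp_eta; case: ifP => // _; exact/ltW/zeta_lt1. Qed.

Lemma eta1 : cdp_eta (1 : R) = 1.
Proof. by rewrite /cdp_eta ltxx. Qed.

Lemma eta_zeta s : s < 1 -> cdp_eta s = cdp_zeta (cdp_phi_inv s).
Proof. by rewrite /cdp_eta => ->. Qed.

Lemma eta_le s t : 0 <= s -> s <= t -> cdp_eta s <= cdp_eta t.
Proof.
move=> s0 st; rewrite {2}/cdp_eta; case: ifP => t1; last exact: eta_le1.
by rewrite eta_zeta ?(le_lt_trans st) //; apply/zeta_le/phi_inv_le.
Qed.

Lemma phi_inv_small s : 0 <= s -> s <= 2^-1 -> cdp_phi_inv s = s.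
Proof.
move=> s0 s2; have s1 : s < 1 by lra.
have [p0 pE] := phi_inv_spec s0 s1.
have := psi_small s2; rewrite -{2}pE.
by case: (ltgtP s (cdp_phi_inv s)) => // /psi_lt; rewrite pE => h e; lra.
Qed.

Lemma eta_small s : 0 <= s -> s <= 2^-1 -> cdp_eta s = 0.
Proof.
move=> s0 s2; rewrite eta_zeta; last by lra.
by rewrite phi_inv_small // zeta_small.
Qed.

(** At s = 1 this uses that psi is below 1 everywhere whereas zeta tends to 1:
    times close to 1 have an arbitrarily large inverse under phi. *)
Lemma eta_continuous s e : 0 <= s -> s <= 1 -> 0 < e ->
  exists2 d, 0 < d & forall t, 0 <= t -> t <= 1 -> `|t - s| < d ->
    `|cdp_eta t - cdp_eta s| < e.
Proof.
move=> s0; rewrite le_eqVlt => /orP[/eqP ->|s1] e0.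
  (* zeta v >= 1 - 1 / (2 v) > 1 - e *)
  pose v := 1 + e^-1; have ei : 0 < e^-1 by rewrite invr_gt0.
  have vz : 1 - e < cdp_zeta v.
    have v2 : 2^-1 < v by rewrite /v; lra.
    apply: lt_le_trans (zeta_ge v2); rewrite ltrD2l ltrN2 invf_plt ?posrE; rewrite /v; try lra.
  have p1 : psi v < 1.
    exact: psi_lt1.
  exists (1 - psi v); first by lra.
  move=> t t0 t1; rewrite eta1 !ltr_norml => /andP[h1 h2].
  apply/andP; split; last by have := eta_le1 t; lra.
  suff : cdp_zeta v <= cdp_eta t by lra.
  rewrite /cdp_eta; case: ifP => t1'; last exact/ltW/zeta_lt1.
  apply: zeta_le; rewrite leNgt; apply/negP => /psi_lt.
  by have [_ ->] := phi_inv_spec t0 t1'; lra.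
have [p0 pE] := phi_inv_spec s0 s1; set p := cdp_phi_inv s in p0 pE *.
have /cvgrPdist_lt/(_ _ e0)/nbhs_ballP[d /= d0 H] := @continuous_zeta p.
have d2 : 0 < d / 2 by lra.
pose d1 := Num.min (1 - s) (Num.min (s - psi (p - d / 2)) (psi (p + d / 2) - s)).
have : p - d / 2 < p by lra.
have : p < p + d / 2 by lra.
move=> /psi_lt + /psi_lt; rewrite pE => h1 h2.
exists d1; first by rewrite !lt_min !subr_gt0 s1 h1 h2.
move=> t t0 t1; rewrite !lt_min => /and3P[+ + +]; rewrite !ltr_norml.
move=> /andP[_ k1] /andP[k2 _] /andP[_ k3].
have t1' : t < 1 by lra.
rewrite -ltr_norml !eta_zeta // -/p distrC; apply: H.
have [q0 qE] := phi_inv_spec t0 t1'.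
rewrite /ball /= ltr_norml; apply/andP; split.
  suff : cdp_phi_inv t < p + d / 2 by lra.
  rewrite ltNge; apply/negP => /psi_le; rewrite qE; lra.
suff : p - d / 2 < cdp_phi_inv t by lra.
rewrite ltNge; apply/negP => /psi_le; rewrite qE; lra.
Qed.
End LimitFunctionsTheory.

(** * Merging two cycles *)
Section Merging.
Context {n : nat}.
Implicit Types (s : 'S_n) (a b v w : 'I_n).

Definition csize s v : nat := #|porbit s v|.

Lemma csize_gt0 s v : (0 < csize s v)%N.
Proof. by rewrite lt0n card_porbit_neq0. Qed.

Lemma csize_le s v : (csize s v <= n)%N.
Proof. by rewrite -[X in (_ <= X)%N]card_ord max_card. Qed.

Lemma csizeE s v w : w \in porbit s v -> csize s w = csize s v.
Proof. by rewrite /csize -eq_porbit_mem => /eqP ->. Qed.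

Lemma csize1 v : csize 1%g v = 1%N.
Proof.
rewrite /csize (_ : porbit _ _ = [set v]%SET) ?cards1 //.
apply/setP => w; rewrite inE; apply/porbitP/eqP => [[i ->]|->].
  by rewrite expg1n perm1.
by exists 0%N; rewrite perm1.
Qed.

Definition fuse s a b : 'S_n := (tperm a b * s)%g.

Definition diffp s : {set 'I_n * 'I_n} :=
  [set ab | porbit s ab.1 != porbit s ab.2]%SET.

Lemma mem_diffp s a b : ((a, b) \in diffp s) = (porbit s a != porbit s b).
Proof. by rewrite inE. Qed.

Lemma fuseC s a b : fuse s a b = fuse s b a.
Proof. by rewrite /fuse tpermC. Qed.

Lemma porbit_closed s (A : {set 'I_n}) v : v \in A -> (forall x, x \in A -> s x \in A) ->
  porbit s v \subset A.
Proof.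
move=> vA sA; apply/fintype.subsetP => x /porbitP[i ->] {x}.
by elim: i => [|i IH]; rewrite ?perm1 // expgSr permM sA.
Qed.

Let step_in s v x : x \in porbit s v -> s x \in porbit s v.
Proof. by move=> /porbitP[i ->]; rewrite -permM -expgSr mem_porbit. Qed.

(** Starting at a, the new permutation jumps to s b and then follows s through
    the whole cycle of b, since a is not met on the way. *)
Lemma fuse_sub s a b : porbit s a != porbit s b ->
  porbit s b \subset porbit (fuse s a b) a.
Proof.
move=> ab; apply/fintype.subsetP => x.
have k i : (s ^+ i.+1)%g b \in porbit (fuse s a b) a.
  elim: i => [|i IH].
    by rewrite expg1; have := step_in (porbit_id (fuse s a b) a); rewrite permM tpermL.
  rewrite expgSr permM; set y := (s ^+ i.+1)%g b in IH *.
  have [yb|yb] := eqVneq y b.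
    by rewrite yb; have := step_in (porbit_id (fuse s a b) a); rewrite permM tpermL.
  have ya : y != a.
    apply: contra_neq ab => <-; apply/eqP.
    by rewrite eq_porbit_mem mem_porbit.
  by have := step_in IH; rewrite permM tpermD // eq_sym.
move=> /porbitP[[|i] ->]; last exact: k.
rewrite perm1; have := k #|porbit s b|.-1; rewrite prednK ?lt0n ?card_porbit_neq0 //.
by rewrite permX iter_porbit.
Qed.

Lemma porbit_fuse s a b v : porbit s a != porbit s b ->
  porbit (fuse s a b) v =
  if (v \in porbit s a) || (v \in porbit s b) then porbit s a :|: porbit s b
  else porbit s v.
Proof.
move=> ab; set U := porbit s a :|: porbit s b.
have ba : porbit s b != porbit s a by rewrite eq_sym.
have aU : a \in U by rewrite inE porbit_id.
have sU x : x \in U -> s x \in U.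
  by rewrite !inE => /orP[]/step_in->; rewrite ?orbT.
have mU x : x \in U -> fuse s a b x \in U.
  move=> xU; rewrite permM; apply: sU; rewrite !inE.
  by case: tpermP => [_|_|//]; rewrite ?porbit_id ?orbT //; move: xU; rewrite inE.
rewrite -finset.in_setU -/U; case: ifP => vU.
  have Ua : U \subset porbit (fuse s a b) a.
    rewrite finset.subUset fuse_sub // andbT.
    have bm : b \in porbit (fuse s a b) a.
      by apply: (fintype.subsetP (fuse_sub ab)); rewrite porbit_id.
    have := fuse_sub ba; rewrite fuseC; move: bm; rewrite -eq_porbit_mem => /eqP -> //.
  have -> : porbit (fuse s a b) v = porbit (fuse s a b) a.
    by apply/eqP; rewrite eq_porbit_mem (fintype.subsetP Ua).
  by apply/eqP; rewrite finset.eqEsubset Ua porbit_closed.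
have e i : ((fuse s a b) ^+ i)%g v = (s ^+ i)%g v.
  elim: i => [|i IH]; first by rewrite !expg0.
  rewrite !expgSr !permM IH tpermD //; apply/eqP => E; move: vU;
  by rewrite !inE porbit_sym [_ \in porbit s b]porbit_sym E mem_porbit ?orbT.
apply/setP => x; apply/porbitP/porbitP => -[i ->]; exists i; by rewrite e.
Qed.

Lemma card_porbitU s a b : porbit s a != porbit s b ->
  #|porbit s a :|: porbit s b| = (csize s a + csize s b)%N.
Proof.
move=> ab; rewrite cardsU (_ : _ :&: _ = finset.set0) ?cards0 ?subn0 //.
apply/setP => x; rewrite !inE; apply/negP => /andP[].
by rewrite -!eq_porbit_mem => /eqP h1 /eqP h2; rewrite -h1 -h2 eqxx in ab.
Qed.

Lemma csize_fuse s a b v : porbit s a != porbit s b ->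
  csize (fuse s a b) v =
  if (v \in porbit s a) || (v \in porbit s b) then (csize s a + csize s b)%N
  else csize s v.
Proof.
by move=> ab; rewrite /csize porbit_fuse //; case: ifP; rewrite // card_porbitU.
Qed.

Lemma csize_fuse_le s a b v : porbit s a != porbit s b ->
  (csize s v <= csize (fuse s a b) v)%N.
Proof.
move=> ab; rewrite csize_fuse //; case: ifP => // /orP[]/csizeE ->.
  exact: leq_addr.
exact: leq_addl.
Qed.

Lemma porbit_fuse_sub s a b v : porbit s a != porbit s b ->
  porbit s v \subset porbit (fuse s a b) v.
Proof.
move=> ab; rewrite porbit_fuse //; case: ifP => // /orP[].
  by rewrite -eq_porbit_mem => /eqP ->; rewrite finset.subsetUl.
by rewrite -eq_porbit_mem => /eqP ->; rewrite finset.subsetUr.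
Qed.

Lemma sum_fuse (V : comNzRingType) s a b (g : nat -> V) : porbit s a != porbit s b ->
  \sum_v g (csize (fuse s a b) v) = \sum_v g (csize s v)
   + (csize s a + csize s b)%:R * g (csize s a + csize s b)%N
   - (csize s a)%:R * g (csize s a) - (csize s b)%:R * g (csize s b).
Proof.
move=> ab; rewrite !mulr_natl; pose U := porbit s a :|: porbit s b.
have dis : fintype.disjoint (mem (porbit s a)) (mem (porbit s b)).
  rewrite fintype.disjoint_subset; apply/fintype.subsetP => x; rewrite -eq_porbit_mem => /eqP h1.
  by rewrite inE -eq_porbit_mem h1.
have sU (h : 'I_n -> V) : \sum_v h v = \sum_(v in U) h v + \sum_(v | v \notin U) h v.
  by rewrite (bigID (mem U)).
rewrite (sU (fun v => g (csize _ v))) [in RHS]sU.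
have -> : \sum_(v | v \notin U) g (csize (fuse s a b) v) = \sum_(v | v \notin U) g (csize s v).
  by apply: eq_bigr => v; rewrite inE => /negbTE vU; rewrite csize_fuse // vU.
have -> : \sum_(v in U) g (csize (fuse s a b) v) =
    g (csize s a + csize s b)%N *+ (csize s a + csize s b).
  rewrite (eq_bigr (fun=> g (csize s a + csize s b)%N)); last first.
    by move=> v; rewrite inE => vU; rewrite csize_fuse // vU.
  by rewrite big_const iter_addr_0 card_porbitU.
have -> : \sum_(v in U) g (csize s v) = g (csize s a) *+ csize s a + g (csize s b) *+ csize s b.
  rewrite (eq_bigl (fun v => (v \in porbit s a) || (v \in porbit s b))); last by move=> v; rewrite inE.
  rewrite bigU //=; congr (_ + _).
    rewrite (eq_bigr (fun=> g (csize s a))); last by move=> v /csizeE ->.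
    by rewrite big_const iter_addr_0.
  rewrite (eq_bigr (fun=> g (csize s b))); last by move=> v /csizeE ->.
  by rewrite big_const iter_addr_0.
set x := _ *+ _; set y := _ *+ _; set z := _ *+ _; set w := (\sum_(v | _) _).
by clearbody x y z w; ring.
Qed.

(** Over all pairs of vertices the sum factorizes; the last term removes the
    pairs inside a common cycle. *)
Lemma sum_diffp (A : comNzRingType) s (f g : nat -> A) :
  \sum_(ab in diffp s) f (csize s ab.1) * g (csize s ab.2) =
  (\sum_v f (csize s v)) * (\sum_v g (csize s v))
  - \sum_v (f (csize s v) * g (csize s v)) *+ csize s v.
Proof.
rewrite big_distrlr /= pair_big /= [in RHS](bigID (fun ab => ab \in diffp s)) /=.
rewrite -addrA -[LHS]addr0; congr (_ + _); apply/esym/eqP; rewrite subr_eq0; apply/eqP.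
transitivity (\sum_(ab | porbit s ab.1 == porbit s ab.2)
   f (csize s ab.1) * g (csize s ab.2)).
  by apply: eq_bigl => -[a b]; rewrite inE negbK.
rewrite -(pair_big_dep xpredT (fun a b => porbit s a == porbit s b)
  (fun a b => f (csize s a) * g (csize s b))) /=.
apply: eq_bigr => a _.
rewrite (eq_bigr (fun=> f (csize s a) * g (csize s a))); last first.
  by move=> b; rewrite eq_porbit_mem porbit_sym => /csizeE ->.
rewrite big_const iter_addr_0; congr (_ *+ _); apply: eq_card => b.
by rewrite -eq_porbit_mem eq_sym.
Qed.

End Merging.

(** * The transition operator *)
Section Kernel.
Context {R : realType} {n : nat}.
Implicit Types (s : 'S_n) (a b v w : 'I_n).

(** The transition operator of the chain, written as an average over ordered
    pairs of vertices rather than over transpositions; see sum_kernel. *)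
Definition step s (g : 'S_n -> R) : R :=
  if diffp s == finset.set0 then g s
  else #|diffp s|%:R^-1 * \sum_(ab in diffp s) g (fuse s ab.1 ab.2).

Lemma tperm_eq (a b c d : 'I_n) : a != b -> tperm a b = tperm c d ->
  (c = a /\ d = b) \/ (c = b /\ d = a).
Proof.
move=> ab E.
have := tpermL a b; have := tpermR a b; rewrite E.
case: (tpermP c d a) => [->|->|_ _ _ ba]; last by rewrite ba eqxx in ab.
  by move=> _ ->; left.
by move=> _ ->; right.
Qed.

(** Each transposition comes from exactly two ordered pairs. *)
Lemma sum_merging s (g : 'S_n -> R) :
  \sum_(ab in diffp s) g (tperm ab.1 ab.2) = (\sum_(m in merging_transpositions s) g m) *+ 2.
Proof.
rewrite -sumrMnl.
pose t ab : 'S_n := @tperm 'I_n ab.1 ab.2.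
have ME : merging_transpositions s = t @: diffp s.
  by apply/setP => m; apply/imsetP/imsetP => -[ab]; rewrite ?inE => h ->; exists ab; rewrite ?inE.
rewrite ME (partition_big_imset t) /=.
apply: eq_bigr => m /imsetP[[a b] ab ->].
rewrite (eq_bigr (fun=> g (t (a, b)))); last by move=> [c d] /andP[_ /eqP <-].
rewrite big_const iter_addr_0; congr (_ *+ _).
have a_b : a != b by move: ab; rewrite mem_diffp; apply: contra_neq => ->.
rewrite (_ : #|_| = #|[set (a, b); (b, a)]%SET|); last first.
  apply: eq_card => -[c d]; rewrite !inE unfold_in /= !inE /=.
  apply/andP/orP => [[cd /eqP /esym/(tperm_eq a_b)[] /= [-> ->]]|[]/eqP[-> ->]].
  - by left.
  - by right.
  - by rewrite -mem_diffp ab.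
  - by rewrite eq_sym -mem_diffp ab /t /= tpermC.
by rewrite cards2 xpair_eqE negb_and a_b.
Qed.

Lemma card_merging s : (#|diffp s| = #|merging_transpositions s| * 2)%N.
Proof.
apply/eqP; rewrite -(eqr_nat R).
by have := sum_merging s (fun=> 1); rewrite !sumr_const mulrnA => ->.
Qed.

Lemma sum_kernel s (g : 'S_n -> R) : \sum_s' cdp_kernel s s' * g s' = step s g.
Proof.
rewrite /step /cdp_kernel.
have -> : (diffp s == finset.set0) = (merging_transpositions s == finset.set0).
  by rewrite -!cards_eq0 card_merging muln_eq0 orbF.
case: ifPn => M0.
  rewrite (bigD1 s) //= eqxx mul1r big1 ?addr0 // => s' /negbTE ->.
  by rewrite mul0r.
set M := merging_transpositions s in M0 *.
rewrite (sum_merging s (fun m => g (m * s)%g)) -/M card_merging -/M.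
transitivity (#|M|%:R^-1 * \sum_(m in M) g (m * s)%g).
  rewrite big_distrr /=.
  transitivity (\sum_s' \sum_(m in M | s' == (m * s)%g) #|M|%:R^-1 * g s').
    apply: eq_bigr => s' _; rewrite sumr_const -mulrA mulr_natl.
    by congr (_ *+ _); apply: eq_card => m; rewrite !inE.
  rewrite (exchange_big_dep (fun m => m \in M)) /=; last by move=> ? ? _ /andP[].
  apply: eq_bigr => m mM.
  by rewrite (big_pred1 (m * s)%g) // => s' /=; rewrite mM.
rewrite natrM invfM -mulr_natr mulrAC -mulrA; congr (_ * _).
have M1 : (2%:R : R) != 0 by rewrite pnatr_eq0.
by rewrite -[X in X / _]mulr_natr mulfK.
Qed.

End Kernel.

(** * Expectations over finite histories *)
Section Histories.
Context {R : realType} {n : nat}.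
Implicit Types (s : 'S_n) (p q : nat -> 'S_n) (f g : (nat -> 'S_n) -> R).

Definition trans s s' : Prop :=
  if diffp s == finset.set0 then s' = s
  else exists2 ab, ab \in diffp s & s' = fuse s ab.1 ab.2.

Lemma step_le s (f g : 'S_n -> R) : (forall s', trans s s' -> f s' <= g s') ->
  step s f <= step s g.
Proof.
rewrite /step /trans; case: ifP => d0 H; first exact: H.
rewrite ler_wpM2l ?invr_ge0 ?ler0n // ler_sum // => ab abd.
by apply: H; exists ab.
Qed.

Lemma stepD s (f g : 'S_n -> R) : step s (fun x => f x + g x) = step s f + step s g.
Proof. by rewrite /step; case: ifP => // _; rewrite big_split /= mulrDr. Qed.

Lemma stepZ s (c : R) (f : 'S_n -> R) : step s (fun x => c * f x) = c * step s f.
Proof. by rewrite /step; case: ifP => // _; rewrite -mulr_sumr mulrCA. Qed.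

Lemma step_cst s (c : R) : step s (fun=> c) = c.
Proof.
rewrite /step; case: ifPn => // d0; rewrite sumr_const -[c *+ _]mulr_natl mulKf //.
by rewrite pnatr_eq0 cards_eq0.
Qed.

(** The histories of length t are coded as sequences of permutations that are
    constant after time t, and app t p s prolongs such a history by s. *)
Definition app t p s : nat -> 'S_n := fun k => if (k <= t)%N then p k else s.

Fixpoint Ex t f : R :=
  if t is t'.+1 then Ex t' (fun p => step (p t') (fun s => f (app t' p s)))
  else f (fun=> 1%g).

Definition valid t p : Prop :=
  p 0%N = 1%g /\ forall k, (k < t)%N -> trans (p k) (p k.+1).

Definition adapted t f : Prop :=
  forall p q, (forall k, (k <= t)%N -> p k = q k) -> f p = f q.

Lemma validS t p : valid t.+1 p -> valid t p.
Proof. by move=> [p0 H]; split=> // k kt; apply/H/ltnW. Qed.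

Lemma valid_le t t' p : (t' <= t)%N -> valid t p -> valid t' p.
Proof. by move=> tt [p0 H]; split=> // k kt; apply: H; apply: leq_trans kt tt. Qed.

Lemma app_le t p s k : (k <= t)%N -> app t p s k = p k.
Proof. by rewrite /app => ->. Qed.

Lemma appS t p s : app t p s t.+1 = s.
Proof. by rewrite /app ltnn. Qed.

Lemma valid_app t p s : valid t p -> trans (p t) s -> valid t.+1 (app t p s).
Proof.
move=> [p0 H] ps; split=> // k; rewrite ltnS leq_eqVlt => /orP[/eqP->|kt].
  by rewrite app_le // appS.
by rewrite !app_le ?(ltnW kt) //; exact: H.
Qed.

Lemma Ex_le t f g : (forall p, valid t p -> f p <= g p) -> Ex t f <= Ex t g.
Proof.
elim: t f g => [|t IH] f g H /=; first by apply: H; split.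
apply: IH => p pv; apply: step_le => s' ss'; apply: H.
exact: valid_app.
Qed.

Lemma Ex_eq t f g : (forall p, valid t p -> f p = g p) -> Ex t f = Ex t g.
Proof. by move=> H; apply/eqP; rewrite eq_le !Ex_le // => p /H ->. Qed.

Lemma ExD t f g : Ex t (fun p => f p + g p) = Ex t f + Ex t g.
Proof.
elim: t f g => [//|t IH] f g /=; rewrite -IH; apply: Ex_eq => p _; exact: stepD.
Qed.

Lemma ExZ t c f : Ex t (fun p => c * f p) = c * Ex t f.
Proof.
elim: t f => [//|t IH] f /=; rewrite -IH; apply: Ex_eq => p _; exact: stepZ.
Qed.

Lemma Ex_cst t c : Ex t (fun=> c) = c.
Proof.
elim: t => [//|t IH] /=; rewrite -[RHS]IH; apply: Ex_eq => p _; exact: step_cst.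
Qed.

Lemma Ex_ge0 t f : (forall p, valid t p -> 0 <= f p) -> 0 <= Ex t f.
Proof. by move=> H; rewrite -[leLHS](Ex_cst t); exact: Ex_le. Qed.

Lemma Ex_sum (I : Type) (r : seq I) (P : pred I) (F : I -> (nat -> 'S_n) -> R) t :
  Ex t (fun p => \sum_(i <- r | P i) F i p) = \sum_(i <- r | P i) Ex t (F i).
Proof.
elim: r => [|i r IH].
  by rewrite big_nil -[RHS](Ex_cst t); apply: Ex_eq => p _; rewrite big_nil.
rewrite big_cons; case: ifPn => Pi.
  by rewrite -IH -ExD; apply: Ex_eq => p _; rewrite big_cons Pi.
by rewrite -IH; apply: Ex_eq => p _; rewrite big_cons (negbTE Pi).
Qed.

Lemma ExS_adapted t f : adapted t f -> Ex t.+1 f = Ex t f.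
Proof.
move=> fa /=; apply: Ex_eq => p _; rewrite -[RHS](step_cst (p t)).
by congr step; apply/funext => s; apply: fa => k; exact: app_le.
Qed.

Lemma adapted_le t t' f : (t <= t')%N -> adapted t f -> adapted t' f.
Proof. by move=> tt fa p q pq; apply: fa => k kt; apply/pq/(leq_trans kt tt). Qed.

Lemma Ex_adapted t t' f : (t <= t')%N -> adapted t f -> Ex t' f = Ex t f.
Proof.
move=> tt fa; rewrite -(subnK tt); elim: (t' - t)%N => [//|k IH].
by rewrite addSn ExS_adapted //; apply: adapted_le fa; rewrite leq_addl.
Qed.

Lemma csizeJ s (x : 'S_n) v : csize (s ^ x)%g (x v) = csize s v.
Proof.
rewrite /csize -[in RHS](card_imset _ (@perm_inj _ x)); congr #|pred_of_set _|.
have itJ i w : ((s ^ x) ^+ i)%g (x w) = x ((s ^+ i)%g w).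
  by rewrite -conjXg permJ.
apply/setP => w; apply/porbitP/imsetP => [[i ->]|[w' /porbitP[i ->] ->]].
  by exists ((s ^+ i)%g v); rewrite ?mem_porbit.
by exists i.
Qed.

Lemma porbitJ s (x : 'S_n) v w : (x w \in porbit (s ^ x)%g (x v)) = (w \in porbit s v).
Proof.
have itJ i u : ((s ^ x) ^+ i)%g (x u) = x ((s ^+ i)%g u).
  by rewrite -conjXg permJ.
apply/porbitP/porbitP => -[i].
  by rewrite itJ => /perm_inj ->; exists i.
by move=> ->; exists i.
Qed.

Lemma step_conj s (x : 'S_n) (f : 'S_n -> R) :
  step (s ^ x)%g f = step s (fun s' => f (s' ^ x)%g).
Proof.
pose h (ab : 'I_n * 'I_n) := (x ab.1, x ab.2).
have hi : injective h by move=> [a b] [c d] [] /perm_inj -> /perm_inj ->.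
have dE : diffp (s ^ x)%g = h @: diffp s.
  apply/setP => -[a b]; apply/idP/imsetP => [|[[c d] cd [-> ->]]].
    rewrite mem_diffp => ab; exists (x^-1 a, x^-1 b)%g; last by rewrite /h /= !permKV.
    by rewrite mem_diffp eq_porbit_mem -(porbitJ _ x) !permKV -eq_porbit_mem.
  by rewrite mem_diffp eq_porbit_mem porbitJ -eq_porbit_mem -mem_diffp.
rewrite /step dE imset_eq0; case: ifP => // _.
rewrite card_imset // big_imset /=; last by move=> a b _ _; exact: hi.
congr (_ * _); apply: eq_bigr => -[a b] _ /=; congr f.
by rewrite /fuse conjMg tpermJ.
Qed.

(** Conjugation relabels the vertices and commutes with the dynamics. This makes
    all starting points of the walk equivalent. *)
Lemma Ex_conj t (x : 'S_n) f : Ex t (fun p => f (fun k => (p k ^ x)%g)) = Ex t f.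
Proof.
elim: t f => [|t IH] f /=.
  by congr f; apply/funext => k; rewrite conj1g.
rewrite -[RHS]IH; apply: Ex_eq => p _; rewrite step_conj; congr step.
apply/funext => s; congr f; apply/funext => k; rewrite /app.
by case: ifP.
Qed.

End Histories.

(** * The number of cycles *)
Section CycleCount.
Context {R : realType} {n : nat}.
Implicit Types (s : 'S_n) (p q : nat -> 'S_n).

(** The number of cycles. *)
Definition kappa s : R := \sum_v (csize s v)%:R^-1.

Definition D s : R := #|diffp s|%:R.

Lemma kappa_fuse s a b : porbit s a != porbit s b -> kappa (fuse s a b) = kappa s - 1.
Proof.
move=> ab; rewrite /kappa (sum_fuse (fun k => k%:R^-1 : R) ab).
have h v : (csize s v)%:R != 0 :> R by rewrite pnatr_eq0 -lt0n csize_gt0.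
rewrite !divff //; first by ring.
by rewrite pnatr_eq0 addn_eq0 -!leqn0 leqNgt csize_gt0.
Qed.

Lemma kappa1 : kappa 1%g = n%:R.
Proof.
rewrite /kappa (eq_bigr (fun=> 1)) ?sumr_const ?card_ord // => v _.
by rewrite csize1 invr1.
Qed.

Let kappa_split s v : kappa s = 1 + \sum_(w | w \notin porbit s v) (csize s w)%:R^-1.
Proof.
rewrite /kappa (bigID (fun w => w \in porbit s v)) /=; congr (_ + _).
rewrite (eq_bigr (fun=> (csize s v)%:R^-1)); last by move=> w /csizeE ->.
by rewrite sumr_const -[_ *+ _]mulr_natl divff // pnatr_eq0 -lt0n csize_gt0.
Qed.

Let card_notin s v : #|[predC porbit s v]| = (n - csize s v)%N.
Proof. have := cardC (mem (porbit s v)).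
by move/(congr1 (fun k => k - csize s v)%N); rewrite addKn => ->; rewrite card_ord. Qed.

Lemma csize_kappa s v : (csize s v)%:R <= n%:R + 1 - kappa s.
Proof.
rewrite (kappa_split s v); set S := \sum_(w | _) _.
suff : S <= n%:R - (csize s v)%:R by move=> ?; lra.
rewrite -natrB ?csize_le // -card_notin -sumr_const; apply: ler_sum => w _.
by rewrite invf_le1 ?ltr0n ?csize_gt0 // ler1n csize_gt0.
Qed.

Lemma kappa_csize s v : 1 + (1 - (csize s v)%:R / n%:R) <= kappa s.
Proof.
have n0 : (0 < n)%N by case: v => m; apply: leq_ltn_trans.
rewrite (kappa_split s v) lerD2l.
have -> : 1 - (csize s v)%:R / n%:R = \sum_(w | w \notin porbit s v) (n%:R^-1 : R).
  rewrite (sumr_const [predC porbit s v]) card_notin -[X in _ = X]mulr_natl natrB ?csize_le // mulrBl divff //.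
  by rewrite pnatr_eq0 -lt0n.
apply: ler_sum => w _; rewrite lef_pV2 ?posrE ?ltr0n ?csize_gt0 //.
by rewrite ler_nat csize_le.
Qed.

Lemma D_E s : D s = n%:R ^+ 2 - \sum_v (csize s v)%:R.
Proof.
have := @sum_diffp _ R s (fun=> 1) (fun=> 1).
rewrite (eq_bigr (fun=> 1)); last by move=> *; rewrite mulr1.
rewrite !sumr_const -[#|_|%:R]/(D s) => ->; rewrite card_ord expr2; congr (_ - _).
by apply: eq_bigr => v _; rewrite mulr1.
Qed.

(** With kappa cycles in total, no cycle has more than n + 1 - kappa elements. *)
Lemma D_ge s : n%:R * (kappa s - 1) <= D s.
Proof.
rewrite D_E; have : \sum_v (csize s v)%:R <= \sum_(v < n) (n%:R + 1 - kappa s).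
  by apply: ler_sum => v _; exact: csize_kappa.
by rewrite sumr_const card_ord -[_ *+ _]mulr_natl; lra.
Qed.

Lemma D_gt0 s : (diffp s != finset.set0) = (0 < D s).
Proof. by rewrite /D ltr0n card_gt0. Qed.

Lemma valid_kappa t p : (t < n)%N -> valid t p -> kappa (p t) = n%:R - t%:R.
Proof.
elim: t => [|t IH] tn pv; first by case: pv => -> _; rewrite kappa1 subr0.
have k := IH (ltnW tn) (validS pv).
have d0 : 0 < D (p t).
  apply: lt_le_trans (D_ge _); rewrite k mulr_gt0 ?ltr0n ?(leq_trans _ tn) //.
  by rewrite -addrA -opprD -[1]/(1%:R) -natrD addn1 subr_gt0 ltr_nat.
have [_ /(_ t (leqnn _))] := pv; rewrite /trans; rewrite -D_gt0 in d0; rewrite (negbTE d0).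
move=> [[a b] ab ->]; rewrite kappa_fuse ?k -?mem_diffp //.
by rewrite -addn1 natrD; lra.
Qed.

Lemma valid_D t p : (t < n)%N -> valid t p -> n%:R * (n%:R - t%:R - 1) <= D (p t).
Proof. by move=> tn pv; have := D_ge (p t); rewrite valid_kappa. Qed.

Lemma valid_last p v : valid n.-1 p -> csize (p n.-1) v = n.
Proof.
have n0 : (0 < n)%N by case: v => m; apply: leq_ltn_trans.
move=> pv; have := kappa_csize (p n.-1) v; rewrite valid_kappa ?prednK //.
have -> : n%:R = n.-1%:R + 1 :> R by rewrite -[1]/(1%:R) -natrD addn1 prednK.
rewrite addrAC subrr add0r gerDl subr_le0 -[n.-1%:R + 1]/(n.-1%:R + 1%:R) -natrD addn1 prednK //.
rewrite ler_pdivlMr ?ltr0n // mul1r ler_nat => h.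
by apply/eqP; rewrite eqn_leq csize_le.
Qed.

Lemma valid_csize_le t t' p v : (t <= t')%N -> valid t' p ->
  (csize (p t) v <= csize (p t') v)%N.
Proof.
move=> tt pv; elim: t' tt pv => [|t' IH]; first by rewrite leqn0 => /eqP ->.
rewrite leq_eqVlt => /orP[/eqP ->//|]; rewrite ltnS => tt pv.
apply: leq_trans (IH tt (validS pv)) _.
have [_ /(_ t' (leqnn _))] := pv; rewrite /trans; case: ifP => _; first by move=> ->.
by move=> [[a b] ab ->]; apply: csize_fuse_le; rewrite -mem_diffp.
Qed.

End CycleCount.

(** * A Gronwall inequality in mean square *)
Section Gronwall.
Context {R : realType} {n : nat}.
Local Notation N := n%:R.
Local Notation path := (nat -> 'S_n).

Lemma gronwall (a : nat -> R) (B K : R) (T : nat) : 0 <= B -> 0 <= K -> (T <= n)%N ->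
  a 0%N = 0 ->
  (forall t, (t < T)%N -> a t.+1 <= (1 + B / N) * a t + K / N ^+ 2) ->
  forall t, (t <= T)%N -> a t <= K * expR B / N.
Proof.
move=> B0 K0 Tn a0 H t tT.
have [n0|n0] := posnP n.
  by move: tT; rewrite (_ : T = 0%N) ?leqn0; [move=> /eqP ->; rewrite a0 n0 invr0 mulr0|lia].
have N0 : 0 < N :> R by rewrite ltr0n.
pose q := 1 + B / N.
have q1 : 1 <= q by rewrite /q lerDl divr_ge0 // ltW.
have KN : 0 <= K / N ^+ 2 by rewrite divr_ge0 // exprn_ge0 // ltW.
have L : a t <= K / N ^+ 2 * (t%:R * q ^+ t).
  elim: t tT => [|t IH] tT; first by rewrite a0 mul0r mulr0.
  apply: le_trans (H _ tT) _; rewrite -/q.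
  apply: le_trans (_ : q * (K / N ^+ 2 * (t%:R * q ^+ t)) + K / N ^+ 2 * 1 <= _).
    by rewrite mulr1 lerD2r ler_wpM2l ?IH ?(ltnW tT) // (le_trans _ q1).
  rewrite mulrCA -mulrDr ler_wpM2l //.
  have -> : t.+1%:R = t%:R + 1 :> R by rewrite -natr1.
  have -> : (t%:R + 1) * q ^+ t.+1 = q * (t%:R * q ^+ t) + q ^+ t.+1 by rewrite exprS; ring.
  rewrite lerD2l.
  by rewrite exprn_ege1.
apply: le_trans L _.
have -> : K * expR B / N = K / N ^+ 2 * (N * expR B) by field; rewrite gt_eqF.
rewrite ler_wpM2l // ler_pM ?ler0n ?exprn_ge0 ?(le_trans _ q1) //.
  by rewrite ler_nat (leq_trans tT).
apply: le_trans (_ : expR (B / N) ^+ n <= _).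
  apply: le_trans (_ : q ^+ n <= _).
    by rewrite ler_weXn2l // (leq_trans tT).
  by rewrite lerXn2r ?nnegrE ?expR_ge0 ?(le_trans _ q1) // expR_ge1Dx.
by rewrite -expRM_natl ler_expR mulrC divfK // gt_eqF.
Qed.

(** The process Z jumps by O(1 / n) and drifts by O((|Z| + Y) / n), as long as the
    events A hold; A (t + 1) is decided by the history up to time t, so it can
    be used for stopping. Expanding the square of Z reduces the claim to
    gronwall. *)
Lemma Ex_gronwall (Z Y : nat -> path -> R) (A : nat -> path -> bool) (C M : R) (T : nat) :
  0 <= C -> 0 <= M -> (T <= n)%N ->
  (forall t p s, A t.+1 (app t p s) = A t.+1 p) ->
  (forall t p, A t.+1 p -> A t p) ->
  (forall t p, (t < T)%N -> valid t p -> A t.+1 p ->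
     [/\ diffp (p t) != finset.set0,
         forall ab, ab \in diffp (p t) ->
          `|Z t.+1 (app t p (fuse (p t) ab.1 ab.2)) - Z t p| <= C / N &
         `|step (p t) (fun s => Z t.+1 (app t p s)) - Z t p| <= (C * `|Z t p| + Y t p) / N]) ->
  (forall t, (t < T)%N -> Ex t (fun p => (A t p)%:R * Y t p ^+ 2) <= M / N) ->
  Z 0%N (fun=> 1%g) = 0 ->
  forall t, (t <= T)%N ->
    Ex t (fun p => (A t p)%:R * Z t p ^+ 2) <= (M + C ^+ 2) * expR (2 * C + 1) / N.
Proof.
move=> C0 M0 Tn Aapp Asub H HY Z0 t tT.
have [n0|n0] := posnP n.
  move: tT; rewrite (_ : T = 0%N) ?leqn0; [move=> /eqP ->|lia].
  by rewrite /= Z0 expr0n mulr0 n0 invr0 mulr0.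
have N0 : 0 < N :> R by rewrite ltr0n.
apply: (@gronwall (fun t => Ex t (fun p => (A t p)%:R * Z t p ^+ 2)) _ _ T) tT => //.
- by rewrite addr_ge0 // mulr_ge0.
- by rewrite addr_ge0 // sqr_ge0.
- by rewrite /= Z0 expr0n mulr0.
move=> {}t tT /=.
apply: le_trans (_ : Ex t (fun p => (1 + (2 * C + 1) / N) * ((A t p)%:R * Z t p ^+ 2)
   + (N^-1 * ((A t p)%:R * Y t p ^+ 2) + C ^+ 2 / N ^+ 2)) <= _); last first.
  rewrite ExD ExZ ExD ExZ Ex_cst lerD2l mulrDl lerD2r.
  by rewrite ExZ expr2 invfM mulrA mulrC ler_wpM2r ?invr_ge0 ?ler0n // HY.
apply: Ex_le => p pv.
have nn : 0 <= (1 + (2 * C + 1) / N) * ((A t p)%:R * Z t p ^+ 2)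
   + (N^-1 * ((A t p)%:R * Y t p ^+ 2) + C ^+ 2 / N ^+ 2).
  have z2 (b : bool) (z : R) : 0 <= b%:R * z ^+ 2 by rewrite mulr_ge0 ?ler0n ?sqr_ge0.
  have q0 : 0 <= C ^+ 2 / N ^+ 2 by rewrite divr_ge0 ?sqr_ge0.
  have q1 : 0 <= 1 + (2 * C + 1) / N by rewrite addr_ge0 // divr_ge0 // addr_ge0 // mulr_ge0.
  by rewrite !addr_ge0 // mulr_ge0 // invr_ge0 ltW.
case: (boolP (A t.+1 p)) => At; last first.
  rewrite (_ : (fun s => _) = fun=> 0) ?step_cst //; apply/funext => s.
  by rewrite Aapp (negbTE At) mul0r.
have [d0 inc drift] := H _ _ tT pv At.
set z := Z t p in inc drift nn *; set y := Y t p in drift nn *.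
rewrite (Asub _ _ At) !mul1r in nn *.
have -> : (fun s => (A t.+1 (app t p s))%:R * Z t.+1 (app t p s) ^+ 2) =
  (fun s => (Z t.+1 (app t p s)) ^+ 2) by apply/funext => s; rewrite Aapp At mul1r.
set X := fun s => Z t.+1 (app t p s) in inc drift *.
rewrite -/(X _).
apply: le_trans (_ : step (p t) (fun s => (2 * z) * X s + (C ^+ 2 / N ^+ 2 - z ^+ 2)) <= _).
  apply: step_le => s'; rewrite /trans (negbTE d0) => -[ab abd ->].
  have hx := inc _ abd; rewrite -/(X _) in hx *.
  set x := X _ in hx *.
  have : (x - z) ^+ 2 <= (C / N) ^+ 2.
    by rewrite -real_normK ?num_real // lerXn2r ?nnegrE ?divr_ge0 // ltW.
  by rewrite expr_div_n; lra.
rewrite stepD stepZ step_cst -/(X _).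
set e := step _ _ in drift *.
have h1 : 2 * z * (e - z) <= 2 * `|z| * ((C * `|z| + y) / N).
  apply: le_trans (ler_norm _) _; rewrite normrM normrM ger0_norm //.
  by rewrite ler_wpM2l // mulr_ge0.
have h2 : 2 * `|z| * ((C * `|z| + y) / N) <= ((2 * C + 1) * z ^+ 2 + y ^+ 2) / N.
  rewrite mulrA ler_pM2r ?invr_gt0 // -[z ^+ 2]real_normK ?num_real //.
  have : 0 <= (`|z| - y) ^+ 2 by exact: sqr_ge0.
  by lra.
have h3 := le_trans h1 h2.
by lra.
Qed.

End Gronwall.

(** * The exponential functionals of the cycle sizes *)
Section Functionals.
Context {R : realType} {n : nat}.
Implicit Types (s : 'S_n) (p : nat -> 'S_n) (h m th : R).
Local Notation N := n%:R.
Local Notation D := (@D R n).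
Local Notation c s v := (csize s v)%:R.

(** F is the Laplace transform of the size of the cycle of a uniform vertex. As
    functions of th, Phi has derivative - F and F has derivative - G, while
    Phi 0 is the number of cycles divided by n. *)
Definition F th s : R := N^-1 * \sum_v expR (- (th * c s v)).
Definition Phi th s : R := N^-1 * \sum_v (expR (- (th * c s v)) / c s v).
Definition G th s : R := N^-1 * \sum_v (c s v * expR (- (th * c s v))).

(** A clock that compares the dynamics with the Erdos-Renyi graph: n ^ 2 / D
    uniform ordered pairs of vertices are needed on average to find one in two
    different cycles, so at time t about n * uu t edges would have been thrown.
    Then thp is the characteristic of the limit equation of F, along which F
    keeps the value 1 - h that it has at time 0. *)
Definition uu t p : R := \sum_(k < t) N / D (p k).
Definition thp h t p : R := - ln (1 - h) - 2 * h * uu t p.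

Lemma uuS t p : uu t.+1 p = uu t p + N / D (p t).
Proof. by rewrite /uu big_ord_recr. Qed.

Lemma uu_app t p s : uu t.+1 (app t p s) = uu t.+1 p.
Proof. by apply: eq_bigr => k _; rewrite app_le // -ltnS. Qed.

Lemma uu_ge0 t p : 0 <= uu t p.
Proof. by apply: sumr_ge0 => k _; rewrite divr_ge0 ?ler0n. Qed.

Lemma thpS h t p : thp h t.+1 p = thp h t p - 2 * h * (N / D (p t)).
Proof. by rewrite /thp uuS; ring. Qed.

Lemma thp_app h t p s : thp h t.+1 (app t p s) = thp h t.+1 p.
Proof. by rewrite /thp uu_app. Qed.

Lemma F_fuse th s a b : porbit s a != porbit s b ->
  F th (fuse s a b) = F th s + N^-1 *
    ((c s a + c s b) * expR (- (th * c s a)) * expR (- (th * c s b))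
     - c s a * expR (- (th * c s a)) - c s b * expR (- (th * c s b))).
Proof.
move=> ab; rewrite /F (sum_fuse (fun k => expR (- (th * k%:R))) ab) natrD.
set S := \sum_(_ | _) _.
by rewrite [th * (_ + _)]mulrDr opprD expRD; ring.
Qed.

Lemma Phi_fuse th s a b : porbit s a != porbit s b ->
  Phi th (fuse s a b) = Phi th s + N^-1 *
    (expR (- (th * c s a)) * expR (- (th * c s b))
     - expR (- (th * c s a)) - expR (- (th * c s b))).
Proof.
move=> ab; rewrite /Phi (sum_fuse (fun k => expR (- (th * k%:R)) / k%:R) ab).
have h v : c s v != 0 :> R by rewrite pnatr_eq0 -lt0n csize_gt0.
have hab : c s a + c s b != 0 :> R by rewrite -natrD pnatr_eq0 addn_eq0 -!leqn0 leqNgt csize_gt0.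
rewrite natrD [(_ + _) * (_ / _)]mulrC divfK // ![c s _ * (_ / _)]mulrC !divfK //.
set S := \sum_(_ | _) _.
by rewrite [th * (_ + _)]mulrDr opprD expRD; ring.
Qed.

(** The leading terms are the drift of the limit equation; the sum corrects for
    the pairs inside a common cycle and is of lower order. *)
Lemma step_F th s : diffp s != finset.set0 ->
  step s (F th) = F th s - 2 * (N / D s) * G th s * (1 - F th s)
   + 2 / (N * D s) * \sum_v (c s v ^+ 2 * (expR (- (th * c s v)) - expR (- (th * c s v)) ^+ 2)).
Proof.
move=> d0; have D0 : D s != 0 by rewrite gt_eqF // -D_gt0.
have [n0|n0] := posnP n.
  by case/set0Pn: d0 => -[a b] _; have := ltn_ord a; rewrite [X in (_ < X)%N]n0.
have N0 : N != 0 :> R by rewrite pnatr_eq0 -lt0n.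
rewrite /step (negbTE d0).
pose e k : R := expR (- (th * k%:R)).
pose ce k : R := k%:R * e k.
rewrite (eq_bigr (fun ab => F th s + N^-1 * (ce (csize s ab.1) * e (csize s ab.2)
   + e (csize s ab.1) * ce (csize s ab.2) - ce (csize s ab.1) * 1 - 1 * ce (csize s ab.2)))); last first.
  move=> [a b] ab /=; rewrite F_fuse -?mem_diffp //; congr (_ + _ * _).
  by rewrite /ce /e; ring.
rewrite big_split /= sumr_const -mulr_sumr !sumrB big_split /=.
rewrite (sum_diffp s ce e) (sum_diffp s e ce) (sum_diffp s ce (fun=> 1)) (sum_diffp s (fun=> 1) ce).
rewrite sumr_const card_ord -[F th s *+ _]mulr_natl -[#|_|%:R]/(D s).
have -> : \sum_v e (csize s v) = N * F th s by rewrite /F mulVKf.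
have -> : \sum_v ce (csize s v) = N * G th s by rewrite /G mulVKf.
have -> : \sum_v (ce (csize s v) * e (csize s v)) *+ csize s v = \sum_v c s v ^+ 2 * e (csize s v) ^+ 2.
  by apply: eq_bigr => v _; rewrite -[LHS]mulr_natl /ce; ring.
have -> : \sum_v (e (csize s v) * ce (csize s v)) *+ csize s v = \sum_v c s v ^+ 2 * e (csize s v) ^+ 2.
  by apply: eq_bigr => v _; rewrite -[LHS]mulr_natl /ce; ring.
have -> : \sum_v (ce (csize s v) * 1) *+ csize s v = \sum_v c s v ^+ 2 * e (csize s v).
  by apply: eq_bigr => v _; rewrite -[LHS]mulr_natl /ce; ring.
have -> : \sum_v (1 * ce (csize s v)) *+ csize s v = \sum_v c s v ^+ 2 * e (csize s v).
  by apply: eq_bigr => v _; rewrite -[LHS]mulr_natl /ce; ring.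
have -> : \sum_v c s v ^+ 2 * (expR (- (th * c s v)) - expR (- (th * c s v)) ^+ 2) =
   \sum_v c s v ^+ 2 * e (csize s v) - \sum_v c s v ^+ 2 * e (csize s v) ^+ 2.
  by rewrite -sumrB; apply: eq_bigr => v _; rewrite mulrBr.
set X := \sum_v _; set Y := \sum_v _; clearbody X Y.
by field; rewrite N0 D0.
Qed.

Lemma step_Phi th s : diffp s != finset.set0 ->
  step s (Phi th) = Phi th s + (N / D s) * (F th s ^+ 2 - 2 * F th s)
   + 1 / (N * D s) * \sum_v (c s v * (2 * expR (- (th * c s v)) - expR (- (th * c s v)) ^+ 2)).
Proof.
move=> d0; have D0 : D s != 0 by rewrite gt_eqF // -D_gt0.
have [n0|n0] := posnP n.
  by case/set0Pn: d0 => -[a b] _; have := ltn_ord a; rewrite [X in (_ < X)%N]n0.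
have N0 : N != 0 :> R by rewrite pnatr_eq0 -lt0n.
rewrite /step (negbTE d0).
pose e k : R := expR (- (th * k%:R)).
rewrite (eq_bigr (fun ab => Phi th s + N^-1 * (e (csize s ab.1) * e (csize s ab.2)
   - e (csize s ab.1) * 1 - 1 * e (csize s ab.2)))); last first.
  move=> [a b] ab /=; rewrite Phi_fuse -?mem_diffp //; congr (_ + _ * _).
  by rewrite /e; ring.
rewrite big_split /= sumr_const -mulr_sumr !sumrB /=.
rewrite (sum_diffp s e e) (sum_diffp s e (fun=> 1)) (sum_diffp s (fun=> 1) e).
rewrite sumr_const card_ord -[Phi th s *+ _]mulr_natl -[#|_|%:R]/(D s).
have -> : \sum_v e (csize s v) = N * F th s by rewrite /F mulVKf.
have -> : \sum_v (e (csize s v) * e (csize s v)) *+ csize s v = \sum_v c s v * e (csize s v) ^+ 2.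
  by apply: eq_bigr => v _; rewrite -[LHS]mulr_natl.
have -> : \sum_v (e (csize s v) * 1) *+ csize s v = \sum_v c s v * e (csize s v).
  by apply: eq_bigr => v _; rewrite -[LHS]mulr_natl mulr1.
have -> : \sum_v (1 * e (csize s v)) *+ csize s v = \sum_v c s v * e (csize s v).
  by apply: eq_bigr => v _; rewrite -[LHS]mulr_natl mul1r.
have -> : \sum_v c s v * (2 * expR (- (th * c s v)) - expR (- (th * c s v)) ^+ 2) =
   2 * (\sum_v c s v * e (csize s v)) - \sum_v c s v * e (csize s v) ^+ 2.
  by rewrite mulr_sumr -sumrB; apply: eq_bigr => v _; rewrite mulrBr [in LHS]mulrCA.
set X := \sum_v _; set Y := \sum_v _; clearbody X Y.
by field; rewrite N0 D0.
Qed.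

Lemma avg_le (f : 'I_n -> R) (B : R) : 0 <= B -> (forall v, f v <= B) ->
  N^-1 * \sum_v f v <= B.
Proof.
move=> B0 H; have [n0|n0] := posnP n.
  by rewrite [in X in X^-1]n0 invr0 mul0r.
have N0 : 0 < N :> R by rewrite ltr0n.
rewrite mulrC ler_pdivrMr // [leRHS]mulrC.
have -> : N * B = \sum_(v < n) B by rewrite sumr_const card_ord -[RHS]mulr_natl.
exact: ler_sum.
Qed.

Lemma avg_ge0 (f : 'I_n -> R) : (forall v, 0 <= f v) -> 0 <= N^-1 * \sum_v f v.
Proof. by move=> H; rewrite mulr_ge0 ?invr_ge0 ?ler0n ?sumr_ge0. Qed.

Lemma avg_norm_le (f : 'I_n -> R) (B : R) : 0 <= B -> (forall v, `|f v| <= B) ->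
  `|N^-1 * \sum_v f v| <= B.
Proof.
move=> B0 H; rewrite normrM ger0_norm ?invr_ge0 ?ler0n //.
apply: le_trans (_ : N^-1 * \sum_v `|f v| <= _); last exact: avg_le.
by rewrite ler_wpM2l ?invr_ge0 ?ler0n // ler_norm_sum.
Qed.

Lemma mul_expRN_le (m x : R) : 0 < m -> 0 <= x -> x * expR (- (m * x)) <= m^-1.
Proof.
move=> m0 x0; rewrite expRN ler_pdivrMr ?expR_gt0 // ler_pdivlMl //.
by apply: le_trans (expR_ge1Dx _); rewrite lerDr.
Qed.

Lemma sqr_mul_expRN_le (m x : R) : 0 < m -> 0 <= x ->
  x ^+ 2 * expR (- (m * x)) <= 4 / m ^+ 2.
Proof.
move=> m0 x0; have m2 : 0 < m / 2 by lra.
have := mul_expRN_le m2 x0.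
have -> : - (m * x) = - (m / 2 * x) + - (m / 2 * x) by field.
rewrite expRD; set E := expR _ => H.
have -> : x ^+ 2 * (E * E) = (x * E) ^+ 2 by ring.
have -> : 4 / m ^+ 2 = (m / 2)^-1 ^+ 2 by field; rewrite gt_eqF.
by rewrite lerXn2r // nnegrE ?(mulr_ge0 x0 (expR_ge0 _)) // invr_ge0 ltW.
Qed.

Lemma expR_decr (y : R) : 0 <= y ->
  0 <= 1 - expR (- y) <= y /\ `|1 - expR (- y) - y| <= y ^+ 2.
Proof.
move=> y0; have h1 : expR (- y) <= 1 by rewrite expR_le1; lra.
have h2 := expR_ge1Dx (- y).
have h3 : expR (- y) * (1 + y) <= 1.
  rewrite expRN mulrC ler_pdivrMr ?expR_gt0 // mul1r; exact: expR_ge1Dx.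
split; first by apply/andP; split; lra.
rewrite ler_norml; have e0 := expR_ge0 (- y).
apply/andP; split; last by nra.
set E := expR (- y) in h1 h2 h3 e0 *.
have : E <= 1 - y + y ^+ 2.
  have y1 : 0 < 1 + y by lra.
  rewrite -(ler_pM2r y1); apply: le_trans h3 _.
  have : 0 <= y ^+ 3 by rewrite exprn_ge0.
  by rewrite !exprS; lra.
by lra.
Qed.

Section Bounds.
Variables (s : 'S_n) (m th d : R).
Hypotheses (m0 : 0 < m) (mth : m <= th) (d0 : 0 <= d).

Let th0 : 0 < th. Proof. exact: lt_le_trans mth. Qed.

Let c0 v : 0 <= c s v :> R. Proof. exact: ler0n. Qed.
Let c1 v : 1 <= c s v :> R. Proof. by rewrite ler1n csize_gt0. Qed.
Let cp v : 0 < c s v :> R. Proof. exact: lt_le_trans (c1 v). Qed.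

Let e0 v : 0 <= expR (- (th * c s v)). Proof. exact: expR_ge0. Qed.
Let e1 v : expR (- (th * c s v)) <= 1.
Proof. by rewrite expR_le1 oppr_le0 mulr_ge0 // ltW. Qed.
Let em v : expR (- (th * c s v)) <= expR (- (m * c s v)).
Proof. by rewrite ler_expR lerN2 ler_wpM2r. Qed.

Lemma ce_le v : c s v * expR (- (th * c s v)) <= m^-1.
Proof. by apply: le_trans (mul_expRN_le m0 (c0 v)); rewrite ler_wpM2l. Qed.

Lemma cce_le v : c s v ^+ 2 * expR (- (th * c s v)) <= 4 / m ^+ 2.
Proof. by apply: le_trans (sqr_mul_expRN_le m0 (c0 v)); rewrite ler_wpM2l ?sqr_ge0. Qed.

Lemma G_ge0 : 0 <= G th s.
Proof. by apply: avg_ge0 => v; rewrite mulr_ge0. Qed.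

Lemma G_le : G th s <= m^-1.
Proof. by apply: avg_le => [|v]; [rewrite invr_ge0 ltW|exact: ce_le]. Qed.

Lemma F_ge0 : 0 <= F th s. Proof. exact: avg_ge0. Qed.
Lemma F_le1 : F th s <= 1. Proof. exact: avg_le. Qed.

Let eD v : expR (- ((th + d) * c s v)) = expR (- (th * c s v)) * expR (- (d * c s v)).
Proof. by rewrite -expRD; congr expR; ring. Qed.

Let FB : F th s - F (th + d) s =
  N^-1 * \sum_v (expR (- (th * c s v)) * (1 - expR (- (d * c s v)))).
Proof.
rewrite /F -mulrBr -sumrB; congr (_ * _); apply: eq_bigr => v _.
by rewrite eD; ring.
Qed.

Let PB : Phi th s - Phi (th + d) s =
  N^-1 * \sum_v (expR (- (th * c s v)) * (1 - expR (- (d * c s v))) / c s v).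
Proof.
rewrite /Phi -mulrBr -sumrB; congr (_ * _); apply: eq_bigr => v _.
by rewrite eD; ring.
Qed.

Let dc v : 0 <= d * c s v. Proof. exact: mulr_ge0. Qed.

Lemma F_diff : 0 <= F th s - F (th + d) s <= d / m.
Proof.
rewrite FB; apply/andP; split.
  by apply: avg_ge0 => v; rewrite mulr_ge0 //; have [/andP[]] := expR_decr (dc v).
apply: avg_le => [|v]; first by rewrite divr_ge0 // ltW.
have [/andP[_ h] _] := expR_decr (dc v).
apply: le_trans (_ : expR (- (th * c s v)) * (d * c s v) <= _); first by rewrite ler_wpM2l.
by rewrite mulrCA ler_wpM2l // mulrC ce_le.
Qed.

Lemma F_diff2 : `|F th s - F (th + d) s - d * G th s| <= d ^+ 2 * (4 / m ^+ 2).
Proof.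
rewrite FB /G mulrCA -mulrBr mulr_sumr -sumrB; apply: avg_norm_le => [|v].
  by rewrite mulr_ge0 ?sqr_ge0 // divr_ge0 ?sqr_ge0.
have [_ h] := expR_decr (dc v).
rewrite [X in `|X|](_ : _ = expR (- (th * c s v)) * (1 - expR (- (d * c s v)) - d * c s v)); last by ring.
rewrite normrM ger0_norm //.
apply: le_trans (_ : expR (- (th * c s v)) * (d * c s v) ^+ 2 <= _); first by rewrite ler_wpM2l.
by rewrite exprMn mulrCA ler_wpM2l ?sqr_ge0 // mulrC cce_le.
Qed.

Lemma Phi_diff : 0 <= Phi th s - Phi (th + d) s <= d.
Proof.
rewrite PB; apply/andP; split.
  apply: avg_ge0 => v; rewrite divr_ge0 // mulr_ge0 //.
  by have [/andP[]] := expR_decr (dc v).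
apply: avg_le => [//|v].
have [/andP[h0 h] _] := expR_decr (dc v).
rewrite ler_pdivrMr //; apply: le_trans h.
by rewrite ler_piMl.
Qed.

Lemma Phi_diff2 : `|Phi th s - Phi (th + d) s - d * F th s| <= d ^+ 2 / m.
Proof.
rewrite PB /F mulrCA -mulrBr mulr_sumr -sumrB; apply: avg_norm_le => [|v].
  by rewrite divr_ge0 ?sqr_ge0 // ltW.
have [_ h] := expR_decr (dc v).
rewrite [X in `|X|](_ : _ = expR (- (th * c s v)) * (1 - expR (- (d * c s v)) - d * c s v) / c s v); last first.
  by field; rewrite gt_eqF.
rewrite normrM normrM [`|expR _|]ger0_norm // [`|_^-1|]ger0_norm ?invr_ge0 //.
rewrite ler_pdivrMr //.
apply: le_trans (_ : expR (- (th * c s v)) * (d * c s v) ^+ 2 <= _); first by rewrite ler_wpM2l.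
rewrite [leLHS](_ : _ = d ^+ 2 * c s v * (c s v * expR (- (th * c s v)))); last by ring.
rewrite [leRHS]mulrAC ler_wpM2l ?mulr_ge0 ?sqr_ge0 //; exact: ce_le.
Qed.

Lemma step_F_bound : 0 < D s ->
  `|step s (F th) - (F th s - 2 * (N / D s) * G th s * (1 - F th s))| <= 8 / (m ^+ 2 * D s).
Proof.
move=> D0; rewrite step_F ?(D_gt0 (R := R)) //.
rewrite [X in `|X|](_ : _ = 2 / D s * (N^-1 * \sum_v
  (c s v ^+ 2 * (expR (- (th * c s v)) - expR (- (th * c s v)) ^+ 2)))); last by rewrite invfM; ring.
rewrite normrM ger0_norm ?divr_ge0 ?(ltW D0) //.
apply: le_trans (_ : 2 / D s * (4 / m ^+ 2) <= _).
  rewrite ler_wpM2l ?divr_ge0 ?(ltW D0) //; apply: avg_norm_le => [|v].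
    by rewrite divr_ge0 ?sqr_ge0.
  rewrite ger0_norm; last first.
    by rewrite mulr_ge0 ?sqr_ge0 // subr_ge0 expr2 ler_piMl.
  apply: le_trans (cce_le v); rewrite ler_wpM2l ?sqr_ge0 //.
  by rewrite gerBl sqr_ge0.
by rewrite le_eqVlt; apply/orP; left; apply/eqP; field; rewrite !gt_eqF.
Qed.

Lemma step_Phi_bound : 0 < D s ->
  `|step s (Phi th) - (Phi th s + (N / D s) * (F th s ^+ 2 - 2 * F th s))| <= 2 / (m * D s).
Proof.
move=> D0; rewrite step_Phi ?(D_gt0 (R := R)) //.
rewrite [X in `|X|](_ : _ = (D s)^-1 * (N^-1 * \sum_v
  (c s v * (2 * expR (- (th * c s v)) - expR (- (th * c s v)) ^+ 2)))); last by rewrite invfM; ring.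
rewrite normrM ger0_norm ?invr_ge0 ?(ltW D0) //.
apply: le_trans (_ : (D s)^-1 * (2 / m) <= _).
  rewrite ler_wpM2l ?invr_ge0 ?(ltW D0) //; apply: avg_norm_le => [|v].
    by rewrite divr_ge0 // ltW.
  have ee : expR (- (th * c s v)) ^+ 2 <= expR (- (th * c s v)) by rewrite expr2 ler_piMl.
  have e2 : 0 <= expR (- (th * c s v)) ^+ 2 by rewrite sqr_ge0.
  have ce := ce_le v; have := e0 v; have := c0 v; move: ee e2 ce.
  set E := expR _; set E2 := E ^+ 2; set C := c s v => ee e2 ce C0 E0.
  rewrite ger0_norm ?mulr_ge0 //; last by lra.
  by nra.
by rewrite le_eqVlt; apply/orP; left; apply/eqP; field; rewrite !gt_eqF.
Qed.

Lemma F_fuse_bound a b : porbit s a != porbit s b ->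
  `|F th (fuse s a b) - F th s| <= 2 / m / N.
Proof.
move=> ab; rewrite F_fuse // addrAC subrr add0r normrM ger0_norm ?invr_ge0 ?ler0n //.
rewrite mulrC ler_wpM2r ?invr_ge0 ?ler0n //.
have ha := ce_le a; have hb := ce_le b.
have := e0 a; have := e0 b; have := e1 a; have := e1 b; have := c0 a; have := c0 b.
set A := c s a in ha *; set B := c s b in hb *.
set E := expR _ in ha *; set E' := expR _ in hb *.
set M := m^-1 in ha hb * => B0 A0 E1' E1 E0' E0.
rewrite ler_norml; apply/andP; split.
  have : 0 <= A * E * E' by rewrite !mulr_ge0.
  have : 0 <= B * E * E' by rewrite !mulr_ge0.
  by rewrite -/M; lra.
have h1 : A * E * E' <= A * E by rewrite ler_piMr // mulr_ge0.
have h2 : B * E' * E <= B * E' by rewrite ler_piMr // mulr_ge0.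
have h3 : 0 <= M by rewrite invr_ge0 ltW.
by rewrite -/M; lra.
Qed.

Lemma Phi_fuse_bound a b : porbit s a != porbit s b ->
  `|Phi th (fuse s a b) - Phi th s| <= N^-1.
Proof.
move=> ab; rewrite Phi_fuse // addrAC subrr add0r normrM ger0_norm ?invr_ge0 ?ler0n //.
rewrite -[leRHS]mulr1 ler_wpM2l ?invr_ge0 ?ler0n //.
have := e0 a; have := e0 b; have := e1 a; have := e1 b.
set E := expR _; set E' := expR _ => h1 h2 h3 h4.
by rewrite ler_norml; apply/andP; split; nra.
Qed.

End Bounds.

End Functionals.

Lemma sqr_onem_le1 (R : realType) (h : R) : 0 < h -> h < 1 -> (1 - h) ^+ 2 <= 1.
Proof. by move=> h0 h1; nra. Qed.

Lemma dist_onem_le1 (R : realType) (h f : R) : 0 < h -> h < 1 -> 0 <= f -> f <= 1 ->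
  `|f - (1 - h)| <= 1.
Proof. by move=> h0 h1 f0 f1; rewrite ler_norml; apply/andP; split; lra. Qed.

(** * Concentration along the characteristics *)
Section Concentration.
Context {R : realType} {n : nat}.
Implicit Types (s : 'S_n) (p : nat -> 'S_n) (t : nat).
Local Notation N := n%:R.
Local Notation D := (@D R n).
Variables (h m b : R) (T : nat).
Hypotheses (h0 : 0 < h) (h1 : h < 1) (m0 : 0 < m) (b0 : 0 < b).
Hypotheses (TN : T%:R <= (1 - b) * N) (bN : 2 <= b * N).

Let C1 : R := 2 / b.
Let C10 : 0 < C1. Proof. by rewrite divr_gt0. Qed.

(** Above a positive level m of th the functionals are Lipschitz functions
    of th, so characteristics are only followed down to m. *)
Definition alive t p : bool := m <= thp h t p.
(** In the limit both F and Phi + (1 - h) ^ 2 u are constant along the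
    characteristic of h, with value 1 - h. *)
Definition errF t p : R := F (thp h t p) (p t) - (1 - h).
Definition errPhi t p : R := Phi (thp h t p) (p t) + (1 - h) ^+ 2 * uu t p - (1 - h).

Let N0 : 0 < N :> R. Proof. by have := ltr0n R n; case: posnP => [n0|//]; move: bN; rewrite n0; lra. Qed.
Let N1 : 1 <= N :> R. Proof. by rewrite ler1n -(ltr0n R). Qed.

Lemma horizon_lt t : (t <= T)%N -> (t < n)%N.
Proof.
rewrite -(ler_nat R) -(ltr_nat R) => tT; apply: (le_lt_trans (le_trans tT TN)).
by rewrite gtr_pMl // ltrBlDr ltrDl.
Qed.

Lemma D_lower t p : (t <= T)%N -> valid t p -> N ^+ 2 / C1 <= D (p t).
Proof.
move=> tT pv; apply: le_trans (valid_D (horizon_lt tT) pv).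
rewrite expr2 -mulrA ler_pM2l // /C1 invfM invrK.
have : t%:R <= T%:R :> R by rewrite ler_nat.
move: TN bN; set x : R := n%:R; set y : R := T%:R; set z : R := t%:R.
by clearbody x y z; lra.
Qed.

Section OneStep.
Variables (t : nat) (p : nat -> 'S_n).
Hypotheses (tT : (t < T)%N) (pv : valid t p) (At : alive t.+1 p).

Let s := p t.
Let q := N / D s.
Let d := 2 * h * q.
Let th := thp h t.+1 p.

Let D0 : 0 < D s.
Proof. by apply: lt_le_trans (D_lower (ltnW tT) pv); rewrite divr_gt0 ?exprn_gt0. Qed.
Let invD : (D s)^-1 <= C1 / N ^+ 2.
Proof. by rewrite -[leRHS]invrK lef_pV2 ?posrE ?invr_gt0 ?divr_gt0 ?exprn_gt0 // invf_div D_lower // ltnW. Qed.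
Let q0 : 0 <= q. Proof. by rewrite divr_ge0 ?(ltW N0) ?(ltW D0). Qed.
Let qle : q <= C1 / N.
Proof.
have -> : C1 / N = N * (C1 / N ^+ 2) by field; rewrite gt_eqF.
by rewrite ler_pM2l.
Qed.
Let d0 : 0 <= d. Proof. by rewrite mulr_ge0 // mulr_ge0 // ltW. Qed.
Let dle : d <= 2 * C1 / N.
Proof.
have hq : h * q <= q by rewrite ler_piMl // ltW.
have := le_trans hq qle; rewrite /d -!mulrA ler_pM2l //.
Qed.
Let thE : thp h t p = th + d.
Proof. by rewrite /th thpS /d /q; ring. Qed.
Let mth : m <= th. Proof. exact: At. Qed.

Lemma diffp_neq0 : diffp s != finset.set0.
Proof. by rewrite (D_gt0 (R := R)). Qed.

Let errFS s' : errF t.+1 (app t p s') = F th s' - (1 - h).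
Proof. by rewrite /errF thp_app appS. Qed.

Let errPhiS s' : errPhi t.+1 (app t p s') = Phi th s' + (1 - h) ^+ 2 * (uu t p + q) - (1 - h).
Proof. by rewrite /errPhi thp_app appS uu_app uuS. Qed.

Let dm : d / m <= 2 * C1 / m / N.
Proof. by rewrite [leRHS]mulrAC ler_pM2r ?invr_gt0 //; exact: dle. Qed.

Lemma errF_incr ab : ab \in diffp s ->
  `|errF t.+1 (app t p (fuse s ab.1 ab.2)) - errF t p| <= (2 + 2 * C1) / m / N.
Proof.
case: ab => a b'; rewrite mem_diffp /= => ab.
rewrite errFS /errF thE -/s.
have B1 := F_fuse_bound m0 mth ab.
have /andP[B2 B3] := F_diff s m0 mth d0.
rewrite [X in `|X|](_ : _ = (F th (fuse s a b') - F th s) + (F th s - F (th + d) s)); last by ring.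
apply: le_trans (ler_normD _ _) _; rewrite (ger0_norm B2).
apply: le_trans (lerD B1 (le_trans B3 dm)) _.
by rewrite le_eqVlt; apply/orP; left; apply/eqP; ring.
Qed.

Let f'err : `|F th s - (1 - h)| <= `|errF t p| + d / m.
Proof.
rewrite /errF thE -/s.
have /andP[B2 B3] := F_diff s m0 mth d0.
rewrite [X in `|X|](_ : _ = (F (th + d) s - (1 - h)) + (F th s - F (th + d) s)); last by ring.
by apply: le_trans (ler_normD _ _) _; rewrite lerD2l ger0_norm.
Qed.

Let d2 : d ^+ 2 <= 4 * C1 ^+ 2 / N ^+ 2.
Proof.
have -> : 4 * C1 ^+ 2 / N ^+ 2 = (2 * C1 / N) ^+ 2 by field; rewrite gt_eqF.
by rewrite lerXn2r ?nnegrE ?d0 ?dle // (le_trans d0 dle).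
Qed.

Definition KF : R := (4 * C1 ^+ 2 + 8 * C1 + 16 * C1 ^+ 2) / m ^+ 2.

(** Mergers change F by about - 2 q G (1 - F), and the motion of the
    characteristic by d = 2 h q changes it by d G. Their sum 2 q G (F - (1 - h))
    is proportional to the error. *)
Lemma errF_drift :
  `|step s (fun s' => errF t.+1 (app t p s')) - errF t p| <=
  ((2 + 2 * C1) / m * `|errF t p| + KF / N) / N.
Proof.
have -> : (fun s' => errF t.+1 (app t p s')) = (fun s' => F th s' + - (1 - h)).
  by apply/funext => s'; rewrite errFS.
rewrite stepD step_cst.
have B1 := step_F_bound m0 mth D0.
have B2 := F_diff2 s m0 mth d0.
have B3 := f'err; have G0 := G_ge0 s th; have G1 := G_le s m0 mth.
rewrite -/(F th) in B1 *; set X := step s (F th) in B1 *.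
set z := `|errF t p| in B3 *; rewrite /errF thE -/s.
set f' := F th s in B1 B2 B3 *; set f := F (th + d) s in B2 *.
set g := G th s in B1 B2 G0 G1; rewrite -/q in B1.
rewrite [X in `|X|](_ : _ = (X - (f' - 2 * q * g * (1 - f'))) + (f' - f - d * g)
   + 2 * q * g * (f' - (1 - h))); last by rewrite /d; ring.
apply: le_trans (ler_normD _ _) _.
apply: le_trans (lerD (le_trans (ler_normD _ _) (lerD B1 B2)) (lexx _)) _.
have B4 : `|2 * q * g * (f' - (1 - h))| <= 2 * (C1 / N) / m * (z + 2 * C1 / m / N).
  have qg : 0 <= 2 * q * g by exact: mulr_ge0 (mulr_ge0 (ler0n _ 2) q0) G0.
  rewrite normrM (ger0_norm qg); apply: ler_pM => //.
    by apply: ler_pM => //; [rewrite mulr_ge0|rewrite ler_pM2l].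
  by apply: le_trans B3 _; rewrite lerD2l.
have B5 : 8 / (m ^+ 2 * D s) <= 8 * C1 / m ^+ 2 / N ^+ 2.
  have -> : 8 * C1 / m ^+ 2 / N ^+ 2 = 8 / m ^+ 2 * (C1 / N ^+ 2) by ring.
  by rewrite invfM mulrA ler_pM2l ?divr_gt0 ?exprn_gt0.
have B6 : d ^+ 2 * (4 / m ^+ 2) <= 16 * C1 ^+ 2 / m ^+ 2 / N ^+ 2.
  have -> : 16 * C1 ^+ 2 / m ^+ 2 / N ^+ 2 = 4 * C1 ^+ 2 / N ^+ 2 * (4 / m ^+ 2) by field; rewrite !gt_eqF.
  by rewrite ler_wpM2r // divr_ge0 // sqr_ge0.
apply: le_trans (lerD (lerD B5 B6) B4) _.
have z0 : 0 <= z by exact: normr_ge0.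
rewrite -subr_ge0 [leRHS](_ : _ = 2 / m / N * z).
  by rewrite !mulr_ge0 ?invr_ge0 // ltW.
by rewrite /KF; field; rewrite !gt_eqF.
Qed.

Lemma errPhi_incr ab : ab \in diffp s ->
  `|errPhi t.+1 (app t p (fuse s ab.1 ab.2)) - errPhi t p| <= (1 + 3 * C1) / N.
Proof.
case: ab => a b'; rewrite mem_diffp /= => ab.
rewrite errPhiS /errPhi thE -/s.
have B1 := Phi_fuse_bound m0 mth ab.
have /andP[B2 B3] := Phi_diff s m0 mth d0.
rewrite [X in `|X|](_ : _ = (Phi th (fuse s a b') - Phi th s) +
  (Phi th s - Phi (th + d) s) + (1 - h) ^+ 2 * q); last by ring.
have q1 : 0 <= (1 - h) ^+ 2 * q <= C1 / N.
  rewrite mulr_ge0 ?sqr_ge0 //=; apply: le_trans qle; rewrite ler_piMl //.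
  exact: sqr_onem_le1.
case/andP: q1 => q1 q2.
apply: le_trans (ler_normD _ _) _; rewrite (ger0_norm q1).
apply: le_trans (lerD (ler_normD _ _) (lexx _)) _; rewrite (ger0_norm B2).
apply: le_trans (lerD (lerD B1 (le_trans B3 dle)) q2) _.
by rewrite le_eqVlt; apply/orP; left; apply/eqP; ring.
Qed.

Definition KPhi : R := (2 * C1 ^+ 2 + 2 * C1 + 4 * C1 ^+ 2) / m.

(** Here the contributions of the mergers, of the moving characteristic and of
    the clock add up to the square q (F - (1 - h)) ^ 2. *)
Lemma errPhi_drift :
  `|step s (fun s' => errPhi t.+1 (app t p s')) - errPhi t p| <=
  ((1 + 3 * C1) * `|errPhi t p| + (C1 * `|errF t p| + KPhi / N)) / N.
Proof.
have -> : (fun s' => errPhi t.+1 (app t p s')) =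
    (fun s' => Phi th s' + ((1 - h) ^+ 2 * (uu t p + q) - (1 - h))).
  by apply/funext => s'; rewrite errPhiS addrA.
rewrite stepD step_cst.
have B1 := step_Phi_bound m0 mth D0.
have B2 := Phi_diff2 s m0 mth d0.
have B3 := f'err; have F0 := F_ge0 s th; have F1 := F_le1 s m0 mth.
rewrite -/(Phi th) in B1 *; set X := step s (Phi th) in B1 *.
set z := `|errF t p| in B3 *; set z2 := `|errPhi t p|; rewrite /errPhi thE -/s.
set f' := F th s in B1 B2 B3 F0 F1 *; set P := Phi (th + d) s in B2 *.
set P' := Phi th s in B1 B2 *; rewrite -/q in B1.
rewrite [X in `|X|](_ : _ = (X - (P' + q * (f' ^+ 2 - 2 * f'))) + (P' - P - d * f')
   + q * (f' - (1 - h)) ^+ 2); last by rewrite /d; ring.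
apply: le_trans (ler_normD _ _) _.
apply: le_trans (lerD (le_trans (ler_normD _ _) (lerD B1 B2)) (lexx _)) _.
have B4 : `|q * (f' - (1 - h)) ^+ 2| <= C1 / N * (z + 2 * C1 / m / N).
  rewrite normrM (ger0_norm q0) normrX; apply: ler_pM; rewrite ?q0 ?qle ?exprn_ge0 //.
  apply: le_trans (_ : `|f' - (1 - h)| <= _).
    rewrite expr2 ler_piMl //; exact: dist_onem_le1.
  by apply: le_trans B3 _; rewrite lerD2l.
have B5 : 2 / (m * D s) <= 2 * C1 / m / N ^+ 2.
  have -> : 2 * C1 / m / N ^+ 2 = 2 / m * (C1 / N ^+ 2) by ring.
  by rewrite invfM mulrA ler_pM2l ?divr_gt0.
have B6 : d ^+ 2 / m <= 4 * C1 ^+ 2 / m / N ^+ 2.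
  by rewrite [leRHS]mulrAC ler_pM2r ?invr_gt0.
apply: le_trans (lerD (lerD B5 B6) B4) _.
have z0 : 0 <= z2 by exact: normr_ge0.
rewrite -subr_ge0 [leRHS](_ : _ = (1 + 3 * C1) * z2 / N).
  exact: divr_ge0 (mulr_ge0 (addr_ge0 ler01 (mulr_ge0 (ler0n _ 3) (ltW C10))) z0) (ltW N0).
by rewrite /KPhi; field; rewrite !gt_eqF.
Qed.

End OneStep.

Lemma alive_app t p s : alive t.+1 (app t p s) = alive t.+1 p.
Proof. by rewrite /alive thp_app. Qed.

Lemma alive_le t p : alive t.+1 p -> alive t p.
Proof.
rewrite /alive thpS => H; apply: le_trans H _; rewrite gerBl.
by rewrite mulr_ge0 ?divr_ge0 ?ler0n // mulr_ge0 // ltW.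
Qed.

Let thp0 p : thp h 0 p = - ln (1 - h).
Proof. by rewrite /thp /uu big_ord0 mulr0 subr0. Qed.

Let errF0 : errF 0%N (fun=> 1%g) = 0.
Proof.
rewrite /errF thp0 /F (eq_bigr (fun=> 1 - h)); last first.
  by move=> v _; rewrite csize1 mulr1 opprK lnK // posrE subr_gt0.
by rewrite sumr_const card_ord -[(1 - h) *+ _]mulr_natl mulKf ?subrr // gt_eqF.
Qed.

Let errPhi0 : errPhi 0%N (fun=> 1%g) = 0.
Proof.
rewrite /errPhi thp0 /uu big_ord0 mulr0 addr0 /Phi (eq_bigr (fun=> 1 - h)); last first.
  by move=> v _; rewrite csize1 mulr1 opprK lnK ?posrE ?subr_gt0 // divr1.
by rewrite sumr_const card_ord -[(1 - h) *+ _]mulr_natl mulKf ?subrr // gt_eqF.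
Qed.

Let CF : R := (2 + 2 * C1) / m.
Let MF : R := (KF ^+ 2 + CF ^+ 2) * expR (2 * CF + 1).

Let CF0 : 0 <= CF.
Proof. by rewrite divr_ge0 ?(ltW m0) // addr_ge0 // mulr_ge0 // ltW. Qed.

Let Tn : (T <= n)%N. Proof. exact/ltnW/horizon_lt. Qed.

Lemma errF_L2 t : (t <= T)%N ->
  Ex t (fun p => (alive t p)%:R * errF t p ^+ 2) <= MF / N.
Proof.
move=> tT; apply: (@Ex_gronwall _ _ errF (fun _ _ => KF / N) alive CF (KF ^+ 2) T) => //.
- exact: sqr_ge0.
- exact: alive_app.
- exact: alive_le.
- move=> {tT}t p tT pv At; split; first exact: diffp_neq0 tT pv.
    exact: errF_incr.
  exact: errF_drift.
- move=> {tT}t tT; rewrite -[leRHS](Ex_cst (n := n) t); apply: Ex_le => p _.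
  apply: le_trans (_ : 1 * (KF / N) ^+ 2 <= _).
    by rewrite ler_wpM2r ?sqr_ge0 // lern1 leq_b1.
  rewrite mul1r expr_div_n ler_wpM2l ?sqr_ge0 // lef_pV2 ?posrE ?exprn_gt0 //.
  by rewrite expr2 ler_peMl // ltW.
Qed.

Let CP : R := 1 + 3 * C1.
Let MP0 : R := 2 * C1 ^+ 2 * MF + 2 * KPhi ^+ 2.
Let MP : R := (MP0 + CP ^+ 2) * expR (2 * CP + 1).

Lemma errPhi_L2 t : (t <= T)%N ->
  Ex t (fun p => (alive t p)%:R * errPhi t p ^+ 2) <= MP / N.
Proof.
have MF0 : 0 <= MF by rewrite mulr_ge0 ?addr_ge0 ?sqr_ge0 // expR_ge0.
move=> tT; apply: (@Ex_gronwall _ _ errPhi (fun t p => C1 * `|errF t p| + KPhi / N) alive CP MP0 T) => //.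
- by rewrite addr_ge0 // mulr_ge0 // ltW.
- exact: addr_ge0 (mulr_ge0 (mulr_ge0 (ler0n _ 2) (sqr_ge0 _)) MF0) (mulr_ge0 (ler0n _ 2) (sqr_ge0 _)).
- exact: alive_app.
- exact: alive_le.
- move=> {tT}t p tT pv At; split; first exact: diffp_neq0 tT pv.
    exact: errPhi_incr.
  exact: errPhi_drift.
- move=> {tT}t tT; apply: le_trans (_ : Ex t (fun p => 2 * C1 ^+ 2 * ((alive t p)%:R * errF t p ^+ 2)
     + 2 * KPhi ^+ 2 / N) <= _).
    apply: Ex_le => p _; set y := (alive t p)%:R.
    have y01 : 0 <= y <= 1 by rewrite ler0n lern1 leq_b1.
    rewrite -[errF t p ^+ 2]real_normK ?num_real //.
    set z := `|_|; set k := KPhi / N.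
    have k2 : k ^+ 2 <= KPhi ^+ 2 / N.
      rewrite expr_div_n ler_wpM2l ?sqr_ge0 // lef_pV2 ?posrE ?exprn_gt0 //.
      by rewrite expr2 ler_peMl // ltW.
    rewrite -mulrA.
    apply: le_trans (_ : y * (2 * C1 ^+ 2 * z ^+ 2 + 2 * k ^+ 2) <= _).
      case/andP: y01 => y0 _; rewrite ler_wpM2l //.
      by have := sqr_ge0 (C1 * z - k); lra.
    rewrite mulrDr; apply: lerD.
      by rewrite le_eqVlt; apply/orP; left; apply/eqP; ring.
    case/andP: y01 => y0 y1; apply: le_trans (_ : 1 * (2 * k ^+ 2) <= _).
      by rewrite ler_wpM2r // mulr_ge0 // sqr_ge0.
    by rewrite mul1r -mulrA ler_pM2l.
  rewrite ExD ExZ Ex_cst /MP0 [leRHS]mulrDl lerD2r -[leRHS]mulrA.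
  apply: ler_wpM2l; first exact: mulr_ge0 (ler0n _ 2) (sqr_ge0 _).
  exact: errF_L2 (ltnW tT).
Qed.

End Concentration.

(** The constant depends neither on n nor on t, so the errors are of order
    n ^ (- 1/2) in mean square as long as the characteristic is alive. *)
Lemma concentration (R : realType) (h m b : R) : 0 < h -> h < 1 -> 0 < m -> 0 < b ->
  exists C : R, forall n t, t%:R <= (1 - b) * n%:R -> 2 <= b * n%:R ->
    Ex (n := n) t (fun p => (alive h m t p)%:R * errF h t p ^+ 2) <= C / n%:R /\
    Ex (n := n) t (fun p => (alive h m t p)%:R * errPhi h t p ^+ 2) <= C / n%:R.
Proof.
move=> h0 h1 m0 b0.
pose C1 : R := 2 / b; pose CF : R := (2 + 2 * C1) / m.
pose MF : R := (KF m b ^+ 2 + CF ^+ 2) * expR (2 * CF + 1).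
pose MP0 : R := 2 * C1 ^+ 2 * MF + 2 * KPhi m b ^+ 2.
pose MP : R := (MP0 + (1 + 3 * C1) ^+ 2) * expR (2 * (1 + 3 * C1) + 1).
exists (Num.max MF MP) => n t tn bn.
have n0 : 0 <= n%:R^-1 :> R by rewrite invr_ge0.
split.
  apply: le_trans (_ : MF / n%:R <= _).
    exact: (@errF_L2 R n h m b t h0 h1 m0 b0 tn bn t (leqnn _)).
  by rewrite ler_wpM2r // le_max lexx.
apply: le_trans (_ : MP / n%:R <= _).
  exact: (@errPhi_L2 R n h m b t h0 h1 m0 b0 tn bn t (leqnn _)).
by rewrite ler_wpM2r // le_max lexx orbT.
Qed.

(** * Events of vanishing probability *)
Section Negligible.
Context {R : realType}.
Local Notation path n := (nat -> 'S_n).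

Definition Pr n t (A : path n -> bool) : R := Ex t (fun p => (A p)%:R).

Lemma Pr_le n t (A B : path n -> bool) :
  (forall p, valid t p -> A p -> B p) -> Pr t A <= Pr t B.
Proof.
move=> H; apply: Ex_le => p pv; case: (boolP (A p)) => [/(H _ pv)->//|_].
by rewrite ler0n.
Qed.

Lemma Pr_ge0 n t (A : path n -> bool) : 0 <= Pr t A.
Proof. by apply: Ex_ge0 => p _; rewrite ler0n. Qed.

Lemma Pr_or n t (A B : path n -> bool) :
  Pr t (fun p => A p || B p) <= Pr t A + Pr t B.
Proof.
rewrite -ExD; apply: Ex_le => p _.
by case: (A p); case: (B p); rewrite /= ?addr0 ?add0r // lerDl.
Qed.

Lemma Pr_exists n t m (A : nat -> path n -> bool) :
  Pr t (fun p => [exists i : 'I_m, A i p]) <= \sum_(i < m) Pr t (A i).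
Proof.
rewrite -Ex_sum; apply: Ex_le => p _; case: existsP => [[i Ai]|_].
  by rewrite (bigD1 i) //= Ai lerDl sumr_ge0.
by rewrite sumr_ge0.
Qed.

Lemma chebyshev_Ex n t (A : path n -> bool) (Z : path n -> R) (g : R) : 0 < g ->
  Pr t (fun p => A p && (g < `|Z p|)) <= Ex t (fun p => (A p)%:R * Z p ^+ 2) / g ^+ 2.
Proof.
move=> g0; have g2 : 0 < g ^+ 2 by rewrite exprn_gt0.
rewrite mulrC -ExZ; apply: Ex_le => p _.
case: (A p); rewrite /= ?mul0r ?mulr0 //; rewrite mul1r.
case: ltP => h; last by rewrite mulr_ge0 ?sqr_ge0 // invr_ge0 ltW.
rewrite ler_pdivlMl // mulr1 -[Z p ^+ 2]real_normK ?num_real //.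
by rewrite lerXn2r ?nnegrE ?(ltW h) ?(ltW g0).
Qed.

(** Events are evaluated at the final time n, so that they live on one space. *)
Definition negl (A : forall n, path n -> bool) : Prop :=
  forall e : R, 0 < e -> exists n0, forall n, (n0 <= n)%N -> Pr n (A n) <= e.

Lemma negl_sub (A B : forall n, path n -> bool) (n0 : nat) :
  (forall n p, (n0 <= n)%N -> valid n p -> A n p -> B n p) -> negl B -> negl A.
Proof.
move=> H nB e /nB[n1 H1]; exists (maxn n0 n1) => n; rewrite geq_max => /andP[nn0 nn1].
by apply: le_trans (H1 _ nn1); apply: Pr_le => p; exact: H.
Qed.

Lemma negl_or (A B : forall n, path n -> bool) :
  negl A -> negl B -> negl (fun n p => A n p || B n p).
Proof.
move=> nA nB e e0; have e2 : 0 < e / 2 by lra.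
have [n1 H1] := nA _ e2; have [n2 H2] := nB _ e2.
exists (maxn n1 n2) => n; rewrite geq_max => /andP[nn1 nn2].
apply: le_trans (Pr_or _ _ _) _.
have := H1 _ nn1; have := H2 _ nn2; lra.
Qed.

Lemma negl_exists m (A : nat -> forall n, path n -> bool) :
  (forall i, (i < m)%N -> negl (A i)) -> negl (fun n p => [exists i : 'I_m, A i n p]).
Proof.
elim: m A => [|m IH] A H.
  by move=> e e0; exists 0%N => n _; apply: le_trans (Pr_exists n 0 (A ^~ n)) _; rewrite big_ord0 ltW.
apply: (@negl_sub _ (fun n p => [exists i : 'I_m, A i n p] || A m n p) 0%N).
  move=> n p _ _ /existsP[i Ai]; have := ltn_ord i; rewrite ltnS leq_eqVlt => /orP[/eqP <-|im].
    by rewrite Ai orbT.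
  by apply/orP; left; apply/existsP; exists (Ordinal im).
by apply: negl_or; [apply: IH => i im; apply: H; rewrite ltnS ltnW|exact: H].
Qed.

Lemma negl_of_rate (A : forall n, path n -> bool) (C : R) (n0 : nat) :
  (forall n, (n0 <= n)%N -> Pr n (A n) <= C / n%:R) -> negl A.
Proof.
move=> H e e0; pose n1 := (Num.truncn (`|C| / e)).+1.
exists (maxn n0 n1) => n; rewrite geq_max => /andP[nn0 nn1].
apply: le_trans (H _ nn0) _.
have n0' : 0 < n%:R :> R by rewrite ltr0n (leq_trans _ nn1).
rewrite ler_pdivrMr //; apply: le_trans (ler_norm _) _.
rewrite mulrC -ler_pdivrMr //; apply: ltW; apply: lt_le_trans (truncnS_gt _) _.
by rewrite ler_nat.
Qed.

Definition tm (s : R) n : nat := Num.truncn (s * n%:R).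

Lemma tm_le s n : 0 <= s -> (tm s n)%:R <= s * n%:R.
Proof. by move=> s0; have := truncn_le (s * n%:R); rewrite mulr_ge0 ?ler0n // => ->. Qed.

Lemma tm_gt s n : s * n%:R - 1 < (tm s n)%:R.
Proof. by have := truncnS_gt (s * n%:R); rewrite -/(tm s n) -[(tm s n).+1]addn1 natrD ltrBlDr. Qed.

Lemma tm_mono s s' n : s <= s' -> (tm s n <= tm s' n)%N.
Proof. by move=> ss; apply: le_truncn; rewrite ler_wpM2r. Qed.

Lemma tm_len s n : s <= 1 -> (tm s n <= n)%N.
Proof. by move=> s1; rewrite -[leqRHS](natrK (R := R)) -[n%:R]mul1r tm_mono. Qed.

Lemma uu_eq n t (p q : path n) : (forall k, (k < t)%N -> p k = q k) -> uu (R := R) t p = uu t q.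
Proof. by move=> H; apply: eq_bigr => k _; rewrite H. Qed.

Lemma large_nat (x : R) : exists n0 : nat, forall n, (n0 <= n)%N -> x <= n%:R.
Proof.
exists (Num.truncn `|x|).+1 => n nn; apply: le_trans (ler_norm _) _.
by apply: ltW; apply: lt_le_trans (truncnS_gt _) _; rewrite ler_nat.
Qed.

Section AtTime.
Variables (s h m g : R).
Hypotheses (s0 : 0 <= s) (s1 : s < 1) (h0 : 0 < h) (h1 : h < 1) (m0 : 0 < m) (g0 : 0 < g).

Lemma err_negl (r : R) : 0 <= r -> r <= s ->
  negl (fun n p => alive h m (tm r n) p && (g < `|errF h (tm r n) p|)) /\
  negl (fun n p => alive h m (tm r n) p && (g < `|errPhi h (tm r n) p|)).
Proof.
move=> r0 rs; have b0 : 0 < 1 - s by rewrite subr_gt0.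
have [C HC] := concentration h0 h1 m0 b0.
have [n0 Hn0] := large_nat (2 / (1 - s)).
have tn n : (tm r n)%:R <= (1 - (1 - s)) * n%:R.
  by rewrite opprB addrC subrK; apply: le_trans (tm_le n r0) _; rewrite ler_wpM2r.
have bn n : (n0 <= n)%N -> 2 <= (1 - s) * n%:R.
  by move=> /Hn0; rewrite ler_pdivrMr // mulrC.
have tl n : (tm r n <= n)%N by apply: tm_len; apply: le_trans rs (ltW s1).
have ad n : adapted (tm r n) (fun p : path n => (alive h m (tm r n) p && (g < `|errF h (tm r n) p|))%:R : R)
   /\ adapted (tm r n) (fun p : path n => (alive h m (tm r n) p && (g < `|errPhi h (tm r n) p|))%:R : R).
  have E (p q : path n) : (forall k, (k <= tm r n)%N -> p k = q k) -> uu (R := R) (tm r n) p = uu (tm r n) q.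
    by move=> H; apply: uu_eq => k /ltnW /H.
  by split=> p q H; rewrite /alive /errF /errPhi /thp (E _ _ H) (H _ (leqnn _)).
split; apply: (@negl_of_rate _ (C / g ^+ 2) n0) => n nn; rewrite /Pr (Ex_adapted (tl n)) //;
  try (by have [] := ad n); have [H1 H2] := HC n _ (tn n) (bn _ nn);
  apply: le_trans (chebyshev_Ex _ _ _ g0) _;
  by rewrite mulrAC ler_wpM2r // invr_ge0 sqr_ge0.
Qed.

End AtTime.

Lemma Phi_ge n (s : 'S_n) (th : R) : 0 <= th -> kappa s / n%:R - th <= Phi th s <= kappa s / n%:R.
Proof.
move=> th0; have cp v : 0 < (csize s v)%:R :> R by rewrite ltr0n csize_gt0.
have E : kappa s / n%:R - Phi th s =
    n%:R^-1 * \sum_v ((1 - expR (- (th * (csize s v)%:R))) / (csize s v)%:R).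
  rewrite /kappa /Phi mulrC -mulrBr -sumrB; congr (_ * _).
  by apply: eq_bigr => v _; rewrite mulrBl mul1r.
have H v := expR_decr (mulr_ge0 th0 (ltW (cp v))).
have L : 0 <= kappa s / n%:R - Phi th s.
  rewrite E; apply: avg_ge0 => v; rewrite divr_ge0 ?(ltW (cp v)) //.
  by have [/andP[]] := H v.
have U : kappa s / n%:R - Phi th s <= th.
  rewrite E; apply: avg_le => // v; rewrite ler_pdivrMr //.
  by have [/andP[]] := H v.
by apply/andP; split; lra.
Qed.

Lemma thp_ge n h u t (p : path n) : 0 <= h -> uu t p <= u -> - ln (1 - h) - 2 * h * u <= thp h t p :> R.
Proof. by move=> h0 ut; rewrite /thp lerD2l lerN2 ler_wpM2l // mulr_ge0. Qed.

Lemma thp_le n h u t (p : path n) : 0 <= h -> u <= uu t p -> thp h t p <= - ln (1 - h) - 2 * h * u :> R.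
Proof. by move=> h0 ut; rewrite /thp lerD2l lerN2 ler_wpM2l // mulr_ge0. Qed.

Lemma theta_gt0 u h : cdp_zeta u < h -> h < 1 -> 0 < - ln (1 - h) - 2 * h * u :> R.
Proof.
move=> zh h1; have := zeta_lt_sign zh h1.
move=> H; have : ln (1 - h) < - (2 * u * h).
  by rewrite -[X in _ < X]expRK ltr_ln ?posrE ?expR_gt0 ?subr_gt0.
by rewrite -[2 * h * u]mulrA [h * u]mulrC mulrA; lra.
Qed.

(** The number of cycles at time t is n - t, and Phi at 0 counts them. If uu
    were below u, then the conserved quantity errPhi, taken along a
    characteristic just above zeta u, would give t / n <= psi u + o(1). *)
Lemma uu_lower (s e : R) : 0 <= s -> s < 1 -> 0 < e ->
  negl (fun n p => uu (tm s n) p < cdp_phi_inv s - e).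
Proof.
move=> s0 s1 e0; have [x0 xE] := phi_inv_spec s0 s1.
set u := cdp_phi_inv s - e.
have [u0|u0] := ltP u 0.
  move=> e' e'0; exists 0%N => n _; rewrite /Pr -[leRHS](Ex_cst (n := n) n).
  apply: Ex_le => p _; rewrite ltNge (le_trans (ltW u0) (uu_ge0 _ _)) /= ltW //.
have us : psi u < s by rewrite -xE; apply: psi_lt; rewrite /u ltrBlDr ltrDl.
have z0 := zeta_ge0 u; have z1 := zeta_lt1 u.
pose d := Num.min ((s - psi u) / 2) ((1 - cdp_zeta u) / 2).
have d0 : 0 < d by rewrite lt_min !divr_gt0 ?subr_gt0.
have d1 : d <= (s - psi u) / 2 by rewrite ge_min lexx.
have d2 : d <= (1 - cdp_zeta u) / 2 by rewrite ge_min lexx orbT.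
pose h := cdp_zeta u + d.
have h0 : 0 < h by rewrite /h; lra.
have h1 : h < 1 by rewrite /h; lra.
have zh : cdp_zeta u < h by rewrite /h; lra.
pose m := - ln (1 - h) - 2 * h * u.
have m0 : 0 < m by exact: theta_gt0.
pose g := (s - psi u) / 8.
have g0 : 0 < g by rewrite divr_gt0 // subr_gt0.
have [_ H] := err_negl s1 h0 h1 m0 g0 s0 (lexx s).
have [n0 Hn0] := large_nat (g^-1).
apply: (negl_sub (n0 := maxn 1 n0)) H => n p; rewrite geq_max => /andP[n1 nn] pv uu_u.
have th := thp_ge (ltW h0) (ltW uu_u).
have al : alive h m (tm s n) p by exact: th.
rewrite al /= ltNge; apply/negP.
rewrite ler_norml => /andP[+ _].
have N0 : 0 < n%:R :> R by rewrite ltr0n.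
have tn : (tm s n < n)%N.
  by rewrite -(ltr_nat R); apply: le_lt_trans (tm_le n s0) _; rewrite gtr_pMl.
have pv' : valid (tm s n) p by apply: valid_le pv; exact: ltnW.
have /andP[_ P1] := Phi_ge (p (tm s n)) (le_trans (ltW m0) th).
rewrite (valid_kappa (R := R) tn pv') mulrBl divff ?gt_eqF // in P1.
have t1 : s - g <= (tm s n)%:R / n%:R.
  rewrite ler_pdivlMr // mulrBl; have := tm_gt s n.
  suff : 1 <= g * n%:R by lra.
  by rewrite mulrC -ler_pdivrMr // div1r Hn0.
have h2 : (1 - h) ^+ 2 <= (1 - cdp_zeta u) ^+ 2.
  by rewrite lerXn2r ?nnegrE ?subr_ge0 ?(ltW h1) ?(ltW z1) // lerD2l lerN2 ltW.
have h3 : (1 - h) ^+ 2 * uu (tm s n) p <= (1 - cdp_zeta u) ^+ 2 * u.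
  by rewrite ler_pM ?sqr_ge0 ?uu_ge0 // ltW.
move: P1 t1 h3 d1; rewrite /errPhi /g /h /psi [u * _]mulrC.
set A := Phi _ _; set B := _ ^+ 2 * uu _ _; set C := _ ^+ 2 * u; set t := _ / n%:R.
by lra.
Qed.

(** For h just above zeta u the characteristic is close to 0 when the clock
    shows u, but it has not reached 0 yet by theta_gt0. *)
Lemma choose_h (u g : R) : 0 < g -> exists h : R,
  [/\ 0 < h, h < 1, cdp_zeta u < h < cdp_zeta u + g,
   - ln (1 - h) - 2 * h * u < g & psi u - g <= h + (1 - h) ^+ 2 * u].
Proof.
move=> g0; have z0 := zeta_ge0 u; have z1 := zeta_lt1 u; set z := cdp_zeta u in z0 z1 *.
have c1 : (fun h => 1 - h) @ z --> 1 - z by apply: cvgB; [exact: cvg_cst|exact: cvg_id].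
have c2 : (fun h => - ln (1 - h) - 2 * h * u) @ z^'+ --> - ln (1 - z) - 2 * z * u.
  apply: cvg_at_right_filter; apply: cvgB.
    apply: cvgN; apply: (@cvg_comp _ _ _ (fun h => 1 - h) (@ln R) _ _ _ c1).
    by apply: continuous_ln; rewrite subr_gt0.
  by apply: cvgM; [apply: cvgM; [exact: cvg_cst|exact: cvg_id]|exact: cvg_cst].
have c3 : (fun h => h + (1 - h) ^+ 2 * u) @ z^'+ --> z + (1 - z) ^+ 2 * u.
  apply: cvg_at_right_filter; apply: cvgD; first exact: cvg_id.
  by apply: cvgM; [apply: cvgM; exact: c1|exact: cvg_cst].
have e1 : - ln (1 - z) - 2 * z * u < g.
  by rewrite ln_zeta -/z opprK [2 * z * u]mulrAC subrr.
have e2 : psi u - g < z + (1 - z) ^+ 2 * u by rewrite /psi -/z [u * _]mulrC gtrBl.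
have n1 := @cvgr_lt _ _ _ _ _ _ c2 _ e1; have n2 := @cvgr_gt _ _ _ _ _ _ c3 _ e2.
have {}n1 := n1 (@at_right_proper_filter R z); have {}n2 := n2 (@at_right_proper_filter R z).
have n3 : \forall h \near z^'+, z < h by exact: nbhs_right_gt.
have n4 : \forall h \near z^'+, h < 1 by exact: nbhs_right_lt.
have n5 : \forall h \near z^'+, h < z + g by apply: nbhs_right_lt; rewrite ltrDl.
have [h [H1 H2 H3 H4 H5]] : exists h, [/\ - ln (1 - h) - 2 * h * u < g,
    psi u - g < h + (1 - h) ^+ 2 * u, z < h, h < 1 & h < z + g].
  near (z^'+) => h; exists h; split; near: h => //.
exists h; split => //; [exact: le_lt_trans H3|by rewrite H3|exact: ltW].
Unshelve. all: by end_near. Qed.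

(** If uu had passed a point u > phi^-1 s by the time s n, it would have been close to u
    at one of finitely many earlier times. There the characteristic just
    above zeta u is still alive and nearly at 0, and errPhi would give a time
    t with t / n close to psi u > s. *)
Lemma uu_upper (s e : R) : 0 < s -> s < 1 -> 0 < e ->
  negl (fun n p => cdp_phi_inv s + e < uu (tm s n) p).
Proof.
move=> s0 s1 e0; have [x0 xE] := phi_inv_spec (ltW s0) s1.
set u := cdp_phi_inv s + e.
have u0 : 0 < u by rewrite /u; lra.
have us : s < psi u by rewrite -xE; apply: psi_lt; rewrite /u ltrDl.
have z0 := zeta_ge0 u; have z1 := zeta_lt1 u.
pose g := (psi u - s) / 4.
have g0 : 0 < g by rewrite divr_gt0 // subr_gt0.
have [h [h0 h1 /andP[zh _] hg1 hg2]] := choose_h u g0.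
pose th0 := - ln (1 - h) - 2 * h * u.
have th00 : 0 < th0 by exact: theta_gt0.
pose m := th0 / 2; have m0 : 0 < m by rewrite divr_gt0.
pose e2 := th0 / (4 * h); have e20 : 0 < e2 by rewrite divr_gt0 // mulr_gt0.
pose C1 := 2 / (1 - s); have C10 : 0 < C1 by rewrite divr_gt0 // subr_gt0.
have [M0 HM0] := large_nat (2 * C1 / e2).
pose M := M0.+1.
have MM : C1 / M%:R <= e2 / 2.
  have e22 : 0 < e2 / 2 by rewrite (divr_gt0 e20).
  rewrite ler_pdivrMr ?ltr0n // mulrC -ler_pdivrMr //.
  have := HM0 _ (leqnSn _); rewrite -/M.
  by have -> : C1 / (e2 / 2) = 2 * C1 / e2 by field; rewrite gt_eqF.
(* between consecutive times of this grid the clock moves by at most e2 *)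
pose r i : R := s * (i%:R / M%:R).
have r0 i : 0 <= r i by rewrite mulr_ge0 ?divr_ge0 // ltW.
have rs i : (i <= M)%N -> r i <= s.
  by move=> iM; rewrite ler_piMr ?(ltW s0) // ler_pdivrMr ?ltr0n // mul1r ler_nat.
have [n1 Hn1] := large_nat (2 * C1 / e2).
have [n2 Hn2] := large_nat (2 / (1 - s)).
apply: (@negl_sub _ (fun n p => [exists i : 'I_M.+1,
   alive h m (tm (r i) n) p && (g < `|errPhi h (tm (r i) n) p|)]) (maxn 1 (maxn n1 n2))); last first.
  apply: (@negl_exists _ (fun i n p => alive h m (tm (r i) n) p && (g < `|errPhi h (tm (r i) n) p|))) => i iM.
  by have [] := err_negl s1 h0 h1 m0 g0 (r0 i) (rs _ iM).
move=> n p; rewrite !geq_max => /and3P[n0 nn1 nn2] pv up.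
have N0 : 0 < n%:R :> R by rewrite ltr0n.
have bn : 2 <= (1 - s) * n%:R by rewrite mulrC -ler_pdivrMr ?subr_gt0 // Hn2.
have tlt i : (i <= M)%N -> (tm (r i) n)%:R <= (1 - (1 - s)) * n%:R.
  by move=> iM; rewrite opprB addrC subrK; apply: le_trans (tm_le n (r0 i)) _; rewrite ler_pM2r // rs.
have rM : r M = s by rewrite /r divff ?mulr1 // pnatr_eq0.
pose P i := u < uu (tm (r i) n) p.
have exP : exists i, P i && (i <= M)%N by exists M; rewrite /P rM up leqnn.
(* i indexes the first grid time at which the clock has passed u *)
case: (ex_minnP exP) => i /andP[Pi iM] mini.
have i0 : (0 < i)%N.
  rewrite lt0n; apply/eqP => i0; move: Pi; rewrite /P i0 /r mul0r mulr0 /tm mul0r truncn0.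
  by rewrite /uu big_ord0 ltNge ltW.
have Pi1 : uu (tm (r i.-1) n) p <= u.
  rewrite leNgt; apply/negP => H; have := mini i.-1; rewrite /P H (leq_trans (leq_pred _) iM) => /(_ isT).
  by rewrite leqNgt prednK // leqnn.
have rr : r i.-1 <= r i by rewrite ler_wpM2l ?(ltW s0) // ler_wpM2r ?invr_ge0 // ler_nat leq_pred.
have step_u : uu (tm (r i) n) p <= uu (tm (r i.-1) n) p + ((tm (r i) n)%:R - (tm (r i.-1) n)%:R) * (C1 / n%:R).
  have tt : (tm (r i.-1) n <= tm (r i) n)%N by exact: tm_mono.
  rewrite -natrB //; suff H k : (k + tm (r i.-1) n <= tm (r i) n)%N ->
      uu (k + tm (r i.-1) n) p <= uu (tm (r i.-1) n) p + k%:R * (C1 / n%:R).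
    by have := H (tm (r i) n - tm (r i.-1) n)%N; rewrite subnK // => /(_ (leqnn _)).
  elim: k => [|k IH]; first by rewrite add0n mul0r addr0.
  rewrite addSn => kt; rewrite uuS -[k.+1]addn1 natrD mulrDl mul1r addrA lerD ?IH ?(ltnW kt) //.
  have pv' : valid (k + tm (r i.-1) n) p.
    apply: valid_le pv; apply: leq_trans (ltnW kt) _; apply: tm_len.
    by apply: le_trans (rs _ iM) (ltW s1).
  have b0 : 0 < 1 - s by rewrite subr_gt0.
  have := D_lower b0 (tlt _ iM) bn (ltnW kt) pv'; rewrite -/C1 => DL.
  have -> : C1 / n%:R = n%:R / (n%:R ^+ 2 / C1) by field; rewrite !gt_eqF.
  have DL0 : 0 < n%:R ^+ 2 / C1 by rewrite divr_gt0 ?exprn_gt0.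
  by rewrite ler_pM2l // lef_pV2 // posrE (lt_le_trans DL0 DL).
have ue : uu (tm (r i) n) p <= u + e2.
  apply: le_trans step_u (lerD Pi1 _).
  have -> : e2 = (e2 / 2 / C1 * n%:R + e2 / 2 / C1 * n%:R) * (C1 / n%:R) by field; rewrite !gt_eqF.
  have eC : 0 < e2 / 2 / C1 by exact: divr_gt0 (divr_gt0 e20 (ltr0n _ 2)) C10.
  have CN : 0 < C1 / n%:R by exact: divr_gt0.
  rewrite ler_pM2r //.
  have q1 : 1 <= e2 / 2 / C1 * n%:R.
    rewrite -ler_pdivrMl // mulr1.
    by have -> : (e2 / 2 / C1)^-1 = 2 * C1 / e2; [field; rewrite !gt_eqF|exact: Hn1].
  have q2 : r i - r i.-1 <= e2 / 2 / C1.
    rewrite /r -mulrBr -mulrBl -[X in (X%:R - _)](prednK i0) -[i.-1.+1]addn1 natrD addrC addKr.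
    apply: le_trans (_ : 1 * (1 / M%:R) <= _).
      by rewrite ler_wpM2r ?divr_ge0 // ltW.
    by rewrite mul1r ler_pdivlMr // mulrC mulrA mulr1.
  have q3 : (r i - r i.-1) * n%:R <= e2 / 2 / C1 * n%:R by rewrite ler_pM2r.
  have q4 := tm_le n (r0 i); have q5 := tm_gt (r i.-1) n.
  move: q1 q3 q4 q5; set A := e2 / 2 / C1 * n%:R; rewrite mulrBl.
  by lra.
apply/existsP; exists (Ordinal (iM : (i < M.+1)%N)) => /=.
have th := thp_ge (ltW h0) ue.
have th2 := thp_le (ltW h0) (ltW Pi).
have al : alive h m (tm (r i) n) p.
  apply: le_trans th; rewrite [2 * h * (u + e2)]mulrDr.
  have -> : 2 * h * e2 = th0 / 2 by rewrite /e2; field; rewrite gt_eqF.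
  by rewrite opprD addrA -/th0 /m; lra.
rewrite al /= ltNge; apply/negP; rewrite ler_norml => /andP[_].
have tn : (tm (r i) n < n)%N.
  rewrite -(ltr_nat R); apply: le_lt_trans (tlt _ iM) _.
  by rewrite opprB addrC subrK gtr_pMl.
have pv' : valid (tm (r i) n) p by apply: valid_le pv; exact: ltnW.
have /andP[P1 _] := Phi_ge (p (tm (r i) n)) (le_trans (ltW m0) al).
rewrite (valid_kappa (R := R) tn pv') mulrBl divff ?gt_eqF // in P1.
have t1 : (tm (r i) n)%:R / n%:R <= s.
  by rewrite ler_pdivrMr //; have := tlt _ iM; rewrite opprB addrC subrK.
have h3 : (1 - h) ^+ 2 * u <= (1 - h) ^+ 2 * uu (tm (r i) n) p.
  by rewrite ler_wpM2l ?sqr_ge0 // ltW.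
move: P1 t1 h3 th2 hg1 hg2; rewrite /errPhi /g /u.
set A := Phi _ _; set B := _ ^+ 2 * uu _ _; set C := _ ^+ 2 * _; set t := _ / n%:R.
set T := thp _ _ _; set T' := - ln _ - _.
by lra.
Qed.

End Negligible.

(** * Vertices in large cycles *)
Section LargeCycles.
Context {R : realType}.
Local Notation path n := (nat -> 'S_n).
Local Notation negl := (@negl R).

Definition NK n K (s : 'S_n) : R := n%:R^-1 * \sum_v (K <= csize s v)%N%:R.

Lemma avg1 n : (0 < n)%N -> n%:R^-1 * \sum_(v < n) 1 = 1 :> R.
Proof. by move=> n0; rewrite sumr_const card_ord mulVf // pnatr_eq0 -lt0n. Qed.

Lemma avg_mono n (f g : 'I_n -> R) : (forall v, f v <= g v) ->
  n%:R^-1 * \sum_v f v <= n%:R^-1 * \sum_v g v.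
Proof. by move=> H; rewrite ler_wpM2l ?invr_ge0 // ler_sum. Qed.

Lemma NK_ge0 n K (s : 'S_n) : 0 <= NK K s.
Proof. by apply: avg_ge0 => v; rewrite ler0n. Qed.

Lemma NK_le1 n K (s : 'S_n) : NK K s <= 1.
Proof. by apply: avg_le => // v; rewrite lern1 leq_b1. Qed.

(** In 1 - F th a vertex counts almost fully if its cycle is much larger than
    1 / th, and almost not at all if its cycle is much smaller. *)
Lemma oneF_NK n K (s : 'S_n) (th : R) : (0 < n)%N -> 0 <= th ->
  1 - F th s <= NK K s + th * K%:R.
Proof.
move=> n0 th0; have -> : NK K s + th * K%:R =
    n%:R^-1 * \sum_v ((K <= csize s v)%N%:R + th * K%:R).
  by rewrite big_split /= mulrDr -[th * K%:R in RHS]mulr1 -mulr_sumr mulrCA avg1 // mulr1.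
have -> : 1 - F th s = n%:R^-1 * \sum_v (1 - expR (- (th * (csize s v)%:R))).
  by rewrite sumrB mulrBr avg1.
apply: avg_mono => v.
have [/andP[_ H] _] := expR_decr (mulr_ge0 th0 (ler0n _ (csize s v))).
have := expR_ge0 (- (th * (csize s v)%:R)).
case: leqP => cK e0; first by have := mulr_ge0 th0 (ler0n R K); rewrite mulr1n; lra.
rewrite add0r; apply: le_trans H _; rewrite ler_wpM2l // ler_nat; exact: ltnW.
Qed.

Lemma NK_oneF n K (s : 'S_n) (th : R) : (0 < n)%N -> 0 <= th ->
  NK K s <= 1 - F th s + expR (- (th * K%:R)).
Proof.
move=> n0 th0; set E := expR (- (th * K%:R)).
have -> : 1 - F th s + E = n%:R^-1 * \sum_v (1 - expR (- (th * (csize s v)%:R)) + E * 1).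
  by rewrite big_split sumrB /= -mulr_sumr mulrDr mulrBr avg1 // [n%:R^-1 * (E * _)]mulrCA avg1 // mulr1.
apply: avg_mono => v; rewrite mulr1 /E.
case: leqP => cK /=; last first.
  have := expR_ge0 (- (th * K%:R)).
  have [/andP[H _] _] := expR_decr (mulr_ge0 th0 (ler0n _ (csize s v))); lra.
suff : expR (- (th * (csize s v)%:R)) <= expR (- (th * K%:R)) by lra.
by rewrite ler_expR lerN2 ler_wpM2l // ler_nat.
Qed.

Lemma uu_close (s e : R) : 0 < s -> s < 1 -> 0 < e ->
  negl (fun n p => e < `|uu (tm s n) p - cdp_phi_inv s|).
Proof.
move=> s0 s1 e0.
apply: (negl_sub (n0 := 0%N)) (negl_or (uu_lower (ltW s0) s1 e0) (uu_upper s0 s1 e0)).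
move=> n p _ _; rewrite ltNge ler_norml negb_and -!ltNge => /orP[h|h]; apply/orP; [left|right]; lra.
Qed.

Definition theta (s h : R) : R := - ln (1 - h) - 2 * h * cdp_phi_inv s.

(** At time s n the clock is close to phi^-1 s, hence the characteristic is close
    to theta s h and still alive. *)
Lemma F_close (s h g : R) : 0 < s -> s < 1 -> 0 < h -> h < 1 ->
  cdp_zeta (cdp_phi_inv s) < h -> 0 < g ->
  negl (fun n p => ~~ [&& theta s h / 2 <= thp h (tm s n) p,
     thp h (tm s n) p <= 3 / 2 * theta s h &
     `|F (thp h (tm s n) p) (p (tm s n)) - (1 - h)| <= g]).
Proof.
move=> s0 s1 h0 h1 zh g0; have th0 : 0 < theta s h by exact: theta_gt0.
have m0 : 0 < theta s h / 2 by rewrite divr_gt0.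
have [H _] := err_negl s1 h0 h1 m0 g0 (ltW s0) (lexx s).
pose e := theta s h / (4 * h); have e0 : 0 < e by rewrite divr_gt0 // mulr_gt0.
have he : 2 * h * e = theta s h / 2 by rewrite /e; field; rewrite gt_eqF.
apply: (negl_sub (n0 := 0%N)) (negl_or H (uu_close s0 s1 e0)) => n p _ _.
rewrite !negb_and => H1.
have [uc|_] := leP `|uu (tm s n) p - cdp_phi_inv s| e; last by rewrite orbT.
move: uc; rewrite orbF ler_norml => /andP[u1 u2].
have u1' : cdp_phi_inv s - e <= uu (tm s n) p by lra.
have u2' : uu (tm s n) p <= cdp_phi_inv s + e by lra.
have T1 := thp_ge (ltW h0) u2'; have T2 := thp_le (ltW h0) u1'.
have A1 : theta s h / 2 <= thp h (tm s n) p.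
  by apply: le_trans T1; rewrite mulrDr he opprD addrA -/(theta s h); lra.
have A2 : thp h (tm s n) p <= 3 / 2 * theta s h.
  by apply: le_trans T2 _; rewrite mulrBr he opprB addrCA -/(theta s h); lra.
move: H1; rewrite A1 A2 /= -ltNge => H1.
by rewrite /alive A1 /errF.
Qed.

(** By choose_h, theta s h can be made small compared with 1 / K. *)
Lemma NK_lower (s e : R) K : 0 < s -> s < 1 -> 0 < e ->
  negl (fun n p => NK K (p (tm s n)) < cdp_eta s - e).
Proof.
move=> s0 s1 e0; pose g := e / (3 * K.+1%:R).
have g0 : 0 < g by rewrite divr_gt0 // mulr_gt0 // ltr0n.
have [h [h0 h1 /andP[zh _] hg _]] := choose_h (cdp_phi_inv s) g0.
have e2 : 0 < e / 2 by rewrite divr_gt0.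
apply: (negl_sub (n0 := 1%N)) (F_close s0 s1 h0 h1 zh e2) => n p n0 _ Nlt.
apply/negP => /and3P[T1 T2 FE].
have th0 : 0 < theta s h by exact: theta_gt0.
have t0 : 0 <= thp h (tm s n) p by apply: le_trans T1; rewrite divr_ge0 // ltW.
have := oneF_NK K (p (tm s n)) n0 t0.
have tK : thp h (tm s n) p * K%:R <= e / 2.
  apply: le_trans (_ : 3 / 2 * g * K.+1%:R <= _).
    apply: ler_pM => //; last by rewrite ler_nat.
    by apply: le_trans T2 _; rewrite ler_pM2l // ltW.
  have K1 : K.+1%:R != 0 :> R by rewrite pnatr_eq0.
  rewrite /g; move: (K.+1%:R) K1 => x x0.
  by rewrite le_eqVlt; apply/orP; left; apply/eqP; field.
move: FE Nlt; rewrite eta_zeta // ler_norml => /andP[F1 F2] Nlt.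
by lra.
Qed.

(** For a fixed h the number theta s h is positive, and K is taken large compared
    with its inverse. *)
Lemma NK_upper (s e : R) : 0 < s -> s < 1 -> 0 < e -> exists K0, forall K, (K0 <= K)%N ->
  negl (fun n p => cdp_eta s + e < NK K (p (tm s n))).
Proof.
move=> s0 s1 e0; have e4 : 0 < e / 4 by rewrite divr_gt0.
have [h [h0 h1 /andP[zh zh2] _ _]] := choose_h (cdp_phi_inv s) e4.
have th0 : 0 < theta s h by exact: theta_gt0.
have [K0 HK0] := large_nat (8 / (e * theta s h)).
exists K0.+1 => K K0K.
apply: (negl_sub (n0 := 1%N)) (F_close s0 s1 h0 h1 zh e4) => n p n0 _ Nlt.
apply/negP => /and3P[T1 T2 FE].
have t0 : 0 < thp h (tm s n) p by apply: lt_le_trans T1; rewrite divr_gt0.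
have := NK_oneF K (p (tm s n)) n0 (ltW t0).
have K0' : 0 < K%:R :> R by rewrite ltr0n (leq_trans _ K0K).
have tK : expR (- (thp h (tm s n) p * K%:R)) <= e / 4.
  have tK0 : 0 < thp h (tm s n) p * K%:R by rewrite mulr_gt0.
  have := mul_expRN_le (ltr01 : 0 < 1 :> R) (ltW tK0).
  rewrite mul1r invr1 mulrC -ler_pdivlMr // div1r => H; apply: le_trans H _.
  rewrite -[leRHS]invrK lef_pV2 ?posrE ?invr_gt0 // invf_div.
  apply: le_trans (_ : theta s h / 2 * K%:R <= _); last by rewrite ler_pM2r.
  rewrite -ler_pdivrMl ?divr_gt0 //; apply: le_trans (HK0 _ (ltnW K0K)).
  by rewrite le_eqVlt; apply/orP; left; apply/eqP; field; rewrite !gt_eqF.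
move: FE Nlt zh2; rewrite eta_zeta // ler_norml => /andP[F1 F2] Nlt.
by lra.
Qed.

(** On the critical line the characteristic of a small h has theta of order
    h ^ 2, whereas 1 - F is close to h; cycles of size less than K would give
    1 - F <= K theta. So after time n / 2 a largest cycle is a large one. *)
Lemma critical_cycles K :
  negl (fun n (p : path n) => [forall v, csize (p (tm (2^-1 : R) n)) v < K]%N).
Proof.
pose h : R := (8 * K.+1%:R)^-1.
have K0 : 0 < K.+1%:R :> R by rewrite ltr0n.
have h0 : 0 < h by rewrite invr_gt0 mulr_gt0.
have K1 : 1 <= K.+1%:R :> R by rewrite ler1n.
have h5 : h <= 8^-1 by rewrite lef_pV2 ?posrE ?mulr_gt0 //; lra.
have h1 : h < 1 by lra.
have hK : h * K%:R <= 8^-1.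
  rewrite /h mulrC ler_pdivrMr ?mulr_gt0 // mulrA mulVf ?mul1r ?ler_nat //.
have s0 : 0 < 2^-1 :> R by rewrite invr_gt0.
have s1 : 2^-1 < 1 :> R by lra.
have pE : cdp_phi_inv (2^-1 : R) = 2^-1 by rewrite phi_inv_small // ltW.
have zh : cdp_zeta (cdp_phi_inv 2^-1) < h by rewrite pE zeta_small.
have g0 : 0 < h / 4 by rewrite divr_gt0.
apply: (negl_sub (n0 := 1%N)) (F_close s0 s1 h0 h1 zh g0) => n p n0 _ /forallP small.
apply/negP => /and3P[T1 T2 FE].
have th0 : 0 < theta 2^-1 h by exact: theta_gt0.
have t0 : 0 <= thp h (tm (2^-1 : R) n) p by apply: le_trans T1; rewrite divr_ge0 // ltW.
have := oneF_NK K (p (tm (2^-1 : R) n)) n0 t0.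
have -> : NK K (p (tm (2^-1 : R) n)) = 0.
  by rewrite /NK big1 ?mulr0 // => v _; rewrite leqNgt small.
have thle : theta 2^-1 h <= 2 * h ^+ 2.
  rewrite /theta pE [2 * h]mulrC mulfK ?pnatr_eq0 //.
  suff : expR (- (h + 2 * h ^+ 2)) <= 1 - h.
    move=> H; have : - (h + 2 * h ^+ 2) <= ln (1 - h).
      by rewrite -ler_expR lnK ?posrE ?subr_gt0.
    by lra.
  have y0 : 0 <= h + 2 * h ^+ 2 by rewrite addr_ge0 ?mulr_ge0 ?sqr_ge0 // ltW.
  have [_] := expR_decr y0; rewrite ler_norml => /andP[+ _].
  set E := expR _ => HE.
  have : h ^+ 2 * (1 + 2 * h) ^+ 2 <= h ^+ 2 * 2.
    rewrite ler_wpM2l ?sqr_ge0 //; nra.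
  have -> : h ^+ 2 * (1 + 2 * h) ^+ 2 = (h + 2 * h ^+ 2) ^+ 2 by ring.
  by lra.
have tK : thp h (tm (2^-1 : R) n) p * K%:R <= 3 * h / 8.
  apply: le_trans (_ : 3 * h ^+ 2 * K%:R <= _).
    by rewrite ler_wpM2r //; apply: le_trans T2 _; lra.
  by rewrite expr2 mulrA -[_ * h * _]mulrA ler_wpM2l // mulr_ge0 // ltW.
by move: FE; rewrite ler_norml => /andP[F1 F2]; lra.
Qed.

End LargeCycles.

(** * The giant cycle *)
Section Giant.
Context {R : realType}.
Local Notation path n := (nat -> 'S_n).
Local Notation negl := (@negl R).

Section Potential.
Variables (n K : nat).
Hypothesis K0 : (0 < K)%N.
Local Notation big a := ((K <= a)%N%:R : R).

Definition WK (s : 'S_n) : R :=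
  (n%:R ^+ 2)^-1 * \sum_(ab in diffp s) big (csize s ab.1) * big (csize s ab.2).

(** The sum of c / K - 1 over the cycles of size c >= K. *)
Definition RK (s : 'S_n) : R :=
  \sum_v (if (K <= csize s v)%N then K%:R^-1 - (csize s v)%:R^-1 else 0).

Let r (c : nat) : R := if (K <= c)%N then K%:R^-1 - c%:R^-1 else 0.

Let rE (c : nat) : c%:R * r c = if (K <= c)%N then c%:R / K%:R - 1 else 0.
Proof.
rewrite /r; case: ifP => Kc; last by rewrite mulr0.
by rewrite mulrBr divff // pnatr_eq0 -lt0n (leq_trans K0).
Qed.

(** For two big cycles the two terms - 1 become one, which is the gain. *)
Let r_super a b : big a * big b <= (a + b)%:R * r (a + b) - a%:R * r a - b%:R * r b.
Proof.
have Kp : 0 < K%:R :> R by rewrite ltr0n.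
have q (c : nat) : 0 <= c%:R / K%:R :> R by rewrite divr_ge0.
rewrite !rE; have := q a; have := q b; move: (q (a + b)%N); rewrite natrD mulrDl.
case: leqP => ha; case: leqP => hb.
- by rewrite (leq_trans ha (leq_addr _ _)) !mulr1n mulr1; lra.
- by rewrite (leq_trans ha (leq_addr _ _)) mulr0n mulr0; lra.
- by rewrite (leq_trans hb (leq_addl _ _)) mulr0n mul0r; lra.
rewrite mulr0n mulr0; case: leqP => hab; last lra.
have : 1 <= (a + b)%:R / K%:R :> R by rewrite ler_pdivlMr // mul1r ler_nat.
by rewrite natrD mulrDl; lra.
Qed.

Lemma RK_le (s : 'S_n) : RK s <= n%:R / K%:R.
Proof.
have -> : n%:R / K%:R = \sum_(v < n) K%:R^-1 :> R by rewrite sumr_const card_ord -[RHS]mulr_natl.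
apply: ler_sum => v _; case: ifP => _; last by rewrite invr_ge0.
by rewrite gerBl invr_ge0.
Qed.

Lemma RK_ge0 (s : 'S_n) : 0 <= RK s.
Proof.
apply: sumr_ge0 => v _; case: ifP => // Kc.
by rewrite subr_ge0 lef_pV2 ?posrE ?ltr0n ?csize_gt0 // ler_nat.
Qed.

Lemma D_le (s : 'S_n) : D s <= n%:R ^+ 2 :> R.
Proof. by rewrite D_E gerBl sumr_ge0. Qed.

Lemma step_RK (s : 'S_n) : RK s + WK s <= step s RK.
Proof.
rewrite /step; case: ifPn => d0.
  by rewrite /WK (eqP d0) big_set0 mulr0 addr0.
have D0 : 0 < D s :> R by rewrite -D_gt0.
apply: le_trans (_ : (D s)^-1 * \sum_(ab in diffp s) (RK s + big (csize s ab.1) * big (csize s ab.2)) <= _).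
  rewrite big_split /= sumr_const -[RK s *+ _]mulr_natl -[#|_|%:R]/(D s) mulrDr mulKf ?gt_eqF //.
  have S0 : 0 <= \sum_(ab in diffp s) big (csize s ab.1) * big (csize s ab.2).
    by apply: sumr_ge0 => ab _; rewrite mulr_ge0.
  rewrite lerD2l /WK ler_wpM2r //.
  by rewrite lef_pV2 ?posrE ?D_le // (lt_le_trans D0 (D_le s)).
rewrite -/(D s) ler_wpM2l ?invr_ge0 ?(ltW D0) //; apply: ler_sum => -[a b] ab /=.
rewrite /RK (sum_fuse r) -?mem_diffp // -!addrA lerD2l !addrA.
exact: r_super.
Qed.

Lemma sum_WK t : \sum_(k < t) Ex k (fun p : path n => WK (p k)) <= Ex t (fun p => RK (p t)).
Proof.
elim: t => [|t IH]; first by rewrite big_ord0; apply: Ex_ge0 => p _; exact: RK_ge0.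
rewrite big_ord_recr /=; apply: le_trans (lerD IH (lexx _)) _.
rewrite -ExD; apply: Ex_le => p _; apply: le_trans (step_RK _) _.
by rewrite (_ : (fun s => RK (app t p s t.+1)) = RK) //; apply/funext => s; rewrite appS.
Qed.

Lemma WK_E (s : 'S_n) : WK s = NK K s ^+ 2 - (n%:R ^+ 2)^-1 * \sum_v big (csize s v) * (csize s v)%:R.
Proof.
rewrite /WK (sum_diffp s (fun c => big c) (fun c => big c)) mulrBr /NK exprMn exprVn; congr (_ - _ * _).
by apply: eq_bigr => v _; rewrite -[LHS]mulr_natr; case: leqP; rewrite ?mulr1 ?mul0r.
Qed.

Lemma WK_ge0 (s : 'S_n) : 0 <= WK s.
Proof. by rewrite mulr_ge0 ?invr_ge0 ?sqr_ge0 // sumr_ge0 // => ab _; rewrite mulr_ge0. Qed.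

End Potential.

Lemma markov_Ex n t (Z : path n -> R) (w : R) : 0 < w ->
  (forall p, valid t p -> 0 <= Z p) -> Pr t (fun p => w < Z p) <= Ex t Z / w.
Proof.
move=> w0 Z0; rewrite mulrC -ExZ; apply: Ex_le => p pv.
case: ltP => h; last by rewrite mulr_ge0 ?invr_ge0 ?Z0 // ltW.
by rewrite ler_pdivlMl // mulr1 ltW.
Qed.

(** A merger of two cycles of size at least K raises the potential RK by at
    least one, and RK never exceeds n / K. So two big cycles rarely coexist
    for long: the fraction WK of pairs of vertices in distinct big cycles is
    small at some time of any macroscopic time window. *)
Lemma giant_exists (s e : R) : 0 < s -> s < 1 -> 0 < e ->
  negl (fun n (p : path n) =>
    [forall v, (csize (p (tm s n)) v)%:R < (cdp_eta s - e) * n%:R]).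
Proof.
move=> s0 s1 e0.
have [es|es] := leP (cdp_eta s) e.
  move=> e' e'0; exists 1%N => n n0; rewrite /Pr -[leRHS](Ex_cst (n := n) n).
  apply: Ex_le => p _; case: forallP => [/(_ (Ordinal n0))|_]; last exact: ltW.
  by rewrite ltNge (le_trans (_ : _ <= 0)) // mulr_le0_ge0 // subr_le0.
have e4 : 0 < e / 4 by rewrite divr_gt0.
have [d d0 Hd] := eta_continuous (ltW s0) (ltW s1) e4.
pose s' := Num.max (s / 2) (s - d / 2).
have ss' : s' < s by rewrite gt_max; apply/andP; split; lra.
have s'0 : 0 < s' by rewrite lt_max; apply/orP; left; lra.
have s'd : `|s' - s| < d.
  rewrite ltr_norml; apply/andP; split; last by lra.
  have : s - d / 2 <= s' by rewrite le_max lexx orbT.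
  by lra.
have s'1 : s' < 1 by lra.
have es' : cdp_eta s - e / 4 < cdp_eta s'.
  by have := Hd _ (ltW s'0) (ltW s'1) s'd; rewrite ltr_norml => /andP[+ _]; lra.
pose w := e ^+ 2 / 8; have w0 : 0 < w by rewrite divr_gt0 // exprn_gt0.
move=> f f0; have f2 : 0 < f / 2 by rewrite divr_gt0.
have ds : 0 < s - s' by rewrite subr_gt0.
have [K0 HK0] := large_nat (2 / ((s - s') * w * (f / 2))).
pose K := K0.+1.
have [n1 Hn1] := NK_lower K s'0 s'1 e4 f2.
have [n2 Hn2] := large_nat (2 / (s - s')).
exists (maxn 1 (maxn n1 n2)) => n; rewrite !geq_max => /and3P[n0 nn1 nn2].
have N0 : 0 < n%:R :> R by rewrite ltr0n.
set a := tm s' n; set b := tm s n.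
have ab : (a <= b)%N by apply/tm_mono/ltW.
have bn : (b <= n)%N by apply/tm_len/ltW.
have dN : 2 <= (s - s') * n%:R by rewrite mulrC -ler_pdivrMr // Hn2.
have gap : (s - s') * n%:R / 2 <= b%:R - a%:R.
  have := tm_gt s n; have := tm_le n (ltW s'0); rewrite -/a -/b; lra.
have K00 : 0 < K%:R :> R by rewrite ltr0n.
(* the sum of the means of WK is at most n / K, so some mean in the window is small *)
have [k /andP[ak kb] Wk] : exists2 k, (a <= k < b)%N & Ex k (fun p : path n => WK K (p k)) <= w * (f / 2).
  apply: contrapT => H.
  have : \sum_(a <= k < b) (w * (f / 2)) < \sum_(a <= k < b) Ex k (fun p : path n => WK K (p k)).
    have ab' : (a < b)%N by rewrite -(ltr_nat R) -subr_gt0 (lt_le_trans _ gap) // divr_gt0 // (lt_le_trans _ dN).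
    apply: ltr_sum_nat => // k akb; rewrite ltNge; apply/negP => Hk; apply: H.
    by exists k.
  apply/negP; rewrite -leNgt sumr_const_nat -[leRHS]mulr_natr natrB //.
  apply: le_trans (_ : n%:R / K%:R <= _).
    apply: le_trans (_ : \sum_(k < b) Ex k (fun p : path n => WK K (p k)) <= _).
      rewrite -(big_mkord xpredT (fun k => Ex k (fun p : path n => WK K (p k)))).
      rewrite [leRHS](big_cat_nat (n := a)) //= lerDr sumr_ge0 // => i _.
      by apply: Ex_ge0 => p _; exact: WK_ge0.
    apply: le_trans (@sum_WK n K (ltn0Sn _) b) _.
    by rewrite -[leRHS](Ex_cst (n := n) b); apply: Ex_le => p _; exact: RK_le.
  apply: le_trans (_ : w * (f / 2) * ((s - s') * n%:R / 2) <= _); last first.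
    by rewrite ler_wpM2l // mulr_ge0 // ltW.
  have wf : 0 < (s - s') * w * (f / 2) by rewrite !mulr_gt0.
  have H1 : 2 / ((s - s') * w * (f / 2)) <= K%:R by exact: HK0 (leqnSn _).
  rewrite ler_pdivrMr //.
  have -> : w * (f / 2) * ((s - s') * n%:R / 2) * K%:R = n%:R * ((s - s') * w * (f / 2) * K%:R / 2) by ring.
  rewrite ler_peMr ?(ltW N0) // ler_pdivlMr // mul1r.
  by move: H1; rewrite ler_pdivrMr // mulrC.
have kn : (k <= n)%N by apply: leq_trans (ltnW kb) bn.
have B1 : Pr n (fun p : path n => w < WK K (p k)) <= f / 2.
  have -> : Pr n (fun p : path n => w < WK K (p k)) = Pr k (fun p : path n => w < WK K (p k)) :> R.
    by apply: (Ex_adapted kn) => p q H; rewrite H.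
  apply: le_trans (@markov_Ex n k (fun p => WK K (p k)) w w0 _) _.
    by move=> p _; exact: WK_ge0.
  by rewrite ler_pdivrMr // mulrC.
apply: le_trans (_ : Pr n (fun p : path n => (NK K (p a) < cdp_eta s' - e / 4) || (w < WK K (p k))) <= _); last first.
  by apply: le_trans (Pr_or _ _ _) _; have := Hn1 _ nn1; move: B1; rewrite -/a; lra.
apply: Pr_le => p pv /forallP small; apply/orP.
have [|NKa] := ltP (NK K (p a)) (cdp_eta s' - e / 4); first by left.
right; rewrite ltNge; apply/negP => Ww.
have NKk : cdp_eta s' - e / 4 <= NK K (p k).
  apply: le_trans NKa _; apply: avg_mono => v; rewrite ler_nat.
  case: leqP => //= Kv.
  by rewrite (leq_trans Kv (valid_csize_le v ak (valid_le kn pv))).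
(* without a giant cycle, WK at time k would be at least NK (NK - (eta - e)) *)
have small' v : (csize (p k) v)%:R <= (cdp_eta s - e) * n%:R.
  apply: le_trans (ltW (small v)); rewrite ler_nat valid_csize_le //; first exact: ltnW.
  exact: valid_le pv.
move: Ww; rewrite WK_E.
set x := NK K (p k) in NKk *.
have H : (n%:R ^+ 2)^-1 * \sum_v (K <= csize (p k) v)%N%:R * (csize (p k) v)%:R <= (cdp_eta s - e) * x.
  rewrite expr2 invfM -mulrA [leRHS]mulrC /x /NK -mulrA ler_wpM2l ?invr_ge0 //.
  rewrite mulr_suml mulr_sumr; apply: ler_sum => v _.
  rewrite mulrCA ler_wpM2l // mulrC ler_pdivrMr //.
have x0 : e / 2 <= x by lra.
have : e / 2 * (e / 2) <= x * (x - (cdp_eta s - e)).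
  have x1 : e / 2 <= x - (cdp_eta s - e) by lra.
  by apply: ler_pM => //; rewrite ltW // divr_gt0.
have : 0 < e ^+ 2 by rewrite exprn_gt0.
by rewrite /w; lra.
Qed.

End Giant.

(** * Limit law of the cycle of a given vertex *)
Section Core.
Context {R : realType}.
Local Notation path n := (nat -> 'S_n).
Local Notation negl := (@negl R).
Local Notation Pr := (@Pr R _).
Local Notation Ex := (@Ex R _).

(** By exchangeability the cycle of v is distributed as that of a uniform vertex. *)
Lemma Pr_csize n t k (g : nat -> bool) (v : 'I_n) :
  Pr t (fun p => g (csize (p k) v)) =
  Ex t (fun p : path n => n%:R^-1 * \sum_w (g (csize (p k) w))%:R) :> R.
Proof.
have n0 : (0 < n)%N by case: v => m; apply: leq_ltn_trans.
have H (w : 'I_n) : Pr t (fun p => g (csize (p k) w)) = Pr t (fun p => g (csize (p k) v)) :> R.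
  rewrite -[RHS](Ex_conj t (tperm v w)) /Pr; apply: Ex_eq => p _.
  by rewrite -{2}(tpermR v w) csizeJ.
rewrite ExZ Ex_sum (eq_bigr (fun=> Pr t (fun p => g (csize (p k) v)))) //.
set x := Pr _ _; rewrite sumr_const card_ord -[x *+ n]mulr_natl mulKf //.
  by rewrite pnatr_eq0 -lt0n.
by move=> w _; exact: H.
Qed.

(** The event that the drop-down time of v is at most s n, in terms of cycles;
    see drop_le_hit. *)
Definition hit (eps : nat -> R) (s : R) n (v : 'I_n) (p : path n) : bool :=
  [exists k : 'I_(tm s n).+1, (n%:R / 2 * (1 + eps n) < k%:R) &&
     [forall w, (csize (p k) w <= csize (p k) v)%N]].

Lemma csize_NK n K (s : 'S_n) v : (K <= csize s v)%N -> (csize s v)%:R <= n%:R * NK K s :> R.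
Proof.
move=> Kv; have n0 : (0 < n)%N by case: (v) => m; apply: leq_ltn_trans.
rewrite /NK mulVKf ?pnatr_eq0 -?lt0n // (bigID (fun w => w \in porbit s v)) /=.
rewrite (eq_bigr (fun=> 1)); last by move=> w /csizeE ->; rewrite Kv.
by rewrite sumr_const lerDl sumr_ge0.
Qed.

Lemma csize2_NK n K (s : 'S_n) v w : (K <= csize s v)%N -> (K <= csize s w)%N ->
  w \notin porbit s v -> (csize s v)%:R + (csize s w)%:R <= n%:R * NK K s :> R.
Proof.
move=> Kv Kw vw; have n0 : (0 < n)%N by case: (v) => m; apply: leq_ltn_trans.
rewrite /NK mulVKf ?pnatr_eq0 -?lt0n // (bigID (fun u => u \in porbit s v)) /=; apply: lerD.
  rewrite (eq_bigr (fun=> 1)); last by move=> u /csizeE ->; rewrite Kv.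
  by rewrite sumr_const.
rewrite (bigID (fun u => u \in porbit s w)) /= -[leLHS]addr0; apply: lerD; last exact: sumr_ge0.
rewrite (eq_bigl (fun u => u \in porbit s w)); last first.
  move=> u; apply: andb_idl => uw; apply: contra vw => uv.
  by move: uw uv; rewrite -!eq_porbit_mem => /eqP <-.
rewrite (eq_bigr (fun=> 1)); last by move=> u /csizeE ->; rewrite Kw.
by rewrite sumr_const.
Qed.

Lemma Ex_NK_le n K t k (U : path n -> bool) (a : R) : 0 <= a ->
  (forall p, valid t p -> ~~ U p -> NK K (p k) <= a) ->
  Ex t (fun p : path n => NK K (p k)) <= a + Pr t U.
Proof.
move=> a0 H; rewrite -[a](Ex_cst (n := n) t) -ExD; apply: Ex_le => p pv.
have [Up|Up] := boolP (U p); last by rewrite addr0 H.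
by apply: le_trans (NK_le1 _ _) _; rewrite lerDr.
Qed.

(** Outside an event U of small probability, a fraction close to eta of the
    vertices lies in cycles of size at least K, and if eta > 0 a single cycle
    contains almost all of these. By exchangeability v is in a cycle of size at
    least K with probability close to eta, and then it is in the giant cycle
    except for an event B of small probability. A vertex of the giant cycle is
    hit because that cycle is the largest at time s n. A vertex that is hit
    before lies in a cycle of size at least K, since already at time n / 2 the
    largest cycle has size at least K. *)
Theorem cycle_limit (eps : nat -> R) (s e : R) :
  (forall n, (0 < n)%N -> 0 < eps n) -> eps @ \oo --> 0 ->
  0 < s -> s < 1 -> 0 < e ->
  exists n0, forall n, (n0 <= n)%N -> forall v : 'I_n,
    `|Pr n (hit eps s v) - cdp_eta s| <= e /\
    Pr n (fun p => if hit eps s v p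
      then e < `|(csize (p (tm s n)) v)%:R / n%:R - cdp_eta s|
      else e < (csize (p (tm s n)) v)%:R / n%:R) <= e.
Proof.
move=> eps0 epsl s0 s1 e0.
have h0 := eta_ge0 s; set eta := cdp_eta s in h0 *.
have [e1 [e10 e1e e1eta]] : exists e1 : R, [/\ 0 < e1, e1 <= e / 20 & 0 < eta -> e1 <= eta / 20].
  have [eta0|] := ltP 0 eta.
    exists (Num.min (e / 20) (eta / 20)); split => [||_].
    - by rewrite lt_min !divr_gt0.
    - by rewrite ge_min lexx.
    - by rewrite ge_min lexx orbT.
  by move=> eta0; exists (e / 20); split; rewrite ?divr_gt0 // ltNge eta0.
have [K0 HK0] := NK_upper s0 s1 e10.
pose K := maxn K0 1.
have K00 : (0 < K)%N by rewrite /K leq_max orbT.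
pose U n (p : path n) := (NK K (p (tm s n)) < eta - e1) || (eta + e1 < NK K (p (tm s n))) ||
  ([forall v, (csize (p (tm s n)) v)%:R < (eta - e1) * n%:R] ||
   [forall v, csize (p (tm (2^-1 : R) n)) v < K]%N).
have nU : negl U.
  apply: negl_or; apply: negl_or.
  - exact: NK_lower.
  - by apply: HK0; rewrite /K leq_max leqnn.
  - exact: giant_exists.
  - exact: critical_cycles.
have [n1 Hn1] := nU _ e10.
have [n2 Hn2] := large_nat (K%:R / e1).
have [n3 Hn3] : exists n3, forall n, (n3 <= n)%N -> 2^-1 < s -> n%:R / 2 * (1 + eps n) < (tm s n)%:R.
  pose d := s - 2^-1; have [d0|d0] := ltP 0 d; last first.
    by exists 0%N => n _ s2; move: d0; rewrite /d; lra.
  have /cvgrPdist_lt/(_ _ d0)[N1 _ HN1] := epsl.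
  have [N2 HN2] := large_nat (2 / d).
  exists (maxn N1 N2) => n; rewrite geq_max => /andP[nN1 nN2] _.
  have := HN1 n nN1; rewrite sub0r normrN => /= /(le_lt_trans (ler_norm _)) en.
  have := HN2 n nN2; rewrite ler_pdivrMr // => nd.
  apply: le_lt_trans (_ : n%:R / 2 * (1 + eps n) <= n%:R / 2 * (1 + d)) _.
    by rewrite ler_wpM2l ?divr_ge0 // lerD2l ltW.
  apply: le_lt_trans (tm_gt s n); move: nd; rewrite /d.
  by set x := n%:R; lra.
exists (maxn 1 (maxn n1 (maxn n2 n3))) => n; rewrite !geq_max => /and4P[n0 nn1 nn2 nn3] v.
have N0 : 0 < n%:R :> R by rewrite ltr0n.
have PU : Pr n (U n) <= e1 := Hn1 _ nn1.
have Kn : K%:R <= e1 * n%:R by rewrite mulrC -ler_pdivrMr // Hn2.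
set t := tm s n; have tn : (t <= n)%N by apply/tm_len/ltW.
(* sizes of at least K, and among these the ones below that of the giant cycle *)
pose L (c : nat) := (K <= c)%N.
pose B (c : nat) := (K <= c)%N && (c%:R < (eta - e1) * n%:R).
have s2 : 0 < eta -> 2^-1 < s.
  by move=> eta0; rewrite ltNge; apply: contraL eta0 => s2; rewrite /eta eta_small ?ltxx // ltW.
have PL : Pr n (fun p => L (csize (p t) v)) = Ex n (fun p : path n => NK K (p t)) :> R by exact: Pr_csize.
have NKU p : ~~ U n p -> eta - e1 <= NK K (p t) <= eta + e1.
  by rewrite !negb_or -!leNgt -andbA => /and3P[-> ->].
have PL_le : Pr n (fun p => L (csize (p t) v)) <= eta + 2 * e1.
  rewrite PL; apply: le_trans (@Ex_NK_le n K n t (U n) (eta + e1) _ _) _.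
  - by rewrite addr_ge0 // ltW.
  - by move=> p _ /NKU /andP[].
  - by lra.
have PL_ge : eta - 2 * e1 <= Pr n (fun p => L (csize (p t) v)).
  have : eta - e1 <= Pr n (fun p => L (csize (p t) v)) + Pr n (U n).
    rewrite PL -ExD -[leLHS](Ex_cst (n := n) n); apply: Ex_le => p _.
    have [Up|/NKU /andP[H _]] := boolP (U n p); last by rewrite addr0.
    have := NK_ge0 (R := R) K (p t); have := eta_le1 s; rewrite -/eta mulr1n; lra.
  by lra.
(* the giant cycle leaves room for few vertices of type B *)
have D1 p : ~~ U n p -> n%:R^-1 * \sum_w (B (csize (p t) w))%:R <= 2 * e1.
  move=> Up; have /andP[NK1 NK2] := NKU _ Up.
  have BL : n%:R^-1 * \sum_w (B (csize (p t) w))%:R <= NK (R := R) K (p t).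
    by apply: avg_mono => w; rewrite /B ler_nat; case: (K <= _)%N => //=; case: (_ < _).
  have [eta0|eta0] := ltP 0 eta; last by lra.
  move: (Up); rewrite !negb_or => /and3P[_ /forallPn[w] + _]; rewrite -leNgt => cw.
  have e1e' := e1eta eta0.
  have Kw : (K <= csize (p t) w)%N.
    rewrite -(ler_nat R); apply: le_trans (le_trans Kn _) cw; rewrite ler_pM2r //; lra.
  have : (csize (p t) w)%:R / n%:R + n%:R^-1 * \sum_w (B (csize (p t) w))%:R <= NK (R := R) K (p t).
    rewrite [_ / _]mulrC -mulrDr /NK ler_wpM2l ?invr_ge0 //.
    rewrite [leRHS](bigID (fun u => u \in porbit (p t) w)) [X in _ + X](bigID (fun u => u \in porbit (p t) w)) /=.
    rewrite [X in _ + (X + _)]big1 ?add0r; last first.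
      by move=> u /csizeE ->; rewrite /B ltNge cw andbF.
    apply: lerD.
      rewrite (eq_bigr (fun=> 1)); last by move=> u /csizeE ->; rewrite Kw.
      by rewrite sumr_const.
    by apply: ler_sum => u _; rewrite /B ler_nat; case: (K <= _)%N => //=; case: (_ < _).
  have : eta - e1 <= (csize (p t) w)%:R / n%:R by rewrite ler_pdivlMr.
  by lra.
have PB : Pr n (fun p => B (csize (p t) v)) <= 3 * e1.
  rewrite (@Pr_csize n n t B v).
  apply: le_trans (_ : Ex n (fun p : path n => 2 * e1 + (U n p)%:R) <= _).
    apply: Ex_le => p _; have [Up|/D1 H] := boolP (U n p); last by rewrite addr0.
    apply: le_trans (_ : 1 <= _); last by rewrite lerDr mulr_ge0 // ltW.
    by apply: avg_le => // w; rewrite lern1 leq_b1.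
  by rewrite ExD Ex_cst -/(Pr n (U n)); lra.
have D2 p : ~~ U n p -> L (csize (p t) v) -> ~~ B (csize (p t) v) ->
    `|(csize (p t) v)%:R / n%:R - eta| <= e1.
  move=> /NKU /andP[_ NK2] Lv; rewrite /B (Lv : (K <= _)%N) /= -leNgt => cv.
  have := csize_NK Lv; rewrite mulrC => cv2.
  rewrite ler_norml lerBlDl lerBrDl ler_pdivlMr // ler_pdivrMr // cv /=.
  by apply: le_trans cv2 _; rewrite ler_pM2r // addrC.
have D3 p : valid n p -> ~~ U n p -> hit eps s v p -> L (csize (p t) v).
  move=> pv Up /existsP[[k /= kt] /andP[nk /forallP Hk]].
  move: (Up); rewrite !negb_or => /and3P[_ _ /forallPn[w]]; rewrite -leqNgt => Kw.
  have kn : (k <= n)%N by apply: leq_trans tn.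
  have hk : (tm (2^-1 : R) n <= k)%N.
    rewrite -(ler_nat R); apply: le_trans (tm_le n _) _; first by rewrite invr_ge0.
    have := mulr_gt0 N0 (eps0 _ n0); move: nk; set x := n%:R; set y := eps n; lra.
  apply: leq_trans (valid_csize_le v (kt : (k <= t)%N) (valid_le tn pv)).
  apply: leq_trans (Hk w); apply: leq_trans Kw _.
  exact: valid_csize_le hk (valid_le kn pv).
(* two cycles larger than (eta - e1) n would exceed the total mass (eta + e1) n *)
have D4 p : 0 < eta -> valid n p -> ~~ U n p -> L (csize (p t) v) -> ~~ B (csize (p t) v) -> hit eps s v p.
  move=> eta0 pv Up Lv; rewrite /B (Lv : (K <= _)%N) /= -leNgt => cv.
  apply/existsP; exists ord_max => /=; rewrite Hn3 ?s2 //=.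
  apply/forallP => w; rewrite leqNgt -/t; apply/negP => vw.
  have Kw : (K <= csize (p t) w)%N by apply: leq_trans Lv (ltnW vw).
  have nvw : w \notin porbit (p t) v by apply/negP => /csizeE E; rewrite E ltnn in vw.
  have := csize2_NK Lv Kw nvw.
  have /andP[_ NK2] := NKU _ Up.
  have : (csize (p t) v)%:R <= (csize (p t) w)%:R :> R by rewrite ler_nat ltnW.
  have : n%:R * NK K (p t) <= n%:R * (eta + e1) by rewrite ler_pM2l.
  have : n%:R * (eta + e1) < n%:R * (2 * (eta - e1)).
    by rewrite ltr_pM2l //; have := e1eta eta0; lra.
  move: cv; rewrite mulrC; lra.
split.
- rewrite ler_norml; apply/andP; split.
    have [eta0|eta0] := ltP 0 eta; last first.
      by have := Pr_ge0 (R := R) n (hit eps s v); lra.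
    have : Pr n (fun p => L (csize (p t) v)) <= Pr n (hit eps s v) +
        (Pr n (fun p => B (csize (p t) v)) + Pr n (U n)).
      rewrite -!ExD; apply: Ex_le => p pv.
      have [Lv|_] := boolP (L _); last by rewrite !addr_ge0.
      have [Up|Up] := boolP (U n p); first by rewrite addrA lerDr addr_ge0.
      have [Bv|Bv] := boolP (B _); first by rewrite addr0 lerDr.
      by rewrite (D4 _ eta0 pv Up Lv Bv) !addr0.
    by lra.
  have : Pr n (hit eps s v) <= Pr n (fun p => L (csize (p t) v)) + Pr n (U n).
    rewrite -ExD; apply: Ex_le => p pv; have [Hv|_] := boolP (hit _ _ _ _); last by rewrite addr_ge0.
    have [Up|Up] := boolP (U n p); first by rewrite lerDr.
    by rewrite (D3 _ pv Up Hv) addr0.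
  by lra.
have [eta0|eta0] := ltP 0 eta.
  apply: le_trans (_ : Pr n (fun p => B (csize (p t) v)) + Pr n (U n) <= _); last by lra.
  rewrite -ExD; apply: Ex_le => p pv.
  have [Up|Up] := boolP (U n p); first by rewrite -[leLHS]add0r lerD // lern1 leq_b1.
  have [Bv|Bv] := boolP (B _); first by rewrite addr0 lern1 leq_b1.
  rewrite addr0 lern0 eqb0; case: ifPn => Hv.
    by rewrite -leNgt (le_trans (D2 _ Up (D3 _ pv Up Hv) Bv)) //; lra.
  apply/negP => cv; move/negP: Hv; apply; apply: D4 => //.
  rewrite /L -(ler_nat R); apply: le_trans Kn _.
  by move: cv; rewrite ltr_pdivlMr // => /ltW; apply: le_trans; rewrite ler_pM2r //; lra.
have etaE : eta = 0 by apply/eqP; rewrite eq_le eta0.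
apply: le_trans (_ : Pr n (fun p => L (csize (p t) v)) + Pr n (U n) <= _); last by lra.
rewrite -ExD; apply: Ex_le => p pv.
have [Up|Up] := boolP (U n p); first by rewrite -[leLHS]add0r lerD // lern1 leq_b1.
have [Lv|Lv] := boolP (L _); first by rewrite addr0 lern1 leq_b1.
rewrite addr0 lern0 eqb0; case: ifPn => Hv; first by rewrite (D3 _ pv Up Hv) in Lv.
apply/negP => cv; move/negP: Lv; apply.
rewrite /L -(ler_nat R); apply: le_trans Kn _.
by move: cv; rewrite ltr_pdivlMr // => /ltW; apply: le_trans; rewrite ler_pM2r //; lra.
Qed.

End Core.

(** * Monotone paths in the M1 topology *)
Section MonotonePaths.
Context {R : realType}.
Implicit Types x y : R -> R.

Definition noninc x : Prop := forall s t : R, 0 <= s -> s <= t -> t <= 1 -> x t <= x s.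

Section OnePath.
Variable x : R -> R.
Hypotheses (px : is_path x) (dx : noninc x).

Lemma lim_left_le t t' : 0 <= t' -> t' < t -> t <= 1 -> lim_left x t <= x t'.
Proof.
move=> t'0 t't t1; have t0 : 0 < t by exact: le_lt_trans t't.
rewrite /lim_left t0; apply: limr_le; first by apply: path_cvg_left => //; rewrite t0.
near=> u; apply: dx => //; first by near: u; exact: nbhs_left_ge.
by apply: le_trans t1; near: u; exact: nbhs_left_le.
Unshelve. all: by end_near. Qed.

Lemma lim_left_ge t (c : R) : 0 <= t -> t <= 1 ->
  (forall t', 0 <= t' -> t' < t -> c <= x t') -> (t = 0 -> c <= x 0) -> c <= lim_left x t.
Proof.
move=> t0 t1 H H0; rewrite /lim_left; case: ltP => t0'; last first.
  by rewrite (_ : t = 0); [apply: H0|]; apply/eqP; rewrite eq_le t0 t0'.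
apply: limr_ge; first by apply: path_cvg_left => //; rewrite t0'.
near=> u; apply: H; first by near: u; exact: nbhs_left_ge.
by near: u; exact: nbhs_left_lt.
Unshelve. all: by end_near. Qed.

Lemma lim_right_ge t t' : 0 <= t -> t < t' -> t' <= 1 -> x t' <= lim_right x t.
Proof.
move=> t0 tt' t'1; have t1 : t < 1 by exact: lt_le_trans t'1.
rewrite /lim_right t1; apply: limr_ge; first by apply: path_cvg_right => //; rewrite t0.
near=> u; apply: dx => //; last by near: u; exact: nbhs_right_le.
by apply: le_trans t0 _; near: u; exact: nbhs_right_ge.
Unshelve. all: by end_near. Qed.

Lemma lim_right_le t (c : R) : 0 <= t -> t <= 1 ->
  (forall t', t < t' -> t' <= 1 -> x t' <= c) -> (t = 1 -> x 1 <= c) -> lim_right x t <= c.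
Proof.
move=> t0 t1 H H0; rewrite /lim_right; case: ltP => t1'; last first.
  by rewrite (_ : t = 1); [apply: H0|]; apply/eqP; rewrite eq_le t1 t1'.
apply: limr_le; first by apply: path_cvg_right => //; rewrite t0.
near=> u; apply: H; first by near: u; exact: nbhs_right_gt.
by near: u; exact: nbhs_right_le.
Unshelve. all: by end_near. Qed.

Lemma lim_left_self t : 0 <= t -> t <= 1 -> x t <= lim_left x t.
Proof.
move=> t0 t1; apply: lim_left_ge => // [t' t'0 t't|->//].
by apply: dx => //; exact: ltW.
Qed.

Lemma lim_right_self t : 0 <= t -> t <= 1 -> lim_right x t <= x t.
Proof.
move=> t0 t1; apply: lim_right_le => // [t' tt' t'1|->//].
by apply: dx => //; exact: ltW.
Qed.

Lemma between_noninc t (z : R) : 0 <= t -> t <= 1 ->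
  between (lim_left x t) (lim_right x t) z <-> lim_right x t <= z <= lim_left x t.
Proof.
move=> t0 t1; have h := le_trans (lim_right_self t0 t1) (lim_left_self t0 t1).
by rewrite /between (min_idPr h) (max_idPl h).
Qed.

(** On the completed graph of a nonincreasing path the coordinate q = t - z is
    strictly increasing along the natural order; level q is the time of the
    point with that coordinate. *)
Definition level (q : R) : R := sup [set t : R | 0 <= t <= 1 /\ (t = 0 \/ t - x t <= q)].

Let S (q : R) : set R := [set t : R | 0 <= t <= 1 /\ (t = 0 \/ t - x t <= q)].

Let hasS q : has_sup (S q).
Proof.
split; first by exists 0; split; [rewrite lexx ler01|left].
by exists 1 => t [/andP[]].
Qed.

Let le_level q t : S q t -> t <= level q.
Proof. by move=> St; exact: (sup_upper_bound (hasS q)). Qed.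

Let level_le q (c : R) : (forall t, S q t -> t <= c) -> level q <= c.
Proof. by move=> H; apply: ge_sup => //; have [] := hasS q. Qed.

Lemma level_ge0 q : 0 <= level q.
Proof. by apply: le_level; split; [rewrite lexx ler01|left]. Qed.

Lemma level_le1 q : level q <= 1.
Proof. by apply: level_le => t [/andP[]]. Qed.

Lemma level_gt q t : level q < t -> t <= 1 -> q < t - x t.
Proof.
move=> lt t1; rewrite ltNge; apply/negP => H.
have t0 : 0 <= t by apply: le_trans (level_ge0 q) (ltW lt).
by have := le_level (conj (introT andP (conj t0 t1)) (or_intror H)); rewrite leNgt lt.
Qed.

Lemma level_lt q t : 0 <= t -> t < level q -> t - x t <= q.
Proof.
move=> t0 tl; have tl' : 0 < level q - t by rewrite subr_gt0.
have [t'' [/andP[h0 h1] H]] := sup_adherent tl' (hasS q).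
rewrite -/(level q) opprB addrCA subrr addr0 => tt.
case: H => [H|H]; first by move: tt; rewrite H ltNge t0.
by apply: le_trans H; apply: lerB; [exact: ltW|apply: dx => //; exact: ltW].
Qed.

Lemma level_unique q t : 0 <= t -> t <= 1 ->
  (forall u, t < u -> u <= 1 -> q < u - x u) ->
  (forall u, 0 <= u -> u < t -> u - x u <= q) -> level q = t.
Proof.
move=> t0 t1 H1 H2; apply/eqP; rewrite eq_le; apply/andP; split.
  apply: level_le => u [/andP[u0 u1] [->//|Hu]]; rewrite leNgt; apply/negP => tu.
  by have := H1 _ tu u1; rewrite ltNge Hu.
rewrite leNgt; apply/negP => lt.
pose u := (level q + t) / 2.
have u1 : level q < u by rewrite /u; lra.
have u2 : u < t by rewrite /u; lra.
have u0 : 0 <= u by apply: le_trans (level_ge0 q) (ltW u1).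
have := level_gt u1 (le_trans (ltW u2) t1).
by rewrite ltNge H2.
Qed.

Lemma level_mono q q' : q <= q' -> level q <= level q'.
Proof.
move=> qq; apply: level_le => t [t01 H]; apply: le_level; split => //.
by case: H => [|H]; [left|right; exact: le_trans H qq].
Qed.

Lemma level_lip q q' : q <= q' -> level q' <= level q + (q' - q).
Proof.
move=> qq; apply: level_le => t [/andP[t0 t1] H]; rewrite leNgt; apply/negP => lt.
have l0 := level_ge0 q.
case: H => [H|H]; first by move: lt; rewrite H ltNge addr_ge0 // subr_ge0.
pose t' := t - (q' - q).
have t'l : level q < t' by rewrite /t'; lra.
have t't : t' <= t by rewrite /t'; lra.
have := level_gt t'l (le_trans t't t1).
have := dx (le_trans l0 (ltW t'l)) t't t1.
by rewrite /t'; lra.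
Qed.

Lemma level_dist q q' : `|level q - level q'| <= `|q - q'|.
Proof.
wlog qq : q q' / q <= q'.
  by move=> H; have [/H//|/ltW/H] := leP q q'; rewrite distrC [X in _ <= X]distrC.
rewrite distrC [X in _ <= X]distrC !ger0_norm ?subr_ge0 ?level_mono //.
by have := level_lip qq; lra.
Qed.

Lemma level_graph q : - x 0 <= q -> q <= 1 - x 1 ->
  lim_right x (level q) <= level q - q <= lim_left x (level q).
Proof.
move=> q0 q1; have l0 := level_ge0 q; have l1 := level_le1 q.
apply/andP; split.
  rewrite lerBrDr; apply/ler_addgt0Pr => e e0; rewrite -lerBrDr.
  apply: lim_right_le => // [t' lt t'1|l]; last by rewrite l; lra.
  have [tt|tt] := leP t' (level q + e).
    by have := level_gt lt t'1; lra.
  pose t'' := level q + e; have t''l : level q < t'' by rewrite /t''; lra.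
  have := level_gt t''l (le_trans (ltW tt) t'1).
  have := dx (le_trans l0 (ltW t''l)) (ltW tt) t'1; rewrite /t''; lra.
rewrite lerBlDr; apply/ler_addgt0Pr => e e0; rewrite -lerBlDr -lerBlDr.
apply: lim_left_ge => // [t' t'0 t'l|l]; last by rewrite l; lra.
have [tt|tt] := leP (level q - e) t'.
  by have := level_lt t'0 t'l; lra.
pose t'' := level q - e; have t''l : t'' < level q by rewrite /t''; lra.
have t''0 : 0 <= t'' by apply: le_trans t'0 (ltW tt).
have := level_lt t''0 t''l.
have := dx t'0 (ltW tt) (le_trans (ltW t''l) l1); rewrite /t''; lra.
Qed.

Lemma graph_level t (z : R) : 0 <= t -> t <= 1 ->
  lim_right x t <= z <= lim_left x t ->
  [/\ - x 0 <= t - z, t - z <= 1 - x 1 & level (t - z) = t].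
Proof.
move=> t0 t1 /andP[zr zl]; split.
- have : z <= x 0 + t; last by lra.
  apply: le_trans zl _; move: t0; rewrite le_eqVlt => /orP[/eqP <-|t0].
    by rewrite /lim_left ltxx addr0.
  by apply: le_trans (lim_left_le (lexx _) t0 t1) _; rewrite lerDl ltW.
- have : x 1 - (1 - t) <= z; last by lra.
  apply: le_trans zr; move: t1; rewrite le_eqVlt => /orP[/eqP ->|t1].
    by rewrite /lim_right ltxx subrr subr0.
  by apply: le_trans (lim_right_ge t0 t1 (lexx _)); rewrite gerBl subr_ge0 ltW.
- apply: level_unique => // u h1 h2.
    have := lim_right_ge t0 h1 h2; lra.
  by have := lim_left_le h1 h2 t1; lra.
Qed.

Let q0 : R := - x 0.
Let q1 : R := 1 - x 1.

(** The coordinate q runs through [- x 0, 1 - x 1], which coord maps affinely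
    from [0, 1]. *)
Definition coord (s : R) : R := - x 0 + s * (1 - x 1 + x 0).
Definition prep_r (s : R) : R := level (coord s).
Definition prep_u (s : R) : R := level (coord s) - coord s.

Let coordE s : coord s = q0 + s * (q1 - q0).
Proof. by rewrite /coord /q0 /q1 opprK. Qed.

Lemma level_continuous : continuous level.
Proof.
move=> q; apply/cvgrPdist_lt => e e0; near=> q'.
by apply: le_lt_trans (level_dist _ _) _; near: q'; exact: (@cvgr_dist_lt _ _ _ _ _ id).
Unshelve. all: by end_near. Qed.

Lemma coord_continuous : continuous coord.
Proof.
by move=> s; apply: cvgD; [exact: cvg_cst|apply: cvgM; [exact: cvg_id|exact: cvg_cst]].
Qed.

Lemma prep_parametric : parametric_representation x prep_u prep_r.
Proof.
have cr : continuous prep_r.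
  by move=> s; apply: continuous_comp; [exact: coord_continuous|exact: level_continuous].
have dq : 0 < q1 - q0.
  by rewrite /q0 /q1; have := dx (lexx 0) ler01 (lexx 1); lra.
split.
- by apply: continuous_subspaceT => s; apply: cvgB; [exact: cr|exact: coord_continuous].
- exact: continuous_subspaceT.
- apply/seteqP; split => [[z t] [s /=]|[z t] /= [/andP[t0 t1]]].
    rewrite in_itv/= => /andP[s0 s1] [<- <-]; split => /=.
      by rewrite level_ge0 level_le1.
    apply/between_noninc; rewrite ?level_ge0 ?level_le1 //.
    have c0 : 0 <= s * (q1 - q0) by rewrite mulr_ge0 // ltW.
    have c1 : s * (q1 - q0) <= q1 - q0 by rewrite ler_piMl // ltW.
    apply: level_graph; rewrite -/q0 -/q1 coordE; lra.
  move=> /between_noninc => /(_ t0 t1) /(graph_level t0 t1)[]; rewrite /= => h0 h1 h2.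
  exists ((t - z - q0) / (q1 - q0)).
    rewrite /= in_itv/= divr_ge0 ?(ltW dq) ?subr_ge0 //= ler_pdivrMr // mul1r.
    by rewrite lerD2r.
  have cE : coord ((t - z - q0) / (q1 - q0)) = t - z.
    by rewrite coordE divfK ?gt_eqF // addrC subrK.
  by rewrite /prep_u /prep_r cE h2; congr pair; lra.
- move=> s s' s0 ss s'1; have cc : coord s <= coord s'.
    by rewrite !coordE lerD2l ler_wpM2r // ltW.
  have [lt|] := ltP (prep_r s) (prep_r s'); first by left.
  move=> ge; right; have E : prep_r s = prep_r s'.
    by apply/eqP; rewrite eq_le ge level_mono.
  split=> //=; rewrite E.
  have L (v : R) : 0 <= v -> v <= 1 -> prep_u v <= lim_left x (prep_r v).
    move=> v0 v1; have c0 : 0 <= v * (q1 - q0) by rewrite mulr_ge0 // ltW.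
    have c1 : v * (q1 - q0) <= q1 - q0 by rewrite ler_piMl // ltW.
    have a0 : - x 0 <= coord v by rewrite -/q0 coordE; lra.
    have a1 : coord v <= 1 - x 1 by rewrite -/q1 coordE; lra.
    by have /andP[] := level_graph a0 a1.
  have L1 := L _ s0 (le_trans ss s'1); have L2 := L _ (le_trans s0 ss) s'1.
  rewrite E in L1; rewrite !ger0_norm ?subr_ge0 // lerD2l lerN2.
  by rewrite /prep_u -/(prep_r s) -/(prep_r s') E lerD2l lerN2.
Qed.

End OnePath.

(** Closeness in the sense of the Levy metric of monotone functions. The end
    points come in separately because the M1 topology controls the values there. *)
Definition levy (e : R) x y : Prop :=
  [/\ `|x 0 - y 0| <= e, `|x 1 - y 1| <= e &
   forall t t' : R, 0 <= t -> t + e <= t' -> t' <= 1 -> y t' <= x t + e /\ x t' <= y t + e].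

Lemma levy_sym e x y : levy e x y -> levy e y x.
Proof.
move=> [h0 h1 H]; split; rewrite 1?distrC // => t t' t0 tt t1.
by have [] := H t t' t0 tt t1.
Qed.

Lemma levyW e e' x y : e <= e' -> levy e x y -> levy e' x y.
Proof.
move=> ee [h0 h1 H]; split => [||t t' t0 tt t1]; rewrite ?(le_trans _ ee) //.
have [] := H t t' t0 _ t1; first by apply: le_trans tt; rewrite lerD2l.
by move=> a b; split; [apply: le_trans a _|apply: le_trans b _]; rewrite lerD2l.
Qed.

Lemma level_levy e x y q : 0 <= e -> noninc x -> noninc y -> levy e x y ->
  `|level x q - level y q| <= e.
Proof.
move=> e0.
have H x' y' : noninc x' -> noninc y' -> levy e x' y' -> level y' q <= level x' q + e.
  move=> dx' dy' [_ _ H]; rewrite leNgt; apply/negP => lt.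
  pose t := (level y' q + (level x' q + e)) / 2.
  have t1 : t < level y' q by rewrite /t; lra.
  have t2 : level x' q + e < t by rewrite /t; lra.
  have lx := level_ge0 x' q; have ly := level_le1 y' q.
  have := level_lt dy' (ltac:(lra) : 0 <= t) t1.
  have := @level_gt x' q (t - e) (ltac:(lra)) (ltac:(lra)).
  have [] := H (t - e) t (ltac:(lra)) (ltac:(lra)) (ltac:(lra)).
  lra.
move=> dx dy L; rewrite ler_norml; apply/andP; split.
  by have := H _ _ dx dy L; lra.
by have := H _ _ dy dx (levy_sym L); lra.
Qed.

Lemma unif_dist_ge0 (u v : R -> R) : 0 <= unif_dist01 u v.
Proof.
rewrite /unif_dist01; set A := [set _ | _ in _].
have A0 : A `|u 0 - v 0| by exists 0 => //=; rewrite in_itv/= lexx ler01.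
have [hs|hs] := pselect (has_sup A).
  by apply: le_trans (sup_upper_bound hs A0).
by rewrite sup_out.
Qed.

Lemma unif_dist_le (u v : R -> R) (c : R) :
  (forall s, 0 <= s -> s <= 1 -> `|u s - v s| <= c) -> unif_dist01 u v <= c.
Proof.
move=> H; apply: ge_sup.
  by exists `|u 0 - v 0|, 0 => //=; rewrite in_itv/= lexx ler01.
by move=> d [s /=]; rewrite in_itv/= => /andP[s0 s1] <-; exact: H.
Qed.

(** Parametrize both completed graphs by the coordinate t - z. Levy-close paths
    have close levels at equal coordinates, by level_levy. *)
Lemma m1_dist_levy e x y : 0 <= e -> is_path x -> is_path y -> noninc x -> noninc y ->
  levy e x y -> m1_dist x y <= 3 * e.
Proof.
move=> e0 px py dx dy L.
rewrite /m1_dist; set A := (X in inf X).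
have lbA : has_lbound A.
  exists 0 => _ [u1 [r1 [u2 [r2 [_ _ ->]]]]].
  by rewrite le_max unif_dist_ge0.
pose d := Num.max (unif_dist01 (prep_u x) (prep_u y)) (unif_dist01 (prep_r x) (prep_r y)).
have Ad : A d.
  exists (prep_u x), (prep_r x), (prep_u y), (prep_r y); split => //; exact: prep_parametric.
apply: le_trans (ge_inf lbA Ad) _.
have cd s : 0 <= s -> s <= 1 -> `|coord x s - coord y s| <= e.
  move=> s0 s1; have [h0 h1 _] := L; rewrite /coord.
  have -> : - x 0 + s * (1 - x 1 + x 0) - (- y 0 + s * (1 - y 1 + y 0)) =
    - ((1 - s) * (x 0 - y 0) + s * (x 1 - y 1)) by ring.
  rewrite normrN; apply: le_trans (ler_normD _ _) _.
  rewrite !normrM (ger0_norm s0) (ger0_norm (_ : 0 <= 1 - s)) ?subr_ge0 //.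
  have : (1 - s) * `|x 0 - y 0| <= (1 - s) * e by rewrite ler_wpM2l ?subr_ge0.
  have : s * `|x 1 - y 1| <= s * e by rewrite ler_wpM2l.
  lra.
have rd s : 0 <= s -> s <= 1 -> `|prep_r x s - prep_r y s| <= 2 * e.
  move=> s0 s1; rewrite /prep_r.
  have -> : level x (coord x s) - level y (coord y s) =
    (level x (coord x s) - level x (coord y s)) + (level x (coord y s) - level y (coord y s)) by ring.
  apply: le_trans (ler_normD _ _) _.
  have := le_trans (level_dist dx _ _) (cd _ s0 s1).
  by have := level_levy (coord y s) e0 dx dy L; lra.
rewrite ge_max; apply/andP; split; apply: unif_dist_le => s s0 s1; last first.
  by apply: le_trans (rd _ s0 s1) _; lra.
have -> : prep_u x s - prep_u y s = (prep_r x s - prep_r y s) - (coord x s - coord y s).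
  by rewrite /prep_u /prep_r; ring.
apply: le_trans (ler_normB _ _) _.
by have := rd _ s0 s1; have := cd _ s0 s1; lra.
Qed.

End MonotonePaths.

(** * Step paths and limit paths *)
Section Paths.
Context {R : realType}.

Lemma near_right_cst (f : R -> R) (t c d : R) : 0 < d ->
  (forall u, t < u -> u < t + d -> f u = c) -> f @ t^'+ --> c.
Proof.
move=> d0 H; apply: cvg_near_cst; near=> u; apply: H; near: u.
  exact: nbhs_right_gt.
by apply: nbhs_right_lt; rewrite ltrDl.
Unshelve. all: by end_near. Qed.

Lemma near_left_cst (f : R -> R) (t c d : R) : 0 < d ->
  (forall u, t - d < u -> u < t -> f u = c) -> f @ t^'- --> c.
Proof.
move=> d0 H; apply: cvg_near_cst; near=> u; apply: H; near: u.
  by apply: nbhs_left_gt; rewrite gtrBl.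
exact: nbhs_left_lt.
Unshelve. all: by end_near. Qed.

Lemma pred_ceil (u : R) : 0 < u -> exists2 k : nat, k%:R < u & u <= k.+1%:R.
Proof.
move=> u0; have /andP[h1 h2] := truncn_itv (ltW u0).
move: h1; rewrite le_eqVlt => /orP[/eqP E|h1]; last by exists (Num.truncn u) => //; exact: ltW.
have k0 : (0 < Num.truncn u)%N by rewrite -(ltr0n R) E.
exists (Num.truncn u).-1; last by rewrite prednK // E.
by rewrite -[X in _ < X]E ltr_nat prednK.
Qed.

Section Step.
Variables (a : nat -> R) (n : nat).

Definition step_path (s : R) : R := a (Num.truncn (s * n%:R)).

Let truncE (k : nat) (u : R) : k%:R <= u -> u < k.+1%:R -> Num.truncn u = k.
Proof. by move=> h1 h2; apply/eqP; rewrite truncn_eq ?h1 ?h2 // (le_trans _ h1). Qed.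

Lemma step_right t : 0 <= t -> step_path @ t^'+ --> step_path t.
Proof.
move=> t0; case: (posnP n) => [n0|n0].
  apply: (near_right_cst ltr01) => u _ _; rewrite /step_path.
  by rewrite [n in u * n%:R]n0 [n in t * n%:R]n0 !mulr0.
have N0 : 0 < n%:R :> R by rewrite ltr0n.
have /andP[h1 h2] : (Num.truncn (t * n%:R))%:R <= t * n%:R < (Num.truncn (t * n%:R)).+1%:R.
  by apply: truncn_itv; rewrite mulr_ge0 ?ler0n.
have d0 : 0 < (Num.truncn (t * n%:R)).+1%:R / n%:R - t by rewrite subr_gt0 ltr_pdivlMr.
apply: (near_right_cst d0) => u tu; rewrite addrC subrK ltr_pdivlMr // => ut.
congr a; apply: truncE => //; apply: le_trans h1 _; by rewrite ler_pM2r // ltW.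
Qed.

Lemma step_left t : 0 < t -> cvg (step_path @ t^'-).
Proof.
move=> t0; case: (posnP n) => [n0|n0].
  apply: (cvgP (a 0%N)); apply: (near_left_cst ltr01) => u _ _; rewrite /step_path.
  by rewrite [n in u * n%:R]n0 mulr0 truncn0.
have N0 : 0 < n%:R :> R by rewrite ltr0n.
have tn0 : 0 < t * n%:R by rewrite mulr_gt0.
have [k k1 k2] := pred_ceil tn0.
apply: (cvgP (a k)).
have d0 : 0 < t - k%:R / n%:R by rewrite subr_gt0 ltr_pdivrMr.
apply: (near_left_cst d0) => u; rewrite subKr ltr_pdivrMr // => u1 u2.
congr a; apply: truncE; first exact: ltW.
by apply: lt_le_trans k2; rewrite ltr_pM2r.
Qed.

Lemma step_is_path : is_path step_path.
Proof.
split.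
- by move=> t /andP[t0 _]; exact: step_left.
- by move=> t /andP[t0 _]; exact: cvgP (step_right t0).
- exact: step_right.
- move=> t /andP[t0 t1]; have -> : lim_right step_path t = step_path t.
    rewrite /lim_right; case: ifP => // _.
    by apply: cvg_lim => //; exact: step_right.
  by rewrite /between ge_min lexx orbT le_max lexx orbT.
Qed.

End Step.

Definition drop_path (r s : R) : R := 1 - cdp_eta s * (r < s)%R%:R.

Section DropPath.
Variable r : R.
Hypothesis r0 : 0 <= r.

Let y := drop_path r.

Lemma eta_right t : 0 <= t -> t < 1 -> (fun s => 1 - cdp_eta s : R) @ t^'+ --> 1 - cdp_eta t.
Proof.
move=> t0 t1; apply: cvgB; first exact: cvg_cst.
apply/cvgrPdist_lt => e e0; have [d d0 H] := eta_continuous t0 (ltW t1) e0.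
near=> u; rewrite distrC; apply: H.
- by apply: le_trans t0 _; near: u; exact: nbhs_right_ge.
- by near: u; exact: nbhs_right_le.
- rewrite ger0_norm ?subr_ge0; last by near: u; exact: nbhs_right_ge.
  by rewrite ltrBlDl; near: u; apply: nbhs_right_lt; rewrite ltrDl.
Unshelve. all: by end_near. Qed.

Lemma eta_left t : 0 < t -> t <= 1 -> (fun s => 1 - cdp_eta s : R) @ t^'- --> 1 - cdp_eta t.
Proof.
move=> t0 t1; apply: cvgB; first exact: cvg_cst.
apply/cvgrPdist_lt => e e0; have [d d0 H] := eta_continuous (ltW t0) t1 e0.
near=> u; rewrite distrC; apply: H.
- by near: u; exact: nbhs_left_ge.
- by apply: le_trans t1; near: u; exact: nbhs_left_le.
- rewrite distrC ger0_norm ?subr_ge0; last by near: u; exact: nbhs_left_le.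
  by rewrite ltrBlDl -ltrBlDr; near: u; apply: nbhs_left_gt; rewrite gtrBl.
Unshelve. all: by end_near. Qed.

Lemma drop_left t : 0 < t -> t <= 1 ->
  y @ t^'- --> (if r < t then 1 - cdp_eta t else 1).
Proof.
move=> t0 t1; case: ltP => rt.
  apply: cvg_trans (eta_left t0 t1); apply: near_eq_cvg; near=> u.
  rewrite /y /drop_path; have -> : r < u by near: u; exact: nbhs_left_gt.
  by rewrite mulr1.
apply: (near_left_cst ltr01) => u _ ut; rewrite /y /drop_path ltNge (le_trans (ltW ut) rt).
by rewrite mulr0 subr0.
Unshelve. all: by end_near. Qed.

Lemma drop_right t : 0 <= t -> t < 1 ->
  y @ t^'+ --> (if r <= t then 1 - cdp_eta t else 1).
Proof.
move=> t0 t1; case: leP => rt.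
  apply: cvg_trans (eta_right t0 t1); apply: near_eq_cvg; near=> u.
  rewrite /y /drop_path; have -> : r < u; last by rewrite mulr1.
  by apply: le_lt_trans rt _; near: u; exact: nbhs_right_gt.
have d0 : 0 < r - t by rewrite subr_gt0.
apply: (near_right_cst d0) => u _; rewrite addrC subrK => ur; rewrite /y /drop_path ltNge (ltW ur).
by rewrite mulr0 subr0.
Unshelve. all: by end_near. Qed.

Lemma drop_is_path : is_path y.
Proof.
split.
- by move=> t /andP[t0 t1]; exact: cvgP (drop_left t0 t1).
- by move=> t /andP[t0 t1]; exact: cvgP (drop_right t0 t1).
- have := drop_right (lexx 0) ltr01; rewrite /y /drop_path.
  rewrite ltNge r0 mulr0 subr0 eta_small // ?invr_ge0 // subr0.
  by case: ifP.
- move=> t /andP[t0 t1]; rewrite /between.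
  have [rt|rt|rt] := ltgtP r t.
  + have -> : lim_left y t = y t.
      rewrite /lim_left; case: ltP => // t0'; apply: cvg_lim => //.
      by have := drop_left t0' t1; rewrite rt /y /drop_path rt mulr1.
    by rewrite ge_min lexx le_max lexx.
  + have -> : lim_right y t = y t.
      rewrite /lim_right; case: ltP => // t1'; apply: cvg_lim => //.
      have := drop_right t0 t1'; rewrite leNgt rt /= /y /drop_path ltNge (ltW rt) mulr0 subr0 //.
    by rewrite ge_min lexx orbT le_max lexx orbT.
  + have -> : lim_left y t = y t.
      rewrite /lim_left; case: ltP => // t0'; apply: cvg_lim => //.
      by have := drop_left t0' t1; rewrite rt ltxx /y /drop_path -rt ltxx mulr0 subr0.
    by rewrite ge_min lexx le_max lexx.
Qed.

Lemma drop_noninc : noninc y.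
Proof.
move=> s t s0 st t1; rewrite /y /drop_path lerD2l lerN2.
apply: ler_pM; rewrite ?eta_ge0 ?eta_le //.
by rewrite ler_nat; case: ltP => // rs; rewrite (lt_le_trans rs st).
Qed.

End DropPath.

Lemma drop0 r : 0 <= r -> drop_path r 0 = 1.
Proof. by move=> r0; rewrite /drop_path ltNge r0 mulr0 subr0. Qed.

Lemma drop1 r : r < 1 -> drop_path r 1 = 0.
Proof. by move=> r1; rewrite /drop_path r1 eta1 mulr1 subrr. Qed.

(** All limit paths with r < 1 end at 1 - eta 1 = 0; the one with r = 1 ends at 1
    and is far from the others. *)
Lemma drop_levy r r' e : 0 <= r -> r < 1 -> 0 <= r' -> r' < 1 -> `|r - r'| <= e ->
  levy e (drop_path r) (drop_path r').
Proof.
move=> r0 r1 r'0 r'1 rr; have e0 : 0 <= e by apply: le_trans rr.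
have H a b t t' : b - a <= e -> 0 <= t -> t + e <= t' -> drop_path b t' <= drop_path a t + e.
  move=> ab t0 tt; rewrite /drop_path.
  suff : cdp_eta t * (a < t)%R%:R <= cdp_eta t' * (b < t')%R%:R by lra.
  apply: ler_pM; rewrite ?eta_ge0 //; first by apply: eta_le => //; lra.
  by rewrite ler_nat; case: ltP => // aet; rewrite (_ : b < t') //; lra.
move: rr; rewrite ler_norml => /andP[h1 h2].
split; rewrite ?drop0 ?drop1 // ?subrr ?normr0 //.
by move=> t t' t0 tt t1; split; apply: H => //; lra.
Qed.

(** Monotonicity extends closeness from the points i / M to closeness in the Levy
    sense, however the path behaves in between. *)
Lemma grid_levy (x : R -> R) r (M : nat) (e : R) : (0 < M)%N -> M%:R^-1 <= e ->
  noninc x -> 0 <= r -> r < 1 -> `|x 0 - 1| <= e -> x 1 = 0 ->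
  (forall i, (0 < i)%N -> (i < M)%N ->
     if r <= i%:R / M%:R then `|1 - x (i%:R / M%:R) - cdp_eta (i%:R / M%:R)| <= e
     else 1 - x (i%:R / M%:R) <= e) ->
  (forall s, 0 <= s -> s <= 1 -> x s <= 1) ->
  levy (2 * e) x (drop_path r).
Proof.
move=> M0 Me dx r0 r1 x0 x1 H xle.
have Mp : 0 < M%:R :> R by rewrite ltr0n.
have e0 : 0 <= e by apply: le_trans Me; rewrite invr_ge0 ltW.
have dd : noninc (drop_path r) by exact: drop_noninc.
split.
- by rewrite drop0 // (le_trans x0) //; lra.
- by rewrite x1 drop1 // subrr normr0; lra.
move=> t t' t0 tt t'1.
have ep : 0 < e by apply: lt_le_trans Me; rewrite invr_gt0.
(* i / M is the last grid point before t' *)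
have t'0 : 0 < t' by lra.
have [i i1 i2] := pred_ceil (mulr_gt0 t'0 Mp).
pose g := i%:R / M%:R : R.
have gt' : g < t' by rewrite ltr_pdivrMr.
have g2 : t' - e <= g.
  have : t' <= i.+1%:R / M%:R by rewrite ler_pdivlMr.
  by rewrite -natr1 mulrDl mul1r -/g; lra.
have tg : t + e <= g by lra.
have g1 : g < 1 by exact: lt_le_trans gt' t'1.
have iM : (i < M)%N by rewrite -(ltr_nat R) -[M%:R]mul1r -ltr_pdivrMr.
have ig : (0 < i)%N.
  by rewrite lt0n; apply/eqP => i0; move: tg; rewrite /g i0 mul0r; lra.
have := H i ig iM; rewrite -/g.
have g0 : 0 <= g by lra.
have xt' : x t' <= x g by apply: dx => //; exact: ltW.
have xt : x g <= x t by apply: dx => //; lra.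
case: leP => rg; last first.
  have yt1 : drop_path r t = 1 by rewrite /drop_path ltNge (_ : t <= r) ?mulr0 ?subr0 //; lra.
  have := xle t' (ltW t'0) t'1; have yt' : drop_path r t' <= 1.
    by rewrite /drop_path gerBl mulr_ge0 ?eta_ge0.
  by rewrite yt1; lra.
rewrite ler_norml => /andP[h1 h2].
have et : 0 <= cdp_eta g by exact: eta_ge0.
have yt' : drop_path r t' = 1 - cdp_eta t' by rewrite /drop_path (le_lt_trans rg gt') mulr1.
have e1 : cdp_eta g <= cdp_eta t' by apply: eta_le => //; exact: ltW.
have e2 : 1 - cdp_eta g <= drop_path r t.
  have : cdp_eta t <= cdp_eta g by apply: eta_le => //; lra.
  by rewrite /drop_path; case: (r < t); rewrite ?mulr1 ?mulr0; lra.
by rewrite yt'; lra.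
Qed.

End Paths.

(** * The walk and the graph of a coagulating history *)
Section Histories.
Context {R : realType} {n : nat}.
Implicit Types (p : nat -> 'S_n) (s : 'S_n) (v w : 'I_n) (t : nat).

Lemma cdp_edge_sym p t : symmetric (cdp_edge p t).
Proof. by move=> a b; apply: eq_existsb => k; rewrite eq_sym tpermC. Qed.

Lemma cdp_edgeS p t a b : cdp_edge p t.+1 a b =
  cdp_edge p t a b || ((a != b) && (p t.+1 == tperm a b * p t)%g).
Proof.
apply/existsP/orP => [[k]|[/existsP[k H]|H]].
- have := ltn_ord k; rewrite ltnS leq_eqVlt => /orP[/eqP -> H|kt H]; first by right.
  by left; apply/existsP; exists (Ordinal kt).
- by exists (widen_ord (leqnSn t) k).
- by exists ord_max.
Qed.

Lemma connect_ind_rel (T : finType) (e : rel T) (Q : rel T) :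
  reflexive Q -> transitive Q -> subrel e Q -> subrel (connect e) Q.
Proof.
move=> Qr Qt eQ x y /connectP[q]; elim: q x => [|z q IH] x /=; first by move=> _ ->; exact: Qr.
by move=> /andP[/eQ xz zq] ye; apply: (Qt z) => //; exact: IH.
Qed.

Lemma trans_fuse s s' : trans s s' -> s' = s \/
  exists a b, porbit s a != porbit s b /\ s' = fuse s a b.
Proof.
rewrite /trans; case: ifP => _; first by left.
by move=> [[a b] ab ->]; right; exists a, b; rewrite -mem_diffp.
Qed.

Lemma porbit_trans_sub s s' v : trans s s' -> porbit s v \subset porbit s' v.
Proof.
by move=> /trans_fuse[->//|[a [b [ab ->]]]]; exact: porbit_fuse_sub.
Qed.

(** Every step adds an edge between the two cycles that it merges, so the
    components of the graph are the cycles. *)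
Lemma connect_cdp p t v w : valid t p ->
  connect (cdp_edge p t) v w = (w \in porbit (p t) v).
Proof.
elim: t v w => [|t IH] v w pv.
  have [-> _] := pv; apply/idP/idP.
    apply: (@connect_ind_rel _ _ (fun v w => w \in porbit 1%g v)).
    - by move=> u; exact: porbit_id.
    - by move=> y x z; rewrite -!eq_porbit_mem => /eqP -> /eqP ->.
    - by move=> a b /existsP[[]].
  by move=> /porbitP[i ->]; rewrite expg1n perm1 connect0.
have IH' u u' := IH u u' (validS pv).
have tr : trans (p t) (p t.+1) by have [_] := pv; apply.
have cs (T : finType) (e : rel T) : symmetric e -> connect_sym e by exact: sym_connect_sym.
have sub a b : connect (cdp_edge p t) a b -> connect (cdp_edge p t.+1) a b.
  by apply: connect_sub => x y xy; apply: connect1; rewrite cdp_edgeS xy.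
apply/idP/idP.
  apply: (@connect_ind_rel _ _ (fun v w => w \in porbit (p t.+1) v)).
  - by move=> u; exact: porbit_id.
  - by move=> y x z; rewrite -!eq_porbit_mem => /eqP -> /eqP ->.
  - move=> a b; rewrite cdp_edgeS => /orP[/connect1|].
      by rewrite IH' => h; apply: (fintype.subsetP (porbit_trans_sub _ tr)).
    move=> /andP[ab /eqP E]; have := trans_fuse tr.
    case=> [E2|[x [y [xy E2]]]].
      move: E; rewrite E2 => /(congr1 (fun s => s * (p t)^-1)%g); rewrite mulgK mulgV.
      by move=> /(congr1 (fun s : 'S_n => s a)); rewrite perm1 tpermL => E; rewrite E eqxx in ab.
    move: E; rewrite E2 => /mulIg /(@tperm_eq _ _ _ _ _).
    have xny : x != y by apply: contra_neq xy => ->.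
    move=> /(_ xny) H.
    rewrite -E2 E2 porbit_fuse //.
    by case: H => -[-> ->]; rewrite !porbit_id ?orbT /= inE !porbit_id ?orbT.
have := trans_fuse tr; case=> [->|[x [y [xy E2]]]].
  by rewrite -IH'; exact: sub.
have xny : x != y by apply: contra_neq xy => ->.
have cxy : connect (cdp_edge p t.+1) x y.
  by apply: connect1; rewrite cdp_edgeS xny E2 eqxx orbT.
have sy := cs _ _ (cdp_edge_sym p t.+1).
have toU u : (u \in porbit (p t) x) || (u \in porbit (p t) y) -> connect (cdp_edge p t.+1) x u.
  case/orP; rewrite -IH' => /sub //; exact: connect_trans.
rewrite E2 porbit_fuse //; case: ifP => [vU|_]; last by rewrite -IH'; exact: sub.
by rewrite inE => wU; apply: (connect_trans (y := x)); [rewrite sy|]; exact: toU.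
Qed.

Lemma largest_csize p t v : valid t p ->
  (v \in largest_components p t) = [forall w, (csize (p t) w <= csize (p t) v)%N].
Proof.
move=> pv; rewrite inE; apply: eq_forallb => w.
have E u : #|connect (cdp_edge p t) u| = csize (p t) u.
  by apply: eq_card => u'; rewrite -(connect_cdp u u' pv).
by rewrite !E.
Qed.

(** Every step of the coagulating dynamics merges cycles, so the walk is
    uniform on the current cycle of its starting point. *)
Lemma isrw_uniform p t v w : valid t p ->
  isrw v p t w = if w \in porbit (p t) v then (csize (p t) v)%:R^-1 else 0 :> R.
Proof.
elim: t w => [|t IH] w pv.
  by rewrite /=; case: ifP => // /csizeE wv; rewrite -/(csize _ _) wv.
have tr : trans (p t) (p t.+1) by have [_] := pv; apply.
have sub := fintype.subsetP (porbit_trans_sub v tr).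
rewrite /= (eq_bigr (fun u => if u \in porbit (p t) v then (csize (p t) v)%:R^-1 else 0)); last first.
  by move=> u _; rewrite IH //; exact: validS.
rewrite -big_mkcondr /=; case: ifPn => wv.
  rewrite (eq_bigl (fun u => u \in porbit (p t) v)); last first.
    move=> u; apply: andb_idl => /sub uv; move: wv uv.
    by rewrite -!eq_porbit_mem => /eqP -> /eqP ->.
  have -> : \sum_(u in porbit (p t) v) (csize (p t) v)%:R^-1 = 1 :> R.
    set x := (csize (p t) v)%:R^-1; rewrite sumr_const -[x *+ _]mulr_natr mulVf //.
    by rewrite pnatr_eq0 -lt0n csize_gt0.
  by rewrite mulr1 -(csizeE wv).
rewrite big_pred0 ?mulr0 // => u; apply/negP => /andP[uw /sub uv].
move/negP: wv; apply; move: uw uv; rewrite -!eq_porbit_mem => /eqP -> /eqP ->.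
by [].
Qed.

Lemma isrw_tv_csize p t v : valid t p ->
  isrw_tv v p t = 1 - (csize (p t) v)%:R / n%:R :> R.
Proof.
move=> pv; have n0 : (0 < n)%N by case: (v) => m; apply: leq_ltn_trans.
have N0 : 0 < n%:R :> R by rewrite ltr0n.
have c0 : 0 < (csize (p t) v)%:R :> R by rewrite ltr0n csize_gt0.
rewrite /isrw_tv /tv_dist (bigID (fun w => w \in porbit (p t) v)) /=.
rewrite (eq_bigr (fun=> (csize (p t) v)%:R^-1 - n%:R^-1)); last first.
  move=> w wv; rewrite isrw_uniform // wv ger0_norm // subr_ge0 lef_pV2 ?posrE //.
  by rewrite ler_nat csize_le.
rewrite [X in _ + X](eq_bigr (fun=> n%:R^-1)); last first.
  by move=> w /negbTE wv; rewrite isrw_uniform // wv sub0r normrN ger0_norm // invr_ge0.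
rewrite sumr_const (sumr_const [predC porbit (p t) v]).
have -> : #|[predC porbit (p t) v]| = (n - csize (p t) v)%N.
  have := cardC (mem (porbit (p t) v)).
  by move/(congr1 (fun k => k - csize (p t) v)%N); rewrite addKn => ->; rewrite card_ord.
rewrite -[X in X + _]mulr_natl -[X in _ + X]mulr_natl natrB ?csize_le // -/(csize _ _).
by field; rewrite !gt_eqF.
Qed.

Lemma drop_event p t v : valid t p ->
  (exists w, isrw v p t w != 0 :> R /\ w \in largest_components p t) <->
  [forall w, (csize (p t) w <= csize (p t) v)%N].
Proof.
move=> pv; split => [[w [w0]]|H].
  rewrite largest_csize // => /forallP H; apply/forallP => u.
  move: w0; rewrite isrw_uniform //; case: ifP; last by rewrite eqxx.
  by move=> /csizeE wv _; have := H u; rewrite wv.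
exists v; rewrite largest_csize // isrw_uniform // porbit_id invr_eq0 pnatr_eq0 -lt0n csize_gt0.
by [].
Qed.

Lemma inf_nat (A : set nat) (m : nat) : A m -> exists k, [/\ A k, forall j, A j -> (k <= j)%N &
  inf [set t%:R | t in A] = k%:R :> R].
Proof.
move=> Am; have exA : exists m, `[< A m >] by exists m; apply/asboolP.
case: (ex_minnP exA) => k /asboolP Ak kmin; exists k; split => //.
  by move=> j Aj; apply: kmin; apply/asboolP.
apply/eqP; rewrite eq_le; apply/andP; split.
  apply: ge_inf; last by exists k.
  by exists 0 => _ [j _ <-].
apply: lb_le_inf; first by exists k%:R, k.
by move=> _ [j Aj <-]; rewrite ler_nat; apply: kmin; apply/asboolP.
Qed.

Definition drop_set (eps : R) v p : set nat := [set t : nat | n%:R / 2 * (1 + eps) < t%:R /\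
    exists w, isrw v p t w != 0 :> R /\ w \in largest_components p t].

Lemma drop_set_last (eps : R) v p : valid n p -> n%:R / 2 * (1 + eps) < n%:R -> drop_set eps v p n.
Proof.
move=> pv en; split => //; apply/(drop_event _ pv); apply/forallP => w.
have n0 : (0 < n)%N by case: (v) => m; apply: leq_ltn_trans.
have H := valid_last (R := R) v (valid_le (leq_pred n) pv).
apply: leq_trans (csize_le _ _) _; rewrite -{1}H.
by apply: valid_csize_le pv; exact: leq_pred.
Qed.

Lemma drop_le_hit (eps : nat -> R) (s : R) v p : valid n p -> 0 <= s -> s <= 1 ->
  n%:R / 2 * (1 + eps n) < n%:R ->
  (drop_down_time (eps n) v p / n%:R <= s) = hit eps s v p.
Proof.
move=> pv s0 s1 en; have n0 : (0 < n)%N by case: (v) => m; apply: leq_ltn_trans.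
have N0 : 0 < n%:R :> R by rewrite ltr0n.
have [k [Ak kmin kE]] := inf_nat (drop_set_last v pv en).
rewrite /drop_down_time -/(drop_set _ _ _) kE ler_pdivrMr //.
have kn : (k <= n)%N by apply: kmin; exact: drop_set_last.
have ts : (k%:R <= s * n%:R) = (k <= tm s n)%N.
  by rewrite /tm truncn_ge_nat // mulr_ge0 // ltW.
rewrite ts; apply/idP/existsP => [kt|[[j /= jt] /andP[ej Hj]]].
  exists (Ordinal (kt : (k < (tm s n).+1)%N)) => /=.
  have [-> H] := Ak; rewrite /=; apply/(drop_event _ (valid_le kn pv)) => //.
have jn : (j <= n)%N by apply: leq_trans (jt : (j <= tm s n)%N) _; exact: tm_len.
apply: leq_trans (jt : (j <= tm s n)%N); apply: kmin; split => //.
by apply/(drop_event _ (valid_le jn pv)).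
Qed.

Lemma drop_bounds (eps : R) v p : valid n p -> n%:R / 2 * (1 + eps) < n%:R ->
  0 <= drop_down_time eps v p / n%:R <= 1.
Proof.
move=> pv en; have n0 : (0 < n)%N by case: (v) => m; apply: leq_ltn_trans.
have N0 : 0 < n%:R :> R by rewrite ltr0n.
have [k [Ak kmin kE]] := inf_nat (drop_set_last v pv en).
rewrite /drop_down_time -/(drop_set _ _ _) kE divr_ge0 // ler_pdivrMr // mul1r ler_nat.
by apply: kmin; exact: drop_set_last.
Qed.

End Histories.

(** * The law of a finite history *)
Section Law.
Context {R : realType} {n : nat}.
Local Notation Ex := (@Ex R _).
Local Notation Pr := (@Pr R _).
Implicit Types (p q : nat -> 'S_n).

Definition prefix_eq t p q : bool := [forall k : 'I_t.+1, p k == q k].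

Lemma prefix_eqP t p q : reflect (forall k, (k <= t)%N -> p k = q k) (prefix_eq t p q).
Proof.
apply: (iffP forallP) => [H k kt|H k]; last by apply/eqP/H; rewrite -ltnS.
exact/eqP/(H (Ordinal (kt : (k < t.+1)%N))).
Qed.

Lemma prefix_eqS t p q : prefix_eq t.+1 p q = prefix_eq t p q && (p t.+1 == q t.+1).
Proof.
apply/prefix_eqP/andP => [H|[/prefix_eqP H /eqP E] k].
  by rewrite H //; split=> //; apply/prefix_eqP => k kt; apply/H/ltnW.
by rewrite leq_eqVlt => /orP[/eqP->|/H].
Qed.

Lemma step_point (s a : 'S_n) : step s (fun s' => (s' == a)%:R) = cdp_kernel s a :> R.
Proof.
rewrite -sum_kernel (bigD1 a) //= eqxx mulr1 big1 ?addr0 // => s' /negbTE ->.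
by rewrite mulr0.
Qed.

Lemma Pr_prefix t q : Pr t (fun p => prefix_eq t p q) =
  (q 0%N == 1%g)%:R * \prod_(k < t) cdp_kernel (q k) (q k.+1).
Proof.
elim: t => [|t IH].
  rewrite /Pr /= big_ord0 mulr1; congr (_ %:R); rewrite eq_sym; congr nat_of_bool.
  apply/prefix_eqP/eqP => [/(_ 0%N) <- //|E k]; by rewrite leqn0 => /eqP ->.
rewrite big_ord_recr /= mulrA -IH mulrC /Pr -ExZ.
change (Ex t (fun p => step (p t) (fun s => (prefix_eq t.+1 (app t p s) q)%:R)) =
  Ex t (fun p => cdp_kernel (q t) (q t.+1) * (prefix_eq t p q)%:R)).
apply: Ex_eq => p _.
rewrite [LHS](_ : _ = step (p t) (fun s => (prefix_eq t p q)%:R * (s == q t.+1)%:R)).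
  rewrite stepZ step_point mulrC; case: prefix_eqP => [->//|_]; by rewrite !mulr0.
congr step; apply/funext => s; rewrite prefix_eqS appS -natrM mulnb; congr ((_ && _)%:R).
by apply: eq_forallb => k; rewrite app_le // -ltnS.
Qed.

Definition extend t (q : {ffun 'I_t.+1 -> 'S_n}) k : 'S_n := q (inord (minn k t)).

Lemma prefix_extend t p : exists q : {ffun 'I_t.+1 -> 'S_n}, prefix_eq t p (extend q).
Proof.
exists [ffun k : 'I_t.+1 => p k]; apply/prefix_eqP => k kt.
by rewrite /extend ffunE inordK (minn_idPl kt).
Qed.

Lemma extend_inj t p (q q' : {ffun 'I_t.+1 -> 'S_n}) :
  prefix_eq t p (extend q) -> prefix_eq t p (extend q') -> q = q'.
Proof.
move=> /prefix_eqP H /prefix_eqP H'; apply/ffunP => k.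
have kt : (k <= t)%N by rewrite -ltnS.
by move: (H k kt) (H' k kt); rewrite /extend (minn_idPl kt) inord_val => -> .
Qed.

Context {d : measure_display} {T : measurableType d} (P : probability T R)
  (Pi : T -> nat -> 'S_n) (PiP : is_cdp P Pi).

Lemma measurable_cylinder t q : measurable [set x | prefix_eq t (Pi x) q].
Proof.
rewrite (_ : [set _ | _] = \bigcap_(k in [set k | (k <= t)%N]) [set x | Pi x k = q k]).
  by apply: bigcap_measurableType => k _; exact: PiP.1.
by apply/seteqP; split => x /=; [move/prefix_eqP|move=> H; apply/prefix_eqP].
Qed.

Lemma prefix_setE t (A : (nat -> 'S_n) -> Prop) :
  (forall p q, (forall k, (k <= t)%N -> p k = q k) -> A p -> A q) ->
  [set x | A (Pi x)] = \bigcup_(q in [set` [seq q <- enum {: {ffun 'I_t.+1 -> 'S_n}} |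
    `[< A (extend q) >]]]) [set x | prefix_eq t (Pi x) (extend q)].
Proof.
move=> At; apply/seteqP; split => x /=.
  move=> Ax; have [q qx] := prefix_extend t (Pi x).
  exists q => //=; rewrite mem_filter mem_enum andbT; apply/asboolP.
  by apply: At Ax; exact/prefix_eqP.
move=> [q /=]; rewrite mem_filter => /andP[/asboolP Aq _] /prefix_eqP qx.
by apply: At Aq => k /qx.
Qed.

Lemma measurable_prefix t (A : (nat -> 'S_n) -> Prop) :
  (forall p q, (forall k, (k <= t)%N -> p k = q k) -> A p -> A q) ->
  measurable [set x | A (Pi x)].
Proof.
move=> /prefix_setE ->; apply: fin_bigcup_measurable; first exact: finite_seq.
by move=> q _; exact: measurable_cylinder.
Qed.

(** This identifies the finite expectations Pr with the law of the given process.
    An event that is decided by time t is a finite union of cylinders. *)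
Lemma law_prefix t (A : (nat -> 'S_n) -> bool) :
  (forall p q, (forall k, (k <= t)%N -> p k = q k) -> A p = A q) ->
  P [set x | A (Pi x)] = (Pr t A)%:E.
Proof.
move=> At; have At' p q : (forall k, (k <= t)%N -> p k = q k) -> A p -> A q.
  by move=> /At ->.
rewrite (prefix_setE (A := A) At') measure_fin_bigcup; last first.
- by move=> q _; exact: measurable_cylinder.
- move=> q q' _ _ [x [/= qx q'x]]; exact: extend_inj qx q'x.
- exact: finite_seq.
rewrite -fsbig_seq; last by apply/filter_uniq/enum_uniq.
rewrite (eq_bigr (fun q : {ffun 'I_t.+1 -> 'S_n} =>
  (Pr t (fun p => prefix_eq t p (extend q)))%:E)); last first.
  move=> q _; rewrite Pr_prefix -PiP.2; congr (P _).
  by apply/seteqP; split => x /=; [move/prefix_eqP|move=> H; apply/prefix_eqP].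
rewrite sumEFin; congr (_%:E); rewrite -Ex_sum; apply: Ex_eq => p _.
rewrite big_filter big_enum_cond /=; have [q qp] := prefix_extend t p.
have Aq : A (extend q) = A p by apply/esym/At; exact/prefix_eqP.
rewrite big_mkcond (bigD1 q) //= qp Aq big1 ?addr0 => [|q' q'q].
  by case: ifP => [/asboolP ->|/asboolP/negP/negbTE ->].
case: ifP => // _; case: (boolP (prefix_eq t p (extend q'))) => // qp'.
by rewrite (extend_inj qp' qp) eqxx in q'q.
Qed.

End Law.

(** * Expectations of bounded random variables *)
Section Mean.
Context {R : realType} {d : measure_display} {T : measurableType d} (P : probability T R).
Implicit Types (f g X : T -> R) (M e : R).

Lemma meanE f : fine 'E_P[f] = \int[P]_x f x.
Proof. by rewrite unlock. Qed.

Lemma integrable_bounded f M : measurable_fun setT f -> (forall x, `|f x| <= M) ->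
  P.-integrable setT (EFin \o f).
Proof.
move=> mf fM; apply: measurable_bounded_integrable => //.
  by rewrite /= probability_setT ltry.
exists M; split; first exact: num_real.
by move=> x Mx y _; apply: le_trans (fM y) (ltW Mx).
Qed.

Lemma mean_close f g M e (N : set T) : measurable_fun setT f -> measurable_fun setT g ->
  (forall x, `|f x| <= M) -> (forall x, `|g x| <= M) -> measurable N -> 0 <= e ->
  (forall x, ~ N x -> `|f x - g x| <= e) ->
  `|fine 'E_P[f] - fine 'E_P[g]| <= e + 2 * M * fine (P N).
Proof.
move=> mf mg fM gM mN e0 fg.
have If := integrable_bounded mf fM; have Ig := integrable_bounded mg gM.
have mfg : measurable_fun setT (fun x => f x - g x) by exact: measurable_funB.
have fgM x : `|f x - g x| <= 2 * M.
  by apply: le_trans (ler_normB _ _) _; rewrite mulr2n mulrDl mul1r lerD.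
have Ifg : P.-integrable setT (EFin \o (fun x => f x - g x)) := integrable_bounded mfg fgM.
have mI : measurable_fun setT (fun x => 2 * M * \1_N x : R).
  by apply: measurable_funM => //; exact: measurable_indic.
have I1 : P.-integrable setT (EFin \o (\1_N : T -> R)).
  apply: (@integrable_bounded _ 1); first exact: measurable_indic.
  by move=> x; rewrite indicE ger0_norm ?ler0n // lern1 leq_b1.
have I2 : P.-integrable setT (EFin \o (fun x => 2 * M * \1_N x)).
  apply: (@integrable_bounded _ (`|2 * M|)) => // x.
  by rewrite normrM ler_piMr // indicE ger0_norm ?ler0n // lern1 leq_b1.
have Ie : P.-integrable setT (EFin \o (cst e)).
  by apply: (@integrable_bounded _ e) => // x; rewrite ger0_norm.
rewrite !meanE -RintegralB //; apply: le_trans (le_normr_Rintegral _ _) _ => //.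
have -> : e + 2 * M * fine (P N) = \int[P]_x (cst e x + 2 * M * \1_N x).
  rewrite RintegralD // RintegralZl // Rintegral_cst //.
  have -> : fine (P setT) = 1 by rewrite probability_setT.
  rewrite mulr1; congr (_ + _ * _); by rewrite /Rintegral integral_indic // setIT.
apply: le_Rintegral => //.
- apply: (@integrable_bounded _ (2 * M)); last by move=> x; rewrite normr_id.
  exact: measurableT_comp.
- apply: (@integrable_bounded _ (e + `|2 * M|)).
    exact: measurable_funD.
  move=> x; apply: le_trans (ler_normD _ _) _; rewrite /cst ger0_norm // lerD2l.
  by rewrite normrM ler_piMr // indicE ger0_norm ?ler0n // lern1 leq_b1.
- move=> x _; rewrite /cst indicE; case: (boolP (x \in N)) => [xN|/negP xN].
    by rewrite mulr1; apply: le_trans (fgM x) _; rewrite lerDr.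
  by rewrite mulr0 addr0; apply: fg => Nx; apply: xN; rewrite inE.
Qed.

Lemma mean_step X (m : nat) (a t : nat -> R) (c : R) : measurable_fun setT X ->
  let s x := c + \sum_(i < m) a i * (X x <= t i)%R%:R in
  [/\ measurable_fun setT s, exists M, forall x, `|s x| <= M &
      fine 'E_P[s] = c + \sum_(i < m) a i * fine (P [set x | X x <= t i])].
Proof.
move=> mX; have mS u : measurable [set x | X x <= u].
  have := mX measurableT _ (measurable_itv `]-oo, u]); rewrite setTI.
  by congr measurable; apply/seteqP; split => x; rewrite /= in_itv.
have iE u : (fun x => (X x <= u)%R%:R) = \1_[set x | X x <= u] :> (T -> R).
  apply/funext => x; rewrite indicE; congr ((_ : bool)%:R); apply/idP/idP.
    by move=> xu; rewrite inE.
  by rewrite inE.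
elim: m => [|m [mI [M HM] IE]].
  split.
  - by apply: (eq_measurable_fun (cst c)) => // x _; rewrite big_ord0 addr0.
  - by exists `|c| => x; rewrite big_ord0 addr0.
  - rewrite big_ord0 addr0 (_ : (fun _ => _) = cst c) ?expectation_cst //.
    by apply/funext => x; rewrite big_ord0 addr0.
pose s x := c + \sum_(i < m) a i * (X x <= t i)%R%:R.
have sE : (fun x => c + \sum_(i < m.+1) a i * (X x <= t i)%R%:R) =
    (fun x => s x + a m * \1_[set x | X x <= t m] x).
  by apply/funext => x; rewrite big_ord_recr /= addrA -iE.
rewrite /= sE; have m1 : measurable_fun setT (\1_[set x | X x <= t m] : T -> R).
  exact: measurable_indic.
have b1 x : `|\1_[set x | X x <= t m] x| <= 1 :> R.
  by rewrite indicE ger0_norm ?ler0n // lern1 leq_b1.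
have m2 : measurable_fun setT (fun x => a m * \1_[set x | X x <= t m] x : R).
  exact: measurable_funM.
have b2 x : `|a m * \1_[set x | X x <= t m] x| <= `|a m|.
  by rewrite normrM ler_piMr.
split.
- exact: measurable_funD.
- exists (M + `|a m|) => x; have /(congr1 (@^~ x)) /= -> := sE.
  by apply: le_trans (ler_normD _ _) _; apply: lerD (b2 x); exact: HM.
- rewrite meanE RintegralD //; last 2 first.
  + exact: integrable_bounded mI HM.
  + exact: integrable_bounded m2 b2.
  rewrite RintegralZl //; last exact: integrable_bounded m1 b1.
  rewrite -[X in X + _]meanE IE big_ord_recr /= addrA; congr (_ + _ * _).
  by rewrite /Rintegral integral_indic // setIT.
Qed.

End Mean.

(** * Convergence of distribution functions *)
Section Portmanteau.
Context {R : realType}.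

Lemma abel_step (g : nat -> R) (m j : nat) : (j <= m)%N ->
  \sum_(i < m) (g i - g i.+1) * (j <= i)%N%:R = g j - g m.
Proof.
elim: m => [|m IH] jm.
  by move: jm; rewrite leqn0 big_ord0 => /eqP ->; rewrite subrr.
rewrite big_ord_recr /=; move: jm; rewrite leq_eqVlt => /orP[/eqP ->|jm].
  rewrite ltnn mulr0 addr0 subrr big1 // => i _.
  by rewrite leqNgt (ltn_trans (ltn_ord i)) // mulr0.
by rewrite IH // -ltnS jm mulr1; ring.
Qed.

Lemma uniform_modulus (f : R -> R) (e : R) : continuous f -> 0 < e ->
  exists2 d : R, 0 < d & forall a b, 0 <= a <= 1 -> `|a - b| <= d -> `|f a - f b| <= e.
Proof.
move=> fc e0; have := @segment_compact R 0 1 => /compact_near_coveringP.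
move=> /(_ _ (0 : R)^'+ (fun d a => forall b, `|a - b| <= d -> `|f a - f b| <= e)) H.
have /H : forall a : R, `[0, 1]%classic a -> \forall a' \near a & d \near 0^'+,
    forall b, `|a' - b| <= d -> `|f a' - f b| <= e.
  move=> a _; have e2 : 0 < e / 2 by rewrite divr_gt0.
  have /cvgrPdist_lt/(_ _ e2) [/= r r0 Hr] := fc a.
  have r2 : 0 < r / 2 by rewrite divr_gt0.
  exists (ball a (r / 2), [set d : R | d < r / 2]) => /=.
    by split; [exact: nbhsx_ballx|exact: nbhs_right_lt].
  move=> [a' d] [/= aa' dr] b bd.
  have h1 : `|f a - f a'| < e / 2.
    by apply: Hr; rewrite /ball_ /=; move: aa'; rewrite /ball /= => aa'; lra.
  have h2 : `|f a - f b| < e / 2.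
    apply: Hr; rewrite /ball_ /=; apply: le_lt_trans (ler_distD a' _ _) _.
    by move: aa'; rewrite /ball /= => aa'; lra.
  apply: le_trans (ler_distD (f a) _ _) _; rewrite (distrC (f a')); lra.
move=> {}H; near (0 : R)^'+ => d; exists d; first by near: d; exact: nbhs_right_gt.
move=> a b a01; have : `[0, 1] `<=` [set a | forall b, `|a - b| <= d -> `|f a - f b| <= e].
  by near: d; apply: H; exact: at_right_proper_filter.
by move=> /(_ a); apply; rewrite /= in_itv.
Unshelve. all: by end_near. Qed.

(** Summation by parts writes a step approximation of f in terms of the events
    that the variable is at most i / m. *)
Definition step_approx (f : R -> R) (m : nat) (t : R) : R :=
  f 1 + \sum_(i < m) (f (i%:R / m%:R) - f (i.+1%:R / m%:R)) * (t <= i%:R / m%:R)%R%:R.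

Lemma step_approx_close (f : R -> R) (m : nat) (e t : R) : (0 < m)%N -> 0 <= t <= 1 ->
  (forall a b, 0 <= a <= 1 -> `|a - b| <= m%:R^-1 -> `|f a - f b| <= e) ->
  `|f t - step_approx f m t| <= e.
Proof.
move=> m0 /andP[t0 t1] fe; have M0 : 0 < m%:R :> R by rewrite ltr0n.
have [j [jm tj jt]] : exists j, [/\ (j <= m)%N, t * m%:R <= j%:R &
    j%:R <= t * m%:R + 1 /\ forall i, (t * m%:R <= i%:R) = (j <= i)%N].
  move: t0; rewrite le_eqVlt => /orP[/eqP <-|t0].
    by exists 0%N; rewrite mul0r add0r; split=> //; split=> // i; rewrite ler0n.
  have [k k1 k2] := pred_ceil (mulr_gt0 t0 M0).
  have km : (k.+1 <= m)%N.
    by rewrite -(ltr_nat R); apply: lt_le_trans k1 _; rewrite ler_piMl // ltW.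
  exists k.+1; split=> //; split=> [|i]; first by rewrite -natr1 lerD2r ltW.
  apply/idP/idP => [ti|]; last by rewrite -(ler_nat R); exact: le_trans.
  by rewrite -(ltr_nat R); exact: lt_le_trans k1 ti.
have [jt1 jtE] := jt.
have -> : step_approx f m t = f (j%:R / m%:R).
  rewrite /step_approx (eq_bigr (fun i : 'I_m =>
      (f (i%:R / m%:R) - f (i.+1%:R / m%:R)) * (j <= i)%N%:R)); last first.
    by move=> i _; rewrite ler_pdivlMr // jtE.
  by rewrite (abel_step (fun i => f (i%:R / m%:R))) // divff ?gt_eqF // addrC subrK.
apply: fe; first by rewrite t0.
rewrite -(ler_pM2r M0) mulVf ?gt_eqF // -[X in _ * X]gtr0_norm // -normrM mulrBl divfK ?gt_eqF //.
by rewrite ler_norml; apply/andP; split; lra.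
Qed.

(** One grid and one tolerance serve all pairs of random variables, which is what
    makes the convergence uniform in the starting point. *)
Lemma cdf_close (f : R -> R) (M e : R) : continuous f -> (forall x, `|f x| <= M) -> 0 < e ->
  exists m : nat, exists2 c : R, 0 < c &
  forall (d1 : measure_display) (T1 : measurableType d1) (P1 : probability T1 R) (A : T1 -> R)
    (d2 : measure_display) (T2 : measurableType d2) (P2 : probability T2 R) (B : T2 -> R),
  measurable_fun setT A -> measurable_fun setT B ->
  (exists N1, [/\ measurable N1, P1 N1 = 0%E & forall x, ~ N1 x -> 0 <= A x <= 1]) ->
  (forall x, 0 <= B x <= 1) ->
  (forall i, (i < m)%N -> `|fine (P1 [set x | A x <= i%:R / m%:R]) -
                            fine (P2 [set x | B x <= i%:R / m%:R])| <= c) ->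
  `|fine 'E_P1[f \o A] - fine 'E_P2[f \o B]| <= e.
Proof.
move=> fc fM e0; have M0 : 0 <= M by apply: le_trans (fM 0).
have e3 : 0 < e / 3 by rewrite divr_gt0.
have [r r0 Hr] := uniform_modulus fc e3.
pose m := (Num.truncn r^-1).+1.
have mr : m%:R^-1 <= r.
  have := truncnS_gt r^-1; rewrite -/m => h.
  by rewrite -[leRHS]invrK lef_pV2 ?posrE ?invr_gt0 // ltW.
have m0 : (0 < m)%N by [].
have M0' : 0 < m%:R :> R by rewrite ltr0n.
pose c := e / 3 / (m%:R * (2 * M + 1)).
have MM : 0 < 2 * M + 1 by lra.
exists m; exists c; first by rewrite /c divr_gt0 // mulr_gt0.
move=> d1 T1 P1 A d2 T2 P2 B mA mB [N1 [mN1 PN1 A01]] B01 AB.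
have fclose t : 0 <= t <= 1 -> `|f t - step_approx f m t| <= e / 3.
  move=> t01; apply: step_approx_close => // a b a01 ab; apply: Hr => //; exact: le_trans ab mr.
have mf : measurable_fun setT f by exact: continuous_measurable_fun.
have mfA : measurable_fun setT (f \o A) by exact: measurableT_comp.
have mfB : measurable_fun setT (f \o B) by exact: measurableT_comp.
pose a i := f (i%:R / m%:R) - f (i.+1%:R / m%:R).
pose t i : R := i%:R / m%:R.
have [mSA [MA HMA] EA] := mean_step P1 m a t (f 1) mA.
have [mSB [MB HMB] EB] := mean_step P2 m a t (f 1) mB.
pose sA := (fun x => f 1 + \sum_(i < m) a i * (A x <= t i)%R%:R).
pose sB := (fun x => f 1 + \sum_(i < m) a i * (B x <= t i)%R%:R).
have h1 : `|fine 'E_P1[f \o A] - fine 'E_P1[sA]| <= e / 3.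
  have := @mean_close _ _ _ P1 (f \o A) sA (Num.max M MA) (e / 3) N1 mfA mSA.
  rewrite PN1 /= mulr0 addr0; apply => //.
  - by move=> x; rewrite le_max fM.
  - by move=> x; rewrite le_max HMA orbT.
  - exact: ltW.
  - by move=> x /A01 /fclose.
have h2 : `|fine 'E_P2[f \o B] - fine 'E_P2[sB]| <= e / 3.
  have := @mean_close _ _ _ P2 (f \o B) sB (Num.max M MB) (e / 3) set0 mfB mSB.
  rewrite measure0 /= mulr0 addr0; apply => //.
  - by move=> x; rewrite le_max fM.
  - by move=> x; rewrite le_max HMB orbT.
  - exact: ltW.
  - by move=> x _; exact: fclose (B01 x).
have h3 : `|fine 'E_P1[sA] - fine 'E_P2[sB]| <= e / 3.
  rewrite EA EB opprD addrACA subrr add0r -sumrB.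
  apply: le_trans (ler_norm_sum _ _ _) _.
  have -> : e / 3 = \sum_(i < m) ((2 * M + 1) * c).
    rewrite sumr_const card_ord -mulr_natl /c; field.
    by rewrite !gt_eqF.
  apply: ler_sum => i _; rewrite -mulrBr normrM ler_pM //; last exact: AB.
  apply: le_trans (ler_normB _ _) _.
  by have := fM (i%:R / m%:R); have := fM (i.+1%:R / m%:R); lra.
apply: le_trans (ler_distD (fine 'E_P1[sA]) _ _) _.
have : `|fine 'E_P1[sA] - fine 'E_P2[f \o B]| <= e / 3 + e / 3.
  apply: le_trans (ler_distD (fine 'E_P2[sB]) _ _) _; rewrite (distrC (fine 'E_P2[sB])).
  exact: lerD.
lra.
Qed.

End Portmanteau.

(** * The limit as a random path *)
Section LimitElement.
Context {R : realType}.

Lemma levy_trans (e e' : R) x y z : levy e x y -> levy e' y z -> levy (e + e') x z.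
Proof.
move=> [a0 a1 H] [b0 b1 H'].
have e0 : 0 <= e by apply: le_trans a0.
have e0' : 0 <= e' by apply: le_trans b0.
split.
- by apply: le_trans (ler_distD (y 0) _ _) _; exact: lerD.
- by apply: le_trans (ler_distD (y 1) _ _) _; exact: lerD.
- move=> t t' t0 tt t1.
  have := H t (t + e) t0 (lexx _); have := H' (t + e) t'.
  have := H (t + e') t'; have := H' t (t + e') t0 (lexx _).
  have -> : 0 <= t + e by lra.
  have -> : 0 <= t + e' by lra.
  have -> : t + e + e' <= t' by lra.
  have -> : t + e' + e <= t' by lra.
  have -> : t + e <= 1 by lra.
  have -> : t + e' <= 1 by lra.
  move=> /(_ isT)[q1 q2] /(_ isT isT t1)[q3 q4] /(_ isT isT t1)[q5 q6] /(_ isT)[q7 q8].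
  by split; lra.
Qed.

Definition clamp (r : R) : R := Num.max 0 (Num.min r 1).

Lemma clamp_ge0 r : 0 <= clamp r. Proof. by rewrite le_max lexx. Qed.
Lemma clamp_lt1 r : r < 1 -> clamp r < 1. Proof. by move=> r1; rewrite gt_max ltr01 gt_min r1. Qed.
Lemma clamp_id r : 0 <= r <= 1 -> clamp r = r.
Proof. by move=> /andP[r0 r1]; rewrite /clamp (min_idPl r1); apply/max_idPr. Qed.

Lemma clamp_dist r r' : `|clamp r - clamp r'| <= `|r - r'|.
Proof.
suff H a b : a <= b -> clamp a - clamp b <= 0 /\ clamp b - clamp a <= b - a.
  case: (leP r r') => [/H[]|/ltW/H[]] h1 h2.
    by rewrite distrC [leRHS]distrC !ger0_norm; lra.
  by rewrite !ger0_norm; lra.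
move=> ab; rewrite /clamp /Num.max /Num.min.
by case: (ltP a 1) => a1; case: (ltP b 1) => b1; do 2?(case: ltP => ?); split; lra.
Qed.

Definition drop_elt (r : R) : m1_space R := M1Space (drop_is_path (clamp_ge0 r)).

Lemma drop_eltE r s : drop_elt r s = drop_path (clamp r) s.
Proof. by []. Qed.

Lemma drop_elt_levy r r' (e : R) : r < 1 -> r' < 1 -> `|r - r'| <= e ->
  levy e (drop_elt r) (drop_elt r').
Proof.
move=> r1 r'1 rr; apply: drop_levy; rewrite ?clamp_ge0 ?clamp_lt1 //.
exact: le_trans (clamp_dist _ _) rr.
Qed.

Lemma open_m1P (U : set (m1_space R)) (x : m1_space R) : open U -> U x ->
  exists2 e : R, 0 < e & forall y : m1_space R, m1_dist x y < e -> U y.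
Proof. by move=> oU Ux; exact: oU. Qed.

Lemma continuous_m1P (f : m1_space R -> R) (x : m1_space R) (e : R) : continuous f -> 0 < e ->
  exists2 r : R, 0 < r & forall y : m1_space R, m1_dist x y < r -> `|f x - f y| < e.
Proof.
move=> /continuousP fc e0; have := open_m1P (fc _ (ball_open (f x) e)).
move=> /(_ x) H; have /H[r r0 Hr] : (f @^-1` ball (f x) e) x by exact: ballxx.
by exists r => // y /Hr.
Qed.

Lemma levy_near (x : m1_space R) (r : R) : noninc x -> 0 < r ->
  exists2 c : R, 0 < c & forall y : m1_space R, noninc y -> levy c x y -> m1_dist x y < r.
Proof.
move=> nx r0; exists (r / 4); first by rewrite divr_gt0.
move=> y ny L; apply: le_lt_trans (m1_dist_levy _ (m1_is_path x) (m1_is_path y) nx ny L) _.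
  by rewrite ltW // divr_gt0.
lra.
Qed.

Lemma drop_elt_noninc r : noninc (drop_elt r).
Proof. exact: drop_noninc. Qed.

(** Below 1 the limit path depends continuously on its drop time, by drop_levy. *)
Lemma drop_elt_open (U : set (m1_space R)) : open U -> open [set r : R | r < 1 /\ U (drop_elt r)].
Proof.
move=> oU; rewrite openE => r [r1 Ur] /=.
have [e e0 He] := open_m1P oU Ur.
have [c c0 Hc] := levy_near (drop_elt_noninc r) e0.
rewrite /interior; near=> r'.
have r'1 : r' < 1 by near: r'; exact: lt_nbhsl.
split => //; apply/He/Hc; first exact: drop_elt_noninc.
apply: drop_elt_levy => //; apply: ltW; near: r'.
Unshelve. all: by end_near. Qed.

Lemma drop_elt_continuous (f : m1_space R -> R) (s : R) : continuous f -> s < 1 ->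
  continuous (fun r => f (drop_elt (Num.min r s))).
Proof.
move=> fc s1 r; apply/cvgrPdist_lt => e e0.
have [d d0 Hd] := continuous_m1P (drop_elt (Num.min r s)) fc e0.
have [c c0 Hc] := levy_near (drop_elt_noninc (Num.min r s)) d0.
near=> r'; apply/Hd/Hc; first exact: drop_elt_noninc.
apply: drop_elt_levy; rewrite ?gt_min ?s1 ?orbT //.
apply: (@le_trans _ _ `|r - r'|).
  by rewrite /Num.min; do 2?case: ltP => ?; rewrite ler_norml; apply/andP; split;
    have := ler_norm (r - r'); have := ler_norm (r' - r); rewrite (distrC r' r); lra.
apply: ltW; near: r'.
exact: (@nbhsx_ballx R R r c c0).
Unshelve. all: by end_near. Qed.

(** Since Lévy-close monotone paths are close in the M1 topology and the limit
    paths that drop before s form a compact family, a continuous functional is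
    uniformly continuous along this family. *)
Lemma drop_modulus (f : m1_space R -> R) (s e : R) : continuous f -> s < 1 -> 0 < e ->
  exists2 c : R, 0 < c & forall r (x : m1_space R), 0 <= r <= s -> noninc x ->
    levy c x (drop_elt r) -> `|f x - f (drop_elt r)| <= e.
Proof.
move=> fc s1 e0; have := @segment_compact R 0 s => /compact_near_coveringP.
move=> /(_ _ (0 : R)^'+ (fun c r => forall x : m1_space R, noninc x ->
  levy c x (drop_elt r) -> `|f x - f (drop_elt r)| <= e)) H.
have /H : forall r : R, `[0, s]%classic r -> \forall r' \near r & c \near 0^'+,
    forall x : m1_space R, noninc x -> levy c x (drop_elt r') -> `|f x - f (drop_elt r')| <= e.
  move=> r; rewrite /= in_itv /= => /andP[r0 rs]; have e2 : 0 < e / 2 by rewrite divr_gt0.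
  have r1 : r < 1 by exact: le_lt_trans rs s1.
  have [d d0 Hd] := continuous_m1P (drop_elt r) fc e2.
  have [c c0 Hc] := levy_near (drop_elt_noninc r) d0.
  pose g := Num.min (c / 2) (1 - r).
  have g0 : 0 < g by rewrite lt_min divr_gt0 // subr_gt0.
  have gc : g <= c / 2 by rewrite ge_min lexx.
  have g1 : g <= 1 - r by rewrite ge_min lexx orbT.
  exists (ball r g, [set c' : R | c' < c / 2]) => /=.
    split; first exact: nbhsx_ballx.
    by apply: nbhs_right_lt; rewrite divr_gt0.
  move=> [r' c'] [/= rr' cc'] x nx L.
  move: rr'; rewrite /ball /= => rr'.
  have r'1 : r' < 1.
    have := ler_norm (r' - r); rewrite distrC; lra.
  have L1 : levy (c / 2) (drop_elt r) (drop_elt r').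
    by apply: drop_elt_levy => //; lra.
  have h1 : `|f (drop_elt r) - f x| < e / 2.
    apply/Hd/Hc => //.
    by apply: levyW (levy_trans L1 (levy_sym L)); lra.
  have h2 : `|f (drop_elt r) - f (drop_elt r')| < e / 2.
    apply/Hd/Hc; first exact: drop_elt_noninc.
    by apply: levyW L1; lra.
  apply: le_trans (ler_distD (f (drop_elt r)) _ _) _; rewrite (distrC (f x)); lra.
move=> {}H; near (0 : R)^'+ => c; exists c; first by near: c; exact: nbhs_right_gt.
move=> r x r01 nx L.
have : `[0, s] `<=` [set r | forall x : m1_space R, noninc x ->
    levy c x (drop_elt r) -> `|f x - f (drop_elt r)| <= e].
  by near: c; apply: H; exact: at_right_proper_filter.
by move=> /(_ r); apply => //; rewrite /= in_itv.
Unshelve. all: by end_near. Qed.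

End LimitElement.

(** * Functionals of the random history *)
Section Process.
Context {R : realType} {n : nat}.
Implicit Types (p q : nat -> 'S_n) (v : 'I_n).

Lemma isrw_prefix v p q t : (forall k, (k <= t)%N -> p k = q k) ->
  isrw v p t = isrw v q t :> ('I_n -> R).
Proof.
elim: t => [|t IH] pq; apply/funext => w /=; first by rewrite pq.
rewrite pq // IH // => k kt; exact/pq/ltnW.
Qed.

Lemma isrw_tv_prefix v p q t : (forall k, (k <= t)%N -> p k = q k) ->
  isrw_tv v p t = isrw_tv v q t :> R.
Proof. by move=> pq; rewrite /isrw_tv (isrw_prefix v pq). Qed.

Lemma largest_prefix p q t : (forall k, (k <= t)%N -> p k = q k) ->
  largest_components p t = largest_components q t.
Proof.
move=> pq; have E : cdp_edge p t = cdp_edge q t.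
  apply/funext => a; apply/funext => b; apply: eq_existsb => k.
  by rewrite !pq // ltnW.
by rewrite /largest_components E.
Qed.

Lemma drop_set_prefix (e : R) v p q t : (forall k, (k <= t)%N -> p k = q k) ->
  drop_set e v p t -> drop_set e v q t.
Proof.
by move=> pq [et]; rewrite /= (isrw_prefix v pq) (largest_prefix pq).
Qed.

Lemma valid_prefix p q t : (forall k, (k <= t)%N -> p k = q k) -> valid t p -> valid t q.
Proof.
move=> pq [p0 H]; split=> [|k kt]; first by rewrite -pq.
by rewrite -!pq // ?(ltnW kt) //; exact: H.
Qed.

Lemma hit_prefix (eps : nat -> R) (s : R) v p q : s <= 1 ->
  (forall k, (k <= n)%N -> p k = q k) -> hit eps s v p = hit eps s v q.
Proof.
move=> s1 pq; apply: eq_existsb => k; have kn : (k <= n)%N.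
  by apply: leq_trans (tm_len n s1); rewrite -ltnS.
by rewrite pq.
Qed.

(** Freezing the history after time n makes the walk a function of finitely
    many variables, without changing the path on [0, 1]. *)
Definition walk_elt v p : m1_space R :=
  M1Space (step_is_path (fun k => isrw_tv v (fun j => p (minn j n)) k) n).

Lemma walk_elt_prefix v p q : (forall k, (k <= n)%N -> p k = q k) -> walk_elt v p = walk_elt v q.
Proof.
move=> pq; rewrite /walk_elt; have -> // : (fun j => p (minn j n)) = (fun j => q (minn j n)).
by apply/funext => j; rewrite pq // geq_minr.
Qed.

Lemma walk_eltE v p (s : R) : s <= 1 -> walk_elt v p s = isrw_tv v p (tm s n).
Proof.
move=> s1; apply: isrw_tv_prefix => k kt; rewrite (minn_idPl _) //.
exact: leq_trans kt (tm_len n s1).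
Qed.

Lemma walk_elt_csize v p (s : R) : valid n p -> s <= 1 ->
  walk_elt v p s = 1 - (csize (p (tm s n)) v)%:R / n%:R.
Proof.
move=> pv s1; rewrite walk_eltE // isrw_tv_csize //.
by apply: valid_le pv; exact: tm_len.
Qed.

Lemma walk_elt_noninc v p : valid n p -> noninc (walk_elt v p).
Proof.
move=> pv s t s0 st t1; have s1 := le_trans st t1.
rewrite !walk_elt_csize // lerD2l lerN2 ler_wpM2r ?invr_ge0 ?ler0n // ler_nat.
apply: valid_csize_le; last by apply: valid_le pv; exact: tm_len.
by apply: le_truncn; rewrite ler_wpM2r.
Qed.

Lemma walk_elt0 v p : valid n p -> walk_elt v p 0 = 1 - n%:R^-1 :> R.
Proof.
move=> pv; rewrite walk_elt_csize //; congr (_ - _).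
rewrite /tm mul0r truncn0; have [-> _] := pv.
by rewrite csize1 mul1r.
Qed.

Lemma walk_elt1 v p : valid n p -> walk_elt v p 1 = 0 :> R.
Proof.
move=> pv; have n0 : (0 < n)%N by case: (v) => m; apply: leq_ltn_trans.
rewrite walk_elt_csize // /tm mul1r natrK.
have E : csize (p n) v = n.
  apply/eqP; rewrite eqn_leq csize_le -{1}(valid_last (R := R) v (valid_le (leq_pred n) pv)).
  by apply: valid_csize_le pv; exact: leq_pred.
by rewrite E divff ?subrr // pnatr_eq0 -lt0n.
Qed.

Lemma walk_elt_le1 v p (s : R) : valid n p -> s <= 1 -> walk_elt v p s <= 1.
Proof.
by move=> pv s1; rewrite walk_elt_csize // gerBl divr_ge0.
Qed.

Context {d : measure_display} {T : measurableType d} (P : probability T R)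
  (Pi : T -> nat -> 'S_n) (PiP : is_cdp P Pi).

Lemma walk_borel v : borel_random_element (fun x => walk_elt v (Pi x)).
Proof.
move=> U _; apply: (measurable_prefix PiP (t := n) (A := fun p => U (walk_elt v p))).
by move=> p q pq; rewrite (walk_elt_prefix v pq).
Qed.

(** The drop-down time takes countably many values, each on an event that is
    determined by finitely many steps, except for the event that it is an
    infimum over the empty set. *)
Lemma measurable_drop (e : R) v (B : set R) :
  measurable [set x | B (drop_down_time e v (Pi x) / n%:R)].
Proof.
pose A k p := drop_set e v p k.
have mA k : measurable [set x | A k (Pi x)].
  by apply: (measurable_prefix PiP (t := k)) => p q; exact: drop_set_prefix.
have mC : measurable (\bigcap_k ~` [set x | A k (Pi x)]).
  by apply: bigcapT_measurable => k; exact: measurableC.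
have mB k : measurable ([set x | A k (Pi x)] `&` \bigcap_(j in `I_k) ~` [set x | A j (Pi x)]
    `&` [set _ | B (k%:R / n%:R)]).
  apply: measurableI; last by case: (pselect (B (k%:R / n%:R))) => H; 
    [rewrite (_ : [set _ | _] = setT)|rewrite (_ : [set _ | _] = set0)] => //; apply/seteqP; split.
  apply: measurableI => //; apply: bigcap_measurableType => j _; exact: measurableC.
have m0 : measurable ((\bigcap_k ~` [set x | A k (Pi x)]) `&` [set _ | B (0 / n%:R)]).
  apply: measurableI => //; case: (pselect (B (0 / n%:R))) => H; 
    [rewrite (_ : [set _ | _] = setT)|rewrite (_ : [set _ | _] = set0)] => //; apply/seteqP; split => //.
rewrite (_ : [set x | _] = (\bigcap_k ~` [set x | A k (Pi x)]) `&` [set _ | B (0 / n%:R)] `|`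
    \bigcup_k ([set x | A k (Pi x)] `&` \bigcap_(j in `I_k) ~` [set x | A j (Pi x)]
    `&` [set _ | B (k%:R / n%:R)])).
  by apply: measurableU => //; exact: bigcupT_measurable.
apply/seteqP; split => x /=.
  rewrite /drop_down_time -/(drop_set _ _ _) => Bx.
  case: (pselect (exists k, A k (Pi x))) => [[k Ak]|nA].
    have [j [Aj jmin jE]] := inf_nat (R := R) Ak.
    right; exists j => //; split; last by rewrite -jE.
    by split=> // i /= ij Ai; have := jmin _ Ai; rewrite leqNgt ij.
  left; split; first by move=> k _ Ak; apply: nA; exists k.
  move: Bx; rewrite (_ : image _ _ = set0) ?inf0 //.
  by apply/seteqP; split => // u [k Ak _]; apply: nA; exists k.
rewrite /drop_down_time -/(drop_set _ _ _) => -[[nA]|[k _ [[Ak nA]]]].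
  rewrite (_ : image _ _ = set0) ?inf0 //.
  by apply/seteqP; split => // u [k Ak _]; exact: (nA k I Ak).
have [j [Aj jmin jE]] := inf_nat (R := R) Ak; rewrite jE.
have jk := jmin _ Ak; have : ~ (j < k)%N by move=> /nA /(_ Aj).
by move=> /negP; rewrite -leqNgt => kj; have -> : j = k by apply/eqP; rewrite eqn_leq jk.
Qed.

Lemma measurable_invalid : measurable [set x | ~ valid n (Pi x)].
Proof.
apply: (measurable_prefix PiP (t := n) (A := fun p => ~ valid n p)) => p q pq np qv.
by apply/np/(valid_prefix _ qv) => k /pq.
Qed.

Lemma law_invalid : P [set x | ~ valid n (Pi x)] = 0%E.
Proof.
rewrite (_ : [set x | _] = [set x | `[< ~ valid n (Pi x) >]]); last first.
  by apply/seteqP; split => x /=; move/asboolP.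
rewrite (law_prefix PiP (t := n) (A := fun p => `[< ~ valid n p >])); last first.
  move=> p q pq; apply/asboolP/asboolP => h pv; apply: h.
    by apply: valid_prefix pv => k /pq.
  exact: valid_prefix pv.
congr (_%:E); rewrite -[RHS](Ex_cst (n := n) n); apply: Ex_eq => p pv.
by case: asboolP.
Qed.

Lemma ae_event (A B N : set T) : measurable A -> measurable B -> measurable N ->
  P N = 0%E -> (forall x, ~ N x -> (A x <-> B x)) -> P A = P B.
Proof.
move=> mA mB mN N0 AB.
have sub (C D : set T) : measurable C -> measurable D ->
    (forall x, ~ N x -> C x -> D x) -> (P C <= P D)%E.
  move=> mC mD CD; apply: (@le_trans _ _ (P (D `|` N))).
    apply: le_measure; rewrite ?inE //; first exact: measurableU.
    by move=> x Cx; case: (pselect (N x)) => Nx; [right|left; exact: CD].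
  by rewrite -[leRHS]adde0 -{}N0; exact: measureU2.
by apply/eqP; rewrite eq_le !sub // => x /AB[].
Qed.

Lemma law_drop (eps : nat -> R) (s : R) v : 0 <= s -> s <= 1 ->
  n%:R / 2 * (1 + eps n) < n%:R ->
  P [set x | drop_down_time (eps n) v (Pi x) / n%:R <= s] = (Pr n (hit eps s v))%:E.
Proof.
move=> s0 s1 en; have pre p q : (forall k, (k <= n)%N -> p k = q k) -> hit eps s v p = hit eps s v q.
  exact: hit_prefix.
rewrite -(law_prefix PiP pre).
apply: (ae_event (N := [set x | ~ valid n (Pi x)])).
- exact: (measurable_drop (eps n) v [set t | t <= s]).
- by apply: (measurable_prefix PiP (t := n) (A := hit eps s v)) => p q /pre ->.
- exact: measurable_invalid.
- exact: law_invalid.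
- by move=> x /contrapT xv /=; rewrite drop_le_hit.
Qed.

End Process.

(** * The two limits *)
Section Limits.
Context {R : realType} (eps : nat -> R).
Hypotheses (eps_gt0 : forall n, (0 < n)%N -> 0 < eps n) (eps_o1 : eps @ \oo --> 0).
Context (d : nat -> measure_display) (T : forall n, measurableType (d n))
  (P : forall n, probability (T n) R) (Pi : forall n, T n -> nat -> 'S_n)
  (PiP : forall n, is_cdp (P n) (@Pi n)).
Context (d0 : measure_display) (T0 : measurableType d0) (P0 : probability T0 R)
  (s_down : {RV P0 >-> R}) (s_down01 : forall x, 0 <= s_down x <= 1)
  (s_down_law : forall s : R, 0 <= s <= 1 ->
       P0 [set x | s_down x <= s] = (cdp_eta s)%:E).

Local Notation Pr := (@Pr R _).
Local Notation drop n v x := (drop_down_time (eps n) v (Pi x) / n%:R).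

Lemma eventually_all (Q : nat -> nat -> Prop) (m : nat) :
  (forall i, (i < m)%N -> exists n0, forall n, (n0 <= n)%N -> Q i n) ->
  exists n0, forall n, (n0 <= n)%N -> forall i, (i < m)%N -> Q i n.
Proof.
elim: m => [|m IH] H; first by exists 0%N.
have [i im|n1 H1] := IH; first by apply: H; exact: leq_trans im _.
have [n2 H2] := H m (ltnSn m); exists (maxn n1 n2) => n; rewrite geq_max => /andP[h1 h2] i.
by rewrite ltnS leq_eqVlt => /orP[/eqP ->|]; [exact: H2|exact: H1].
Qed.

Lemma window_small : exists n0, forall n, (n0 <= n)%N -> (0 < n)%N /\ n%:R / 2 * (1 + eps n) < n%:R.
Proof.
have /cvgrPdist_lt/(_ 1 ltr01) [n1 _ H] := eps_o1.
exists n1.+1 => n nn; have n0 : (0 < n)%N by apply: leq_trans nn.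
split=> //; have := H n (ltnW nn); rewrite /= sub0r normrN => /(le_lt_trans (ler_norm _)) h.
have N0 : 0 < n%:R :> R by rewrite ltr0n.
by rewrite -mulrA gtr_pMr //; lra.
Qed.

Lemma cdf_limit (s e : R) : 0 <= s -> s < 1 -> 0 < e -> exists n0, forall n, (n0 <= n)%N ->
  forall v : 'I_n, `|fine (P n [set x | drop n v x <= s]) - cdp_eta s| <= e.
Proof.
move=> s0 s1 e0; have [n1 H1] := window_small.
move: s0; rewrite le_eqVlt => /orP[/eqP <-|s0].
  exists n1 => n /H1[n0 en] v.
  rewrite (law_drop (PiP n)) //= eta_small ?invr_ge0 // subr0 /Pr.
  rewrite (Ex_eq (g := fun=> 0)) ?Ex_cst ?normr0 ?ltW // => p _.
  case: (boolP (hit _ _ _ _)) => // /existsP[[k kt] /= /andP[]].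
  move: kt; rewrite /tm mul0r truncn0 ltnS leqn0 => /eqP -> /=.
  rewrite ltNge mulr_ge0 ?divr_ge0 ?ler0n ?addr_ge0 ?ler01 //.
  by apply/ltW/eps_gt0.
have [n2 H2] := cycle_limit eps_gt0 eps_o1 s0 s1 e0.
exists (maxn n1 n2) => n; rewrite geq_max => /andP[/H1[n0 en] nn] v.
rewrite (law_drop (PiP n)) //=; [by have [] := H2 n nn v|exact: ltW|exact: ltW].
Qed.

Lemma drop_in01 n v : n%:R / 2 * (1 + eps n) < n%:R ->
  exists N : set (T n), [/\ measurable N, P n N = 0%E & forall x, ~ N x -> 0 <= drop n v x <= 1].
Proof.
move=> en; exists [set x | ~ valid n (Pi x)]; split.
- exact: measurable_invalid (PiP n).
- exact: law_invalid (PiP n).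
- by move=> x /contrapT xv; exact: drop_bounds.
Qed.

Lemma drop_measurable n (v : 'I_n) : measurable_fun setT (fun x : T n => drop n v x).
Proof. by move=> _ B mB; rewrite setTI; exact: (measurable_drop (PiP n) (eps n) v B). Qed.

Lemma drop_limit (f : R -> R) (M e : R) : continuous f -> (forall x, `|f x| <= M) -> 0 < e ->
  exists n0, forall n, (n0 <= n)%N -> forall v : 'I_n,
    `|fine 'E_(P n)[f \o (fun x => drop n v x)] - fine 'E_P0[f \o s_down]| <= e.
Proof.
move=> fc fM e0; have [m [c c0 H]] := cdf_close fc fM e0.
have [n1 H1] := window_small.
have [i im|n2 H2] := @eventually_all (fun i n => forall v : 'I_n,
    `|fine (P n [set x | drop n v x <= i%:R / m%:R]) - cdp_eta (i%:R / m%:R)| <= c) m.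
  have m0 : (0 < m)%N by apply: leq_ltn_trans im.
  have M0 : 0 < m%:R :> R by rewrite ltr0n.
  by apply: cdf_limit; rewrite ?divr_ge0 // ltr_pdivrMr // mul1r ltr_nat.
exists (maxn n1 n2) => n; rewrite geq_max => /andP[/H1[n0 en] nn] v.
apply: H => //; first exact: drop_measurable.
  exact: drop_in01.
move=> i im; have m0 : (0 < m)%N by apply: leq_ltn_trans im.
have M0 : 0 < m%:R :> R by rewrite ltr0n.
rewrite [X in _ - fine X]s_down_law; first exact: H2.
by rewrite divr_ge0 //= ler_pdivrMr // mul1r ler_nat ltnW.
Qed.

Lemma eta_near1 (e : R) : 0 < e -> exists2 s : R, 2^-1 < s < 1 & 1 - e < cdp_eta s.
Proof.
move=> e0; have [c c0 H] := eta_continuous (ler01 : 0 <= 1 :> R) (lexx 1) e0.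
pose s : R := Num.max (3 / 4) (1 - c / 2).
have s1 : s < 1 by rewrite gt_max; apply/andP; split; lra.
have s2 : 3 / 4 <= s by rewrite le_max lexx.
have s3 : 1 - c / 2 <= s by rewrite le_max lexx orbT.
exists s; first by apply/andP; split; lra.
have s0 : 0 <= s by lra.
have sc : `|s - 1| < c by rewrite ltr_norml; apply/andP; split; lra.
by have := H s s0 (ltW s1) sc; rewrite eta1 ltr_norml => /andP[h _]; lra.
Qed.

Lemma natV_small (e : R) : 0 < e -> exists2 n0 : nat, (0 < n0)%N &
  forall n, (n0 <= n)%N -> n%:R^-1 <= e.
Proof.
move=> e0; exists (Num.truncn e^-1).+1 => // n nn.
have n0 : (0 < n)%N by apply: leq_trans nn.
rewrite -[leRHS]invrK lef_pV2 ?posrE ?invr_gt0 ?ltr0n //.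
apply/ltW/(lt_le_trans (truncnS_gt _)); by rewrite ler_nat.
Qed.

(** The exceptional set N consists of the invalid histories, of those whose
    drop-down time exceeds s n, which have probability about 1 - eta s, and of
    those that violate the estimate of cycle_limit at some point of a fine grid.
    Elsewhere grid_levy compares the walk with the limit path that drops at the
    same time as the walk. *)
Lemma walk_near_drop (s a b : R) : 2^-1 < s -> s < 1 -> 0 < a -> 0 < b ->
  exists n0, forall n, (n0 <= n)%N -> forall v : 'I_n, exists N : set (T n),
    [/\ measurable N, fine (P n N) <= 1 - cdp_eta s + b &
     forall x, ~ N x -> [/\ valid n (Pi x), 0 <= drop n v x <= s &
       levy a (walk_elt v (Pi x)) (drop_elt (drop n v x))]].
Proof.
move=> s2 s1 a0 b0; have s0 : 0 < s by lra.
have a2 : 0 < a / 2 by rewrite divr_gt0.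
have b2 : 0 < b / 2 by rewrite divr_gt0.
have [m m0 Hm] := natV_small a2.
have M0 : 0 < m%:R :> R by rewrite ltr0n.
pose c := Num.min (a / 2) (b / 2 / m%:R).
have c0 : 0 < c by rewrite lt_min a2 divr_gt0.
have ca : c <= a / 2 by rewrite ge_min lexx.
have cb : m%:R * c <= b / 2.
  by rewrite -ler_pdivlMl // mulrC ge_min lexx orbT.
pose bad n (v : 'I_n) i (p : nat -> 'S_n) := let t : R := i%:R / m%:R in
  if hit eps t v p then c < `|(csize (p (tm t n)) v)%:R / n%:R - cdp_eta t|
  else c < (csize (p (tm t n)) v)%:R / n%:R.
have [n1 H1] := window_small.
have [n2 _ H2] := natV_small a2.
have [n3 H3] := cycle_limit eps_gt0 eps_o1 s0 s1 b2.
have [i im|n4 H4] := @eventually_all (fun i n => (0 < i)%N -> forall v : 'I_n,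
    Pr n (bad n v i) <= c) m.
  case: (posnP i) => [->|i0]; first by exists 0%N.
  have i1 : 0 < i%:R / m%:R :> R by rewrite divr_gt0 // ltr0n.
  have i2 : i%:R / m%:R < 1 :> R by rewrite ltr_pdivrMr // mul1r ltr_nat.
  have [n5 H5] := cycle_limit eps_gt0 eps_o1 i1 i2 c0.
  by exists n5 => n /H5 H _ v; have [] := H v.
exists (maxn (maxn n1 n2) (maxn n3 n4)) => n; rewrite !geq_max => /andP[/andP[nn1 nn2] /andP[nn3 nn4]] v.
have [n0 en] := H1 n nn1.
have grid_le1 (i : nat) : (i < m)%N -> i%:R / m%:R <= 1 :> R.
  by move=> im; rewrite ler_pdivrMr // mul1r ler_nat ltnW.
pose A p := [|| `[< ~ valid n p >], ~~ hit eps s v p |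
  [exists i : 'I_m, (0 < i)%N && bad n v i p]].
have Apre p q : (forall k, (k <= n)%N -> p k = q k) -> A p = A q.
  move=> pq; rewrite /A (hit_prefix eps v (ltW s1) pq); congr [|| _, _ | _].
    apply/asboolP/asboolP => h pv; apply: h.
      by apply: valid_prefix pv => k /pq.
    exact: valid_prefix pv.
  apply: eq_existsb => i; congr (_ && _); rewrite /bad.
  have i1 := grid_le1 i (ltn_ord i).
  by rewrite (hit_prefix eps v i1 pq) pq // tm_len.
exists [set x | A (Pi x)]; split.
- by apply: (measurable_prefix (PiP n) (t := n) (A := A)) => p q /Apre ->.
- rewrite (law_prefix (PiP n) Apre) /=.
  have E : Pr n A <= (1 - Pr n (hit eps s v)) + \sum_(i < m | (0 < i)%N) Pr n (bad n v i).
    rewrite /Pr -Ex_sum -[X in _ <= X - _ + _](Ex_cst (n := n) n) -[X in _ + X + _]mulN1r -ExZ -!ExD.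
    apply: Ex_le => p pv; rewrite /A; case: asboolP => // _; rewrite orFb mulN1r.
    case: (hit eps s v p) => /=; last first.
      by rewrite subr0 lerDl sumr_ge0.
    rewrite subrr add0r; case: existsP => [[i /andP[i0 bi]]|_]; last by rewrite sumr_ge0.
    by rewrite (bigD1 i) //= bi lerDl sumr_ge0.
  have S : \sum_(i < m | (0 < i)%N) Pr n (bad n v i) <= b / 2.
    apply: le_trans cb; rewrite mulr_natl -[X in _ *+ X]card_ord -sumr_const.
    rewrite big_mkcond /=; apply: ler_sum => i _; case: ifP => [i0|_]; last exact: ltW.
    exact: H4.
  have [h _] := H3 n nn3 v; move: h; rewrite ler_norml => /andP[h _].
  lra.
- move=> x /= nA; have xv : valid n (Pi x).
    by apply: contrapT => nv; apply: nA; rewrite /A asboolT.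
  move: nA; rewrite /A (asboolF (fun h : ~ valid n (Pi x) => h xv)) orFb => /negP.
  rewrite negb_or negbK => /andP[hx nb].
  have t01 : 0 <= drop n v x <= 1 by exact: drop_bounds.
  have ts : drop n v x <= s by rewrite drop_le_hit // ltW.
  have /andP[t0 _] := t01.
  split => //; first by rewrite t0.
  have -> : a = 2 * (a / 2) by lra.
  rewrite /drop_elt; apply: (@levyW _ (2 * (a / 2))) => //.
  suff : levy (2 * (a / 2)) (walk_elt v (Pi x)) (drop_path (drop n v x)).
    by rewrite /= clamp_id.
  apply: (@grid_levy _ _ _ m) => //.
  + exact: Hm.
  + exact: walk_elt_noninc.
  + exact: le_lt_trans ts s1.
  + rewrite walk_elt0 // addrAC subrr sub0r normrN ger0_norm ?invr_ge0 //.
    exact: H2.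
  + exact: walk_elt1.
  + move=> i i0 im; have i1 := grid_le1 i im.
    rewrite drop_le_hit // ?divr_ge0 // walk_elt_csize // subKr.
    move: nb; rewrite negb_exists => /forallP /(_ (Ordinal im)) /=; rewrite i0 /bad /=.
    by case: ifP => _; rewrite -leNgt => h; exact: le_trans h ca.
  + by move=> u u0 u1; exact: walk_elt_le1.
Qed.

(** The value s_down = 1, where continuity in the drop time fails, is a separate
    measurable piece. *)
Lemma limit_path_borel : borel_random_element (fun x => drop_elt (s_down x)).
Proof.
move=> U oU; have ms (B : set R) : measurable B -> measurable (s_down @^-1` B).
  by move=> mB; rewrite -[X in measurable X]setTI; exact: measurable_funPT.
rewrite (_ : _ @^-1` U = s_down @^-1` [set r | r < 1 /\ U (drop_elt r)] `|`
   s_down @^-1` [set r | r = 1 /\ U (drop_elt 1)]).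
  apply: measurableU; apply: ms; first by apply: open_measurable; exact: drop_elt_open.
  case: (pselect (U (drop_elt 1))) => U1.
    by rewrite (_ : [set _ | _] = [set 1]) //; apply/seteqP; split => r /=; [case|].
  by rewrite (_ : [set _ | _] = set0) //; apply/seteqP; split => r //= [].
apply/seteqP; split => x /= => [Ux|[[]|[->]]//].
have /andP[_] := s_down01 x; rewrite le_eqVlt => /orP[/eqP E|]; last by left.
by right; split => //; rewrite -E.
Qed.

(** A bounded continuous f of the walk is close to g, the value of f at the
    limit path that drops at the drop-down time. Drop times are cut off at some
    s < 1 to make g continuous, and then drop_limit applies to g. *)
Lemma path_limit (f : m1_space R -> R) (M e : R) : continuous f -> (forall x, `|f x| <= M) -> 0 < e ->
  exists n0, forall n, (n0 <= n)%N -> forall v : 'I_n,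
    `|fine 'E_(P n)[f \o (fun x => walk_elt v (Pi x))] -
      fine 'E_P0[f \o (fun x => drop_elt (s_down x))]| <= e.
Proof.
move=> fc fM e0.
have M0 : 0 <= M by apply: le_trans (fM (drop_elt 0)).
pose c := e / (4 + 6 * M).
have D0 : 0 < 4 + 6 * M by lra.
have c0 : 0 < c by rewrite divr_gt0.
have ce : c * (4 + 6 * M) = e by rewrite /c divfK // gt_eqF.
have [s /andP[s2 s1] es] := eta_near1 c0.
have [a a0 Ha] := drop_modulus fc s1 c0.
pose g r := f (drop_elt (Num.min r s)).
have gc : continuous g by exact: drop_elt_continuous.
have gM x : `|g x| <= M by exact: fM.
have [n1 H1] := drop_limit gc gM c0.
have [n2 H2] := walk_near_drop s2 s1 a0 c0.
have mf (d1 : measure_display) (T1 : measurableType d1) (X : T1 -> m1_space R) :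
    borel_random_element X -> measurable_fun setT (f \o X).
  move=> BX; apply: (measurability _ (RGenOpens.measurableE R)).
  by move=> _ [_ [a' [b' ->]] <-]; rewrite setTI; apply: (BX (f @^-1` `]a', b'[%classic)); move/continuousP: fc; apply; exact: interval_open.
have mg : measurable_fun setT g by exact: continuous_measurable_fun.
exists (maxn n1 n2) => n; rewrite geq_max => /andP[nn1 nn2] v.
have [N [mN PN HN]] := H2 n nn2 v.
have E1 : `|fine 'E_(P n)[f \o (fun x => walk_elt v (Pi x))] -
    fine 'E_(P n)[g \o (fun x => drop n v x)]| <= c + 2 * M * fine (P n N).
  apply: mean_close => //; last 2 first.
  - exact: ltW.
  - move=> x /HN[xv /andP[t0 ts] L]; rewrite /g /= (min_idPl ts).
    by apply: Ha => //; [rewrite t0|exact: walk_elt_noninc].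
  - exact/mf/(walk_borel (PiP n)).
  - by apply: measurableT_comp => //; exact: drop_measurable.
  - by move=> x; exact: fM.
  - by move=> x; exact: gM.
have mS : measurable [set x | s_down x <= s].
  rewrite (_ : [set x | _] = s_down @^-1` `]-oo, s]).
    by rewrite -[X in measurable X]setTI; exact: measurable_funPT.
  by apply/seteqP; split => x; rewrite /= in_itv.
have E2 : `|fine 'E_P0[f \o (fun x => drop_elt (s_down x))] - fine 'E_P0[g \o s_down]| <=
    c + 2 * M * fine (P0 (~` [set x | s_down x <= s])).
  apply: mean_close => //; last 3 first.
  - exact: measurableC.
  - exact: ltW.
  - move=> x /contrapT /= xs; rewrite /g /= (min_idPl xs) subrr normr0; exact: ltW.
  - exact/mf/limit_path_borel.
  - by apply: measurableT_comp => //.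
  - by move=> x; exact: fM.
  - by move=> x; exact: gM.
have E3 := H1 n nn1 v.
rewrite probability_setC // s_down_law in E2; last by apply/andP; split; lra.
rewrite -EFinB /= in E2.
have P1 : fine (P n N) <= 2 * c by lra.
have Q1 : M * fine (P n N) <= M * (2 * c) by exact: ler_wpM2l.
have Q2 : M * (1 - cdp_eta s) <= M * c by apply: ler_wpM2l => //; lra.
move: E1 E2 E3; rewrite !ler_norml => /andP[p1 p2] /andP[p3 p4] /andP[p5 p6].
by apply/andP; split; lra.
Qed.

End Limits.

Theorem theorem1 (R : realType)
    (eps : nat -> R)
    (eps_gt0 : forall n, (0 < n)%N -> 0 < eps n)
    (eps_omega : (fun n : nat => eps n / n%:R `^ (- 3^-1)) @ \oo --> +oo)
    (eps_o1 : eps @ \oo --> 0)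
    (d : nat -> measure_display) (T : forall n, measurableType (d n))
    (P : forall n, probability (T n) R)
    (Pi : forall n, T n -> nat -> 'S_n)
    (Pi_cdp : forall n, is_cdp (P n) (Pi n))
    (d0 : measure_display) (T0 : measurableType d0) (P0 : probability T0 R)
    (s_down : {RV P0 >-> R})
    (s_down01 : forall x, 0 <= s_down x <= 1)
    (s_down_law : forall s : R, 0 <= s <= 1 ->
       P0 [set x | s_down x <= s] = (cdp_eta s)%:E) :
  cvg_in_law_unif P
    (fun n v0 x => drop_down_time (eps n) v0 (Pi n x) / n%:R)
    P0 s_down
  /\
  exists (X : forall n, 'I_n -> T n -> m1_space R) (Y : T0 -> m1_space R),
    [/\ forall n v0 x (s : R), 0 <= s <= 1 ->
          X n v0 x s = isrw_tv v0 (Pi n x) (Num.truncn (s * n%:R)),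
        forall x (s : R), 0 <= s <= 1 ->
          Y x s = 1 - cdp_eta s * (s_down x < s)%R%:R &
        cvg_in_law_unif P X P0 Y].
Proof.
split.
  split=> [n v U oU|U oU|f fc [M fM] e e0].
  - exact: (measurable_drop (Pi_cdp n)).
  - rewrite -[X in measurable X]setTI; apply: measurable_funPT => //; exact: open_measurable.
  - have e2 : 0 < e / 2 by rewrite divr_gt0.
    have [n0 H] := drop_limit eps_gt0 eps_o1 Pi_cdp s_down01 s_down_law fc fM e2.
    exists n0 => // n /= nn v; apply: le_lt_trans (H n nn v) _.
    by rewrite ltr_pdivrMr // ltr_pMr // ltr1n.
exists (fun n v0 x => walk_elt v0 (Pi n x)), (fun x => drop_elt (s_down x)); split.
- by move=> n v0 x s /andP[_ s1]; exact: walk_eltE.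
- by move=> x s _; rewrite drop_eltE clamp_id.
split=> [n v|U oU|f fc [M fM] e e0].
- exact: walk_borel (Pi_cdp n) v.
- exact: limit_path_borel oU.
- have e2 : 0 < e / 2 by rewrite divr_gt0.
  have [n0 H] := path_limit eps_gt0 eps_o1 Pi_cdp s_down01 s_down_law fc fM e2.
  exists n0 => // n /= nn v; apply: le_lt_trans (H n nn v) _.
  by rewrite ltr_pdivrMr // ltr_pMr // ltr1n.
Qed.
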